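(* Let $G=(P,B)$ be an irreducible braced triangulation with $b=|B|\geq 1$ braces. Then $|V(P)|\leq 11b-4$.
   Context: A sphere graph is a simple graph with a fixed embedding in the 2-sphere without edge crossings. A (sphere) triangulation $P$ is a maximal sphere graph with at least 3 vertices. An edge $e$ of $P$ is contractible in $P$ if it belongs to precisely two 3-cycles of $P$. A braced triangulation $G=(P,B)$ is the simple graph obtained from a triangulation $P$ by adjoining a set $B$ of additional edges (braces) joining pairs of vertices of $P$ that are not adjacent in $P$. An edge $e$ of $P$ is contractible in $G$ if $e$ is contractible in $P$ and $e$ does not belong to any 3-cycle of $G$ that contains a brace. $G$ is irreducible if no edge of $P$ is contractible in $G$. *)

(* Defs.v *)
From HB Require Import structures.
From mathcomp Require Import all_boot all_order all_algebra.
From mathcomp Require Import all_classical all_reals all_analysis.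

Set Implicit Arguments.
Unset Strict Implicit.
Unset Printing Implicit Defensive.

Import Order.TTheory GRing.Theory Num.Theory.
Import numFieldNormedType.Exports.

Local Open Scope classical_set_scope.
Local Open Scope ring_scope.

Definition sphere2 (R : realType) : set 'rV[R]_3 :=
  [set x | \sum_(i < 3) x 0 i ^+ 2 = 1].

Definition simple_arc (R : realType) (p q : 'rV[R]_3) (A : set 'rV[R]_3) :=
  exists g : R -> 'rV[R]_3,
    [/\ {within `[0, 1], continuous g},
        {in `[0, 1] &, injective g},
        g 0 = p, g 1 = q & g @` `[0, 1] = A].

(* An edge is the two-element set of its ends. The value of [edge_arc]
   outside [edges] is irrelevant. *)
Record sphere_graph (R : realType) (V : finType) := SphereGraph {
  edges : {set {set V}};
  vertex_point : V -> 'rV[R]_3;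
  edge_arc : {set V} -> set 'rV[R]_3;
  edges_card2 : forall f, f \in edges -> #|f| = 2%N;
  point_sphere : forall v, sphere2 (vertex_point v);
  point_inj : injective vertex_point;
  arc_sphere : forall f, f \in edges -> edge_arc f `<=` @sphere2 R;
  arc_simple : forall u v, [set u; v]%SET \in edges ->
    simple_arc (vertex_point u) (vertex_point v) (edge_arc [set u; v]%SET);
  arc_point : forall f v, f \in edges -> edge_arc f (vertex_point v) -> v \in f;
  arc_cross : forall f g, f \in edges -> g \in edges -> f != g ->
    edge_arc f `&` edge_arc g `<=` range vertex_point }.

(* [Q] has the same vertices as [P] and its embedding extends that of [P].    *)
Definition sphere_extends (R : realType) (V : finType)
    (P Q : sphere_graph R V) : Prop :=
  [/\ edges P \subset edges Q,
      forall v, vertex_point Q v = vertex_point P v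
    & forall f, f \in edges P -> edge_arc Q f = edge_arc P f].

Definition triangulation (R : realType) (V : finType)
    (P : sphere_graph R V) : Prop :=
  (3 <= #|V|)%N /\
  forall Q : sphere_graph R V, sphere_extends P Q -> edges Q = edges P.

(* The 3-cycles of a simple graph, each given by its vertex set.              *)
Definition cycles3 (V : finType) (E : {set {set V}}) : {set {set V}} :=
  [set T : {set V} | (#|T| == 3%N) &&
    [forall f : {set V}, (#|f| == 2%N) && (f \subset T) ==> (f \in E)]]%SET.

Definition contractible (V : finType) (E : {set {set V}}) (f : {set V}) : Prop :=
  f \in E /\ #|[set T in cycles3 E | f \subset T]%SET| = 2%N.

Definition braces (V : finType) (E B : {set {set V}}) : Prop :=
  forall f, f \in B -> #|f| = 2%N /\ f \notin E.

Definition braced_contractible (V : finType) (E B : {set {set V}})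
    (f : {set V}) : Prop :=
  contractible E f /\
  ~ exists T : {set V}, exists g : {set V},
      [/\ T \in cycles3 (E :|: B)%SET, f \subset T, g \in B & g \subset T].

Definition braced_irreducible (V : finType) (E B : {set {set V}}) : Prop :=
  forall f, f \in E -> ~ braced_contractible E B f.

(* Main.v *)
Require Import Defs.
From mathcomp Require Import all_boot all_order all_algebra.
From mathcomp Require Import all_classical all_reals all_analysis.
From mathcomp Require Import complex.
From mathcomp Require Import ring lra zify.

Set Implicit Arguments.
Unset Strict Implicit.
Unset Printing Implicit Defensive.

Import Order.TTheory GRing.Theory Num.Theory.
Import numFieldNormedType.Exports.

Local Open Scope classical_set_scope.
Local Open Scope ring_scope.

(* Eilenberg's criterion describes the faces of a compact plane set K by the maps from K to
   the unit circle that have a continuous argument. It shows that an arc added to a plane drawing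
   keeps the number of faces when it joins two components and splits one face in two otherwise,
   which is Euler's formula. Hence a set X of at least 3 vertices spans at most 3|X| - 6 edges; if
   equality holds and |X| >= 4, the faces are distinct triangles, so an edge lies in at least two
   3-cycles, and among three 3-cycles through an edge one is not a face and separates X.
   A triangulation attains equality for X = V: a vertex on the boundary of a face is
   accessible from it by an arc, so the vertices of a face are pairwise adjacent.

   Cut P along separating 3-cycles. A piece X keeps the set M of the 3-cycles along which
   it was cut or that were marked before, and the set H of its half braces, so that irreducibility
   still explains every edge that lies in exactly two 3-cycles. The bound
   2|X| + 8 <= 7|M| + 11|H| is stable under gluing. In a piece that cannot be cut each
   edge is in exactly two 3-cycles; an unmarked edge has an end in the set A of ends of half braces,
   so each of the 2|X| - 4 3-cycles contains a marked edge or an edge spanned by A, and A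
   spans at most 3|A| - 6 edges. For X = V there are no marks and 2|B| half braces. *)

(** * Plane topology *)

(** The arcs of a drawing are merely continuous: they may spiral, and the drawing has no normal form
    near a vertex or an edge. So separation is never read off a local picture but derived from
    arguments of maps on compact sets. The one local fact about a vertex, that it can be reached
    from a face, rests on a finite count of sectors. A cut may separate the ends of a brace. A brace
    is therefore treated as two ordered half braces [(x, z)], each of which can only stay in a part
    that contains [x]; the lost end [z] is remembered by a set [D z] that stands for its neighbours.
    A cut counts three vertices twice and marks one 3-cycle in both parts. With weight w per mark
    and additive constant c, gluing needs c + 6 <= 2w, and c = 8, w = 7 meet this with equality.
    Half braces are shared out between the parts, so their weight does not enter here. The value 11
    comes from the pieces with one mark and one half brace, where the count of 3-cycles still allows
    |X| = 5. Two half braces per brace turn the bound into |V| + 4 <= 11|B|. *)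

Definition cont_on (X Y : topologicalType) (A : set X) (f : X -> Y) :=
  forall x, A x -> f @ within A (nbhs x) --> f x.

Section ContOn.
Variables X Y Z : topologicalType.

Lemma cont_onP (A : set X) (f : X -> Y) :
  {within A, continuous f} <-> cont_on A f.
Proof. exact: subspace_continuousP. Qed.

Lemma continuous_cont_on (A : set X) (f : X -> Y) :
  continuous f -> cont_on A f.
Proof. by move=> cf x _; apply: cvg_within_filter; exact: cf. Qed.

Lemma cont_on_sub (A B : set X) (f : X -> Y) :
  B `<=` A -> cont_on A f -> cont_on B f.
Proof.
move=> BA cf x /BA/cf; apply: cvg_trans; apply: cvg_app.
exact: within_subset.
Qed.

Lemma cont_on_open (A : set X) (f : X -> Y) :
  open A -> cont_on A f -> forall x, A x -> {for x, continuous f}.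
Proof.
move=> oA cf x Ax; have := cf x Ax.
by rewrite within_interior//; apply: open_nbhs_nbhs.
Qed.

Lemma cont_on_eq (A : set X) (f g : X -> Y) :
  (forall x, A x -> f x = g x) -> cont_on A f -> cont_on A g.
Proof.
move=> fg cf x Ax U; rewrite -fg// => /(cf x Ax).
rewrite /= !nbhs_simpl /within/=; apply: filterS => z H Az.
by rewrite /= -fg//; exact: H.
Qed.

Lemma cont_on_comp (A : set X) (B : set Y) (f : X -> Y) (g : Y -> Z) :
  (forall x, A x -> B (f x)) -> cont_on A f -> cont_on B g ->
  cont_on A (g \o f).
Proof.
move=> AB cf cg x Ax U /= nU.
have := cf x Ax _ (cg _ (AB _ Ax) U nU).
by rewrite /= !nbhs_simpl /within/=; apply: filterS => z H Az; apply: H => //; exact: AB.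
Qed.

Lemma cont_onU (A B : set X) (f : X -> Y) :
  closed A -> closed B -> cont_on A f -> cont_on B f -> cont_on (A `|` B) f.
Proof. by move=> *; apply/cont_onP/withinU_continuous => //; exact/cont_onP. Qed.

Lemma connected_image (A : set X) (f : X -> Y) :
  cont_on A f -> connected A -> connected (f @` A).
Proof. by move=> /cont_onP ? ?; exact: connected_continuous_connected. Qed.

Lemma compact_image (A : set X) (f : X -> Y) :
  cont_on A f -> compact A -> compact (f @` A).
Proof. by move=> /cont_onP ? ?; exact: continuous_compact. Qed.

End ContOn.

Lemma cont_on_pair (X Y Z : topologicalType) (A : set X) (f : X -> Y) (g : X -> Z) :
  cont_on A f -> cont_on A g -> cont_on A (fun x => (f x, g x)).
Proof. by move=> cf cg x Ax; apply: cvg_pair; [exact: cf|exact: cg]. Qed.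

Section Plane.
Variable R : realType.
Local Notation T := (R * R)%type.
Implicit Types (x y z c : T) (K A B : set T).

Definition conv (V : lmodType R) (A : set V) := forall (x y : V) (t : R),
  A x -> A y -> 0 <= t <= 1 -> A (x + t *: (y - x)).

(** The component is empty when [x] lies in [K], so [joined K x y] puts both points off [K], and
    [joined K x] is the face of [x]. *)
Definition joined K x y := connected_component (~` K) x y.

Lemma conv_connected (V : normedModType R) (A : set V) : conv A -> connected A.
Proof.
move=> cA; have [[a Aa]|A0] := pselect (A !=set0); last first.
  have A0e : A = set0 by apply/seteqP; split => // x Ax; apply: A0; exists x.
  by rewrite A0e; exact: connected0.
pose seg (y : V) := (fun t : R => a + t *: (y - a)) @` `[0, 1]%classic.
have -> : A = \bigcup_(y in A) seg y.
  apply/seteqP; split => [y Ay|_ [y Ay [t /= t01 <-]]].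
    exists y => //; exists 1; first by rewrite /= in_itv/= ler01 lexx.
    by rewrite scale1r addrC subrK.
  by apply: cA => //; move: t01; rewrite in_itv.
apply: bigcup_connected.
  exists a => y Ay; exists 0; first by rewrite /= in_itv/= ler01 lexx.
  by rewrite scale0r addr0.
move=> y Ay; apply: connected_image; last exact: segment_connected.
apply: continuous_cont_on => t; apply: cvgD; first exact: cvg_cst.
by apply: cvgZr_tmp; exact: cvg_id.
Qed.

Lemma conv_ball (V : normedModType R) (c : V) e : conv (ball c e).
Proof.
move=> x y t; rewrite -ball_normE /ball_/= => xe ye /andP[t0 t1].
have -> : c - (x + t *: (y - x)) = (1 - t) *: (c - x) + t *: (c - y).
  rewrite scalerBl scale1r opprD addrA -[in RHS]addrA; congr (_ + _).
  by rewrite -scalerN -scalerDr -scalerN !opprB addrA subrK.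
apply: le_lt_trans (ler_normD _ _) _; rewrite !normrZ.
rewrite (ger0_norm t0) ger0_norm ?subr_ge0//.
have [->|tn0] := eqVneq t 0; first by rewrite subr0 mul1r mul0r addr0.
have tp : 0 < t by rewrite lt_def tn0.
have -> : e = (1 - t) * e + t * e by ring.
apply: ler_ltD; last by rewrite ltr_pM2l.
by rewrite ler_wpM2l ?subr_ge0// ltW.
Qed.

Lemma convI (V : lmodType R) (A B : set V) : conv A -> conv B -> conv (A `&` B).
Proof. by move=> cA cB x y t [? ?] [? ?] t01; split; [exact: cA|exact: cB]. Qed.

Lemma connected_ball (V : normedModType R) (c : V) e : connected (ball c e).
Proof. exact/conv_connected/conv_ball. Qed.

Lemma plane_normE z : `|z| = Num.max `|z.1| `|z.2|.
Proof. by []. Qed.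

Lemma plane_norm_lt z r : (`|z| < r) = (`|z.1| < r) && (`|z.2| < r).
Proof. by rewrite plane_normE gt_max. Qed.

Lemma plane_norm_gt z r : (r < `|z|) = (r < `|z.1|) || (r < `|z.2|).
Proof. by rewrite plane_normE lt_max. Qed.

(** The plane carries the maximum norm, so the outside of a ball is a union of four half-planes,
    each of which cuts [P] in a convex set. Neighbouring ones meet at corners of the square of
    radius [rho], which lie in [P]. *)
Lemma annulus_connected c (r rho : R) (P : set T) :
  0 <= r < rho -> conv P ->
  (forall a b : R, `|a| = rho -> `|b| = rho -> P (c.1 + a, c.2 + b)) ->
  connected (P `&` [set z | r < `|z - c|]).
Proof.
move=> /andP[r0 rr] cP Pc.
have rho0 : 0 < rho by exact: le_lt_trans rr.
have nr : `|rho| = rho by rewrite gtr0_norm.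
have nnr : `|- rho| = rho by rewrite normrN.
pose A1 := P `&` [set z : T | r < z.1 - c.1].
pose A2 := P `&` [set z : T | r < z.2 - c.2].
pose A3 := P `&` [set z : T | r < - (z.1 - c.1)].
pose A4 := P `&` [set z : T | r < - (z.2 - c.2)].
have aux (u v t : R) : r < u -> r < v -> 0 <= t <= 1 -> r < u + t * (v - u).
  move=> ru rv /andP[t0 t1].
  have [->|tn] := eqVneq t 0; first by rewrite mul0r addr0.
  have tp : 0 < t by rewrite lt_def tn.
  by nra.
have auxp (u v w t : R) : r < u - w -> r < v - w -> 0 <= t <= 1 ->
    r < (u + t *: (v - u)) - w.
  move=> ru rv /(aux _ _ _ ru rv); congr (_ < _).
  by rewrite -[_ *: _]/(_ * _); ring.
have auxn (u v w t : R) : r < - (u - w) -> r < - (v - w) -> 0 <= t <= 1 ->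
    r < - ((u + t *: (v - u)) - w).
  move=> ru rv /(aux _ _ _ ru rv); congr (_ < _).
  by rewrite -[_ *: _]/(_ * _); ring.
have C1 : connected A1.
  apply: conv_connected; apply: convI; first exact: cP.
  by move=> x y t /= rx ry t01; exact: auxp.
have C2 : connected A2.
  apply: conv_connected; apply: convI; first exact: cP.
  by move=> x y t /= rx ry t01; exact: auxp.
have C3 : connected A3.
  apply: conv_connected; apply: convI; first exact: cP.
  by move=> x y t /= rx ry t01; exact: auxn.
have C4 : connected A4.
  apply: conv_connected; apply: convI; first exact: cP.
  by move=> x y t /= rx ry t01; exact: auxn.
have -> : P `&` [set z | r < `|z - c|] = ((A1 `|` A2) `|` A3) `|` A4.
  apply/seteqP; split => z.
    case=> Pz /=; rewrite plane_norm_gt /= !ltr_normr.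
    by case/orP=> /orP[] ?; [left; left; left|left; right|left; left; right|right].
  by case=> [[[[]|[]]|[]]|[]] Pz /= H; split=> //=; rewrite plane_norm_gt /= !ltr_normr H ?orbT.
apply: connectedU => //; last first.
  apply: connectedU => //; last first.
    apply: connectedU => //.
    exists (c.1 + rho, c.2 + rho); split; split => /=; do ?exact: Pc; by rewrite addrC addKr.
  exists (c.1 - rho, c.2 + rho); split; last first.
    by split => /=; [exact: Pc|rewrite addrC addKr opprK].
  by right; split => /=; [exact: Pc|rewrite addrC addKr].
exists (c.1 + rho, c.2 - rho); split; last first.
  by split => /=; [exact: Pc|rewrite addrC addKr opprK].
by left; left; split => /=; [exact: Pc|rewrite addrC addKr].
Qed.

Lemma punctured_ball_connected c e : connected (ball c e `\ c).
Proof.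
have [e0|e0] := ltP 0 e; last first.
  have -> : ball c e `\ c = set0; last exact: connected0.
  apply/seteqP; split => // z [] /=; rewrite -ball_normE /ball_/= => H _.
  by have := lt_le_trans H e0; rewrite normr_lt0.
have -> : ball c e `\ c = ball c e `&` [set z | 0 < `|z - c|].
  apply/seteqP; split => z [bz] /= H; split => //.
    by rewrite normr_gt0 subr_eq0; apply/eqP.
  by move=> zc; move: H; rewrite zc subrr normr0 ltxx.
apply: (@annulus_connected c 0 (e / 2)); first by rewrite lexx divr_gt0.
  exact: conv_ball.
move=> a b ha hb; rewrite -ball_normE /ball_/= plane_norm_lt/=.
by rewrite !opprD !addNKr !normrN ha hb; lra.
Qed.

Lemma exterior_connected r : 0 <= r -> connected [set z : T | r < `|z|].
Proof.
move=> r0.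
have -> : [set z : T | r < `|z|] = setT `&` [set z | r < `|z - 0|].
  by rewrite setTI; apply/seteqP; split => z /=; rewrite subr0.
by apply: (@annulus_connected 0 r (r + 1)) => //; lra.
Qed.

Section Joined.
Variable K : set T.

Lemma joined_refl x : ~ K x -> joined K x x.
Proof. exact: connected_component_refl. Qed.

Lemma joined_sym x y : joined K x y -> joined K y x.
Proof. exact: connected_component_sym. Qed.

Lemma joined_trans y x z : joined K x y -> joined K y z -> joined K x z.
Proof. exact: connected_component_trans. Qed.

Lemma joined_off x y : joined K x y -> ~ K y.
Proof. exact: connected_component_sub. Qed.

Lemma joined_offl x y : joined K x y -> ~ K x.
Proof. by move=> /joined_sym/joined_off. Qed.

Lemma joined_conn (D : set T) x y :
  connected D -> D x -> D y -> D `<=` ~` K -> joined K x y.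
Proof. by move=> cD Dx Dy DK; exact: (@connected_component_max _ (~` K) D x). Qed.

Lemma joinedP x y : joined K x y ->
  exists D : set T, [/\ connected D, D x, D y & D `<=` ~` K].
Proof. by case=> D [Dx DK cD] Dy; exists D. Qed.

Lemma face_open x : closed K -> open (joined K x).
Proof.
move=> cK; rewrite openE => y xy.
have : nbhs y (~` K) by apply: open_nbhs_nbhs; split; [exact: closed_openC|exact: joined_off xy].
move=> /nbhs_ballP[e /= e0 be].
apply/nbhs_ballP; exists e => //= z yz.
apply: joined_trans xy _; apply: (joined_conn (@connected_ball _ y e)) => //.
exact: ballxx.
Qed.

(** The face is open, and the last hypothesis makes its trace on [D] closed as well. In the
    applications [D] avoids those parts of [K] that the closure of the face touches. *)
Lemma face_trap x (D : set T) y : closed K -> connected D -> D y -> joined K x y ->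
  D `&` closure (joined K x) `<=` joined K x -> D `<=` joined K x.
Proof.
move=> cK cD Dy xy H.
have <- : D `&` joined K x = D; last by move=> z [].
apply: cD; first by exists y.
- by exists (joined K x) => //; exact: face_open.
- exists (closure (joined K x)); first exact: closed_closure.
  apply/seteqP; split => z [Dz Fz]; split => //; first exact: subset_closure.
  by apply: H.
Qed.

Lemma closure_face x y : closed K -> closure (joined K x) y -> ~ K y -> joined K x y.
Proof.
move=> cK xy nKy; have : nbhs y (joined K y).
  by apply: open_nbhs_nbhs; split; [exact: face_open|exact: joined_refl].
by move/xy => [z [xz yz]]; apply: joined_trans xz _; exact: joined_sym.
Qed.

End Joined.

Lemma joined_sub K K' x y : K' `<=` K -> joined K x y -> joined K' x y.
Proof.
move=> KK /joinedP[D [cD Dx Dy DK]]; apply: (joined_conn cD) => // z /DK.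
by move=> + /KK.
Qed.

Lemma compact_closedP K : compact K -> closed K.
Proof. exact: (compact_closed (@norm_hausdorff _ _)). Qed.

Lemma bounded_plane K : compact K -> exists2 r : R, 0 < r & forall z, K z -> `|z| < r.
Proof.
move=> /compact_bounded [M [Mr HM]]; exists (`|M| + 2); first by rewrite ltr_wpDl.
move=> z Kz; apply: le_lt_trans (HM (`|M| + 1) _ z Kz) _.
  by rewrite ltr_pwDr// ler_norm.
by rewrite ltrD2l; lra.
Qed.

Lemma closed_bounded_compact K (r : R) : closed K -> (forall z, K z -> `|z| <= r) -> compact K.
Proof.
move=> cK bK; apply: (@subclosed_compact _ _ (`[- r, r]%classic `*` `[- r, r]%classic)) => //.
  by apply: compact_setX; exact: segment_compact.
move=> z /bK; rewrite plane_normE ge_max => /andP[]; rewrite !ler_norml => h1 h2.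
by split => /=; rewrite in_itv.
Qed.

End Plane.

(** * Arguments of circle-valued maps *)

Section Circle.
Variable R : realType.
Local Notation T := (R * R)%type.
Local Notation C := R[i].
Local Notation re := (@complex.Re R).
Local Notation im := (@complex.Im R).

Definition uni (w : C) := re w ^+ 2 + im w ^+ 2 = 1.

Definition cis (t : R) : C := Complex (cos t) (sin t).

Lemma uni_cis t : uni (cis t).
Proof. exact: cos2Dsin2. Qed.

Lemma uni1 : uni 1.
Proof. by rewrite /uni /=; ring. Qed.

Lemma uniM u v : uni u -> uni v -> uni (u * v).
Proof.
case: u => a b; case: v => c d; rewrite /uni /= => h1 h2.
have -> : (a * c - b * d) ^+ 2 + (a * d + b * c) ^+ 2 =
  (a ^+ 2 + b ^+ 2) * (c ^+ 2 + d ^+ 2) by ring.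
by rewrite h1 h2 mulr1.
Qed.

Lemma uni_neq0 w : uni w -> w != 0.
Proof.
case: w => a b; rewrite /uni /=; apply: contra_eqN => /eqP[-> ->].
by rewrite expr0n addr0 eq_sym oner_neq0.
Qed.

Lemma uni_inv w : uni w -> w^-1 = (w^*)%C.
Proof.
move=> uw; apply: (mulfI (uni_neq0 uw)); rewrite mulfV ?uni_neq0//.
case: w uw => a b; rewrite /uni /= => h.
apply/eqP; rewrite eq_complex /=; apply/andP; split; apply/eqP.
  by rewrite -h; ring.
by ring.
Qed.

Lemma uniV w : uni w -> uni w^-1.
Proof. by move=> uw; rewrite uni_inv//; case: w uw => a b; rewrite /uni /= sqrrN. Qed.

Lemma uniX w (m : int) : uni w -> uni (w ^ m).
Proof.
move=> uw; have P n : uni (w ^+ n).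
  by elim: n => [|n IH]; [rewrite expr0; exact: uni1|rewrite exprS; exact: uniM].
by case: m => n; rewrite ?NegzE ?exprnN; [exact: P|exact/uniV/P].
Qed.

Lemma cisD s t : cis (s + t) = cis s * cis t.
Proof.
by apply/eqP; rewrite eq_complex /= cosD sinD; apply/andP; split; apply/eqP; ring.
Qed.

Lemma cis0 : cis 0 = 1.
Proof. by apply/eqP; rewrite eq_complex /= cos0 sin0 !eqxx. Qed.

Lemma cisN t : cis (- t) = (cis t)^-1.
Proof. by rewrite (uni_inv (uni_cis t)) /cis /= cosN sinN. Qed.

Lemma cisB s t : cis (s - t) = cis s / cis t.
Proof. by rewrite cisD cisN. Qed.

Lemma cisX t (m : int) : cis (t * m%:~R) = cis t ^ m.
Proof.
have P n : cis (t * n%:R) = cis t ^+ n.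
  elim: n => [|n IH]; first by rewrite mulr0 cis0.
  by rewrite -natr1 mulrDr mulr1 cisD IH exprSr.
case: m => n; first by rewrite -pmulrn P.
by rewrite -[RHS]/((cis t ^+ n.+1)^-1) NegzE mulrNz mulrN cisN -pmulrn P.
Qed.

Lemma cis2pi : cis (pi *+ 2) = 1.
Proof. by apply/eqP; rewrite eq_complex /= cos2pi sin2pi !eqxx. Qed.

Lemma cispi : cis pi = -1.
Proof. by apply/eqP; rewrite eq_complex /= cospi sinpi oppr0 !eqxx. Qed.

Lemma cis_surj w : uni w -> exists t, w = cis t.
Proof.
case: w => a b; rewrite /uni /= => h.
have ha : -1 <= a <= 1.
  have : a ^+ 2 <= 1 by rewrite -h lerDl sqr_ge0.
  by move=> ?; apply/andP; split; nra.
have hs : sin (acos a) = `|b|.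
  rewrite sin_acos// -sqrtr_sqr; congr (Num.sqrt _).
  by rewrite -h; ring.
have [b0|b0] := leP 0 b.
  exists (acos a); apply/eqP; rewrite eq_complex /= hs acosK ?inE//.
  by rewrite ger0_norm// !eqxx.
exists (- acos a); apply/eqP; rewrite eq_complex /= cosN sinN hs acosK ?inE//.
by rewrite ltr0_norm// opprK !eqxx.
Qed.

Lemma cis_eq1 t : cis t = 1 -> exists k : int, t = pi *+ 2 * k%:~R.
Proof.
move=> ct; have p0 : 0 < pi *+ 2 :> R by rewrite pmulrn_lgt0// pi_gt0.
pose k := Num.floor (t / (pi *+ 2)); exists k.
pose u := t - pi *+ 2 * k%:~R.
have u0 : 0 <= u.
  by rewrite subr_ge0 mulrC -ler_pdivlMr// floor_le.
have u2 : u < pi *+ 2.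
  rewrite ltrBlDr -[X in X + _]mulr1 -mulrDr mulrC -ltr_pdivrMr// addrC.
  by rewrite -[1]/(1%:~R) -intrD floorD1_gt.
have cu : cis u = 1 by rewrite cisB ct cisX cis2pi exp1rz divr1.
have cu1 : cos u = 1 by case: cu.
suff : u = 0 by move/eqP; rewrite subr_eq0 => /eqP.
have [upi|upi] := leP u pi.
  apply: (@cos_inj R); rewrite ?cos0 ?in_itv/= ?u0//.
  by rewrite lexx pi_ge0.
have : pi *+ 2 - u = 0.
  apply: (@cos_inj R); rewrite ?in_itv/= ?lexx ?pi_ge0//.
    by rewrite subr_ge0 (ltW u2)/= mulr2n; move: upi; lra.
  by rewrite cosB cos2pi sin2pi cu1 cos0; ring.
by move=> /eqP; rewrite subr_eq0 => /eqP e; move: u2; rewrite -e ltxx.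
Qed.

Lemma cis_asin w : uni w -> 0 < re w -> w = cis (asin (im w)).
Proof.
case: w => a b; rewrite /uni /= => h a0.
have hb : -1 <= b <= 1.
  have : b ^+ 2 <= 1 by rewrite -h lerDr sqr_ge0.
  by move=> ?; apply/andP; split; nra.
apply/eqP; rewrite eq_complex /= asinK ?inE// eqxx andbT cos_asin//.
by rewrite -h addrK sqrtr_sqr gtr0_norm.
Qed.

Section Arg.
Variable X : topologicalType.
Implicit Types (A B : set X) (f g : X -> C).

Definition ccont A f := cont_on A (re \o f) /\ cont_on A (im \o f).

Definition has_arg A f :=
  exists2 t : X -> R, cont_on A t & forall x, A x -> f x = cis (t x).

Lemma ccont_sub A B f : B `<=` A -> ccont A f -> ccont B f.
Proof. by move=> BA [h1 h2]; split; exact: cont_on_sub BA _. Qed.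

Lemma ccont_eq A f g : (forall x, A x -> f x = g x) -> ccont A f -> ccont A g.
Proof.
by move=> fg [h1 h2]; split; [move: h1|move: h2]; apply: cont_on_eq => x Ax /=; rewrite fg.
Qed.

Lemma ccontM A f g : ccont A f -> ccont A g -> ccont A (fun x => f x * g x).
Proof.
move=> [f1 f2] [g1 g2]; split => x Ax.
  have -> : re \o (fun x => f x * g x) =
    (fun x => (re \o f) x * (re \o g) x - (im \o f) x * (im \o g) x).
    by apply/funext => z /=; case: (f z) (g z) => [? ?] [].
  by apply: cvgB; apply: cvgM; [exact: f1|exact: g1|exact: f2|exact: g2].
have -> : im \o (fun x => f x * g x) =
  (fun x => (re \o f) x * (im \o g) x + (im \o f) x * (re \o g) x).
  by apply/funext => z /=; case: (f z) (g z) => [? ?] [].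
by apply: cvgD; apply: cvgM; [exact: f1|exact: g2|exact: f2|exact: g1].
Qed.

Lemma ccontV A f : (forall x, A x -> uni (f x)) -> ccont A f ->
  ccont A (fun x => (f x)^-1).
Proof.
move=> uf [f1 f2]; apply: (@ccont_eq _ (fun x => (f x)^*%C)).
  by move=> x /uf /uni_inv.
split => x Ax.
  have -> : re \o (fun x => (f x)^*%C) = re \o f.
    by apply/funext => z /=; case: (f z).
  exact: f1.
have -> : im \o (fun x => (f x)^*%C) = (fun x => - (im \o f) x).
  by apply/funext => z /=; case: (f z).
by apply: cvgN; exact: f2.
Qed.

Lemma ccont_cst A w : ccont A (fun=> w).
Proof. by split => x Ax; exact: cvg_cst. Qed.

Lemma ccontX A f (m : int) : (forall x, A x -> uni (f x)) -> ccont A f ->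
  ccont A (fun x => f x ^ m).
Proof.
move=> uf cf; have P n : ccont A (fun x => f x ^+ n).
  elim: n => [|n IH]; first exact: ccont_cst.
  by have := ccontM cf IH; apply: ccont_eq => x _; rewrite exprS.
case: m => n; first exact: P.
rewrite NegzE; apply: (@ccont_eq _ (fun x => (f x ^+ n.+1)^-1)).
  by move=> x _; rewrite exprnN.
by apply: ccontV (P _) => x Ax; exact: (@uniX _ n.+1 (uf x Ax)).
Qed.

Lemma ccont_cis A (t : X -> R) : cont_on A t -> ccont A (fun x => cis (t x)).
Proof.
move=> ct; split.
  by apply: (cont_on_comp (B := setT) _ ct) => //; exact/continuous_cont_on/continuous_cos.
by apply: (cont_on_comp (B := setT) _ ct) => //; exact/continuous_cont_on/continuous_sin.
Qed.

Lemma has_arg_eq A f g : (forall x, A x -> f x = g x) -> has_arg A f -> has_arg A g.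
Proof. by move=> fg [t ct h]; exists t => // x Ax; rewrite -fg// h. Qed.

Lemma has_arg_sub A B f : B `<=` A -> has_arg A f -> has_arg B f.
Proof.
by move=> BA [t ct h]; exists t => [|x /BA/h//]; exact: cont_on_sub BA ct.
Qed.

Lemma has_argM A f g : has_arg A f -> has_arg A g -> has_arg A (fun x => f x * g x).
Proof.
move=> [t ct h] [s cs k]; exists (fun x => t x + s x).
  by move=> x Ax; apply: cvgD; [exact: ct|exact: cs].
by move=> x Ax; rewrite cisD h// k.
Qed.

Lemma has_argV A f : has_arg A f -> has_arg A (fun x => (f x)^-1).
Proof.
move=> [t ct h]; exists (fun x => - t x).
  by move=> x Ax; apply: cvgN; exact: ct.
by move=> x Ax; rewrite cisN h.
Qed.

Lemma has_arg_cst A w : uni w -> has_arg A (fun=> w).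
Proof.
move=> /cis_surj[t ->]; exists (fun=> t) => // x Ax; exact: cvg_cst.
Qed.

(** On the right half-plane the arcsine of the imaginary part is an argument. It is continuous there
    because a positive real part keeps the imaginary part strictly between -1 and 1. *)
Lemma arg_near A f : ccont A f -> (forall x, A x -> uni (f x)) ->
  (forall x, A x -> 0 < re (f x)) ->
  cont_on A (fun x => asin (im (f x))) /\ forall x, A x -> f x = cis (asin (im (f x))).
Proof.
move=> [_ cf] uf pf; split; last first.
  by move=> x Ax; apply: cis_asin; [exact: uf|exact: pf].
move=> x Ax; apply: (@continuous_cvg _ _ _ (within A (nbhs x)) _ (im \o f) asin); last exact: cf.
apply: continuous_asin.
have := uf x Ax; have := pf x Ax; rewrite /uni; case: (f x) => a b /= a0 h.
have : b ^+ 2 < 1 by rewrite -h ltrDr exprn_gt0.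
by move=> ?; apply/andP; split; nra.
Qed.

Lemma has_arg_near A f : ccont A f -> (forall x, A x -> uni (f x)) ->
  (forall x, A x -> 0 < re (f x)) -> has_arg A f.
Proof. by move=> cf uf pf; have [h1 h2] := arg_near cf uf pf; eexists; eauto. Qed.

(** The image of [D] under [t] is an interval. If it held two different multiples of 2 pi, it would
    also hold [t x + pi], where [cis] equals -1. *)
Lemma cis_const (D : set X) (t : X -> R) : connected D -> cont_on D t ->
  (forall x, D x -> cis (t x) = 1) -> forall x y, D x -> D y -> t x = t y.
Proof.
move=> cD ct h.
suff P x y : D x -> D y -> t x <= t y -> t x = t y.
  move=> x y Dx Dy; have [/P->//|/ltW/P->//] := leP (t x) (t y).
move=> Dx Dy; rewrite le_eqVlt => /orP[/eqP//|lt]; exfalso.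
have /connected_intervalP iD := connected_image ct cD.
have [k] := cis_eq1 (etrans (cisB (t y) (t x)) (etrans (f_equal2 (fun a b => a / b) (h _ Dy) (h _ Dx)) (divr1 1))).
move=> tk; have p0 := @pi_gt0 R.
have k0 : (1 <= k)%R.
  rewrite -gtz0_ge1 -(ltr0z R) -(@pmulr_rgt0 _ (pi *+ 2)) -?tk ?subr_gt0//.
  by rewrite pmulrn_lgt0.
have k1 : (1 <= k%:~R :> R) by rewrite -[1]/(1%:~R) ler_int.
have [z Dz tz] : (t @` D) (t x + pi).
  apply: (iD (t x) (t y)); [by exists x|by exists y|].
  have : t y = t x + pi *+ 2 * k%:~R by rewrite -tk addrC subrK.
  rewrite mulr2n => e; apply/andP; split; nra.
have := h z Dz; rewrite tz cisD h// mul1r cispi => /eqP.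
by rewrite eq_complex /= -subr_eq0 -opprD oppr_eq0 (_ : 1 + 1 = 2%:R)// pnatr_eq0.
Qed.

End Arg.

(* The set of parameters at which an argument exists is clopen. *)
Lemma homotopy_arg (S X : topologicalType) (D : set S) (K : set X) (G : S -> X -> C) :
  connected D -> (forall s, D s -> ccont K (G s)) ->
  (forall s x, D s -> K x -> uni (G s x)) ->
  (forall s0, D s0 -> \forall s \near within D (nbhs s0),
     forall x, K x -> 0 < re (G s x / G s0 x)) ->
  forall a b, D a -> D b -> has_arg K (G a) -> has_arg K (G b).
Proof.
move=> cD cG uG nG a b Da Db Ga.
(* Two maps whose ratio stays in the right half-plane differ by a factor that has an argument, so
   both have an argument or neither has. *)
have close s0 s : D s0 -> D s -> (forall x, K x -> 0 < re (G s x / G s0 x)) ->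
    has_arg K (fun x => G s x / G s0 x).
  move=> Ds0 Ds H; apply: has_arg_near => //.
    apply: ccontM; first exact: cG.
    by apply: ccontV; [move=> x; exact: uG|exact: cG].
  by move=> x Kx; apply: uniM; [exact: uG|exact/uniV/uG].
have nxt s0 s : D s0 -> D s -> (forall x, K x -> 0 < re (G s x / G s0 x)) ->
    has_arg K (G s0) <-> has_arg K (G s).
  move=> Ds0 Ds H; have h := close _ _ Ds0 Ds H; split=> h0.
    have := has_argM h h0; apply: has_arg_eq => x Kx.
    by rewrite divfK// uni_neq0//; exact: uG.
  have := has_argM (has_argV h) h0; apply: has_arg_eq => x Kx.
  by rewrite invf_div divfK// uni_neq0//; exact: uG.
suff e : D `&` [set s | has_arg K (G s)] = D by move: Db; rewrite -e => -[].
apply: cD; first by exists a.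
- exists [set s | D s -> has_arg K (G s)]°; first exact: open_interior.
  apply/seteqP; split => s [Ds Hs]; split => //.
    have H : nbhs s (fun z => D z -> forall x, K x -> 0 < re (G z x / G s x)) := nG s Ds.
    apply: filterS H => s' Hs' Ds'.
    by apply/(nxt s s') => //; exact: Hs'.
  exact: interior_subset Hs Ds.
- exists (~` [set s | D s -> ~ has_arg K (G s)]°); first exact/open_closedC/open_interior.
  apply/seteqP; split => s [Ds Hs]; split => //.
    by move=> /interior_subset/(_ Ds).
  apply: contrapT => nHs; apply: Hs.
  have H : nbhs s (fun z => D z -> forall x, K x -> 0 < re (G z x / G s x)) := nG s Ds.
  apply: filterS H => s' Hs' Ds' h.
  by apply: nHs; apply/(nxt s s') => //; exact: Hs'.
Qed.

Lemma slice_ccont (S X : topologicalType) (D : set S) (K : set X) (G : S -> X -> C) s :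
  D s -> ccont (D `*` K) (fun p : S * X => G p.1 p.2) -> ccont K (G s).
Proof.
move=> Ds cG; have aux (h : S * X -> R) : cont_on (D `*` K) h -> cont_on K (fun x => h (s, x)).
  move=> ch; apply: (@cont_on_comp _ _ _ K (D `*` K) (fun x => (s, x)) h) => //.
  by apply: continuous_cont_on => x; apply: cvg_pair; [exact: cvg_cst|exact: cvg_id].
by case: cG => c1 c2; split; [exact: aux c1|exact: aux c2].
Qed.

(** The ratio is 1 at [s0], hence positive near every [(s0, x)]; compactness of [K] makes the
    neighbourhood of [s0] uniform in [x]. *)
Lemma compact_near_ratio (S X : topologicalType) (D : set S) (K : set X) (G : S -> X -> C) :
  compact K -> ccont (D `*` K) (fun p : S * X => G p.1 p.2) ->
  (forall s x, D s -> K x -> uni (G s x)) ->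
  forall s0, D s0 -> \forall s \near within D (nbhs s0),
     forall x, K x -> 0 < re (G s x / G s0 x).
Proof.
move=> cK cG uG.
move=> s0 Ds0.
move/compact_near_coveringP : (cK) => ncK.
suff H x : K x -> \forall x' \near x & s \near within D (nbhs s0),
    K x' -> 0 < re (G s x' / G s0 x').
  have := ncK S (within D (nbhs s0)) (fun s x => K x -> 0 < re (G s x / G s0 x)).
  by move=> /(_ _ H); apply: filterS => s Hs x Kx; exact: Hs.
move=> Kx.
pose h (p : S * X) := re (G p.1 p.2 / G s0 p.2).
have ch : cont_on (D `*` K) h.
  have [] // : ccont (D `*` K) (fun p : S * X => G p.1 p.2 / G s0 p.2).
  apply: ccontM => //; apply: ccontV; first by move=> p [_ /= Kp]; exact: uG.
  have aux (k : X -> R) : cont_on K k -> cont_on (D `*` K) (fun p => k p.2).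
    move=> ck; apply: (@cont_on_comp _ _ _ (D `*` K) K snd k) => //; first by move=> p [].
    by apply: continuous_cont_on => p; exact: cvg_snd.
  by case: (slice_ccont Ds0 cG) => c1 c2; split; [exact: aux c1|exact: aux c2].
have h1 : h (s0, x) = 1 by rewrite /h /= divff// uni_neq0//; exact: uG.
have : \forall p \near within (D `*` K) (nbhs (s0, x)), 0 < h p.
  apply: (ch (s0, x) (conj Ds0 Kx) [set r | 0 < r]).
  by rewrite h1; apply: open_nbhs_nbhs; split; [exact: open_gt|exact: ltr01].
rewrite /within /= => -[[U V] /= [nU nV] UV].
exists (V, [set s | D s /\ U s]).
  by split => //=; rewrite /within/=; apply: filterS nU => s Us Ds.
by move=> [x' s] /= [Vx' [Ds Us]] Kx'; apply: (UV (s, x')).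
Qed.

Lemma homotopy_arg_compact (S X : topologicalType) (D : set S) (K : set X) (G : S -> X -> C) :
  connected D -> compact K ->
  ccont (D `*` K) (fun p : S * X => G p.1 p.2) ->
  (forall s x, D s -> K x -> uni (G s x)) ->
  forall a b, D a -> D b -> has_arg K (G a) -> has_arg K (G b).
Proof.
move=> cD cK cG uG; apply: homotopy_arg => //.
  by move=> s Ds; exact: slice_ccont cG.
exact: compact_near_ratio.
Qed.

Local Notation I01 := (`[0, 1]%classic : set R).

Lemma in01 (t : R) : I01 t = (0 <= t <= 1).
Proof. by rewrite /= in_itv. Qed.

Lemma connected01 : connected I01.
Proof. exact: segment_connected. Qed.

Lemma compact01 : compact I01.
Proof. exact: segment_compact. Qed.

Lemma ccont_comp (X Y : topologicalType) (A : set X) (B : set Y) (h : X -> Y) (f : Y -> C) :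
  (forall x, A x -> B (h x)) -> cont_on A h -> ccont B f -> ccont A (f \o h).
Proof.
by move=> AB ch [c1 c2]; split;
  [exact: (cont_on_comp AB ch c1)|exact: (cont_on_comp AB ch c2)].
Qed.

Lemma has_arg_comp (X Y : topologicalType) (A : set X) (B : set Y) (h : X -> Y) (f : Y -> C) :
  (forall x, A x -> B (h x)) -> cont_on A h -> has_arg B f -> has_arg A (f \o h).
Proof.
move=> AB ch [t ct e]; exists (t \o h); first exact: (cont_on_comp AB ch ct).
by move=> x Ax /=; rewrite e//; exact: AB.
Qed.

(** Contraction of the interval: the maps [f (s * t)] lead from a constant, at [s = 0], to [f], at
    [s = 1]. *)
Lemma lift01 (f : R -> C) : ccont I01 f ->
  (forall t, 0 <= t <= 1 -> uni (f t)) -> has_arg I01 f.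
Proof.
move=> cf uf.
have mul01 (s t : R) : 0 <= s <= 1 -> 0 <= t <= 1 -> 0 <= s * t <= 1.
  by move=> /andP[? ?] /andP[? ?]; apply/andP; split; nra.
have : has_arg I01 (fun t => f (1 * t)).
  apply: (@homotopy_arg_compact R R I01 I01 (fun s t => f (s * t)) connected01 compact01 _ _ 0 1).
  - apply: (@ccont_comp _ _ _ I01 (fun p : R * R => p.1 * p.2) f _ _ cf).
      by move=> [s t] /= [] ; rewrite !in_itv /=; exact: mul01.
    by apply: continuous_cont_on => p; apply: cvgM; [exact: cvg_fst|exact: cvg_snd].
  - by move=> s t; rewrite !in01 => ? ?; apply/uf/mul01.
  - by rewrite in01 lexx ler01.
  - by rewrite in01 lexx ler01.
  - have : has_arg I01 (fun=> f 0) by apply/has_arg_cst/uf; rewrite lexx ler01.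
    by apply: has_arg_eq => t _; rewrite mul0r.
by apply: has_arg_eq => t _; rewrite mul1r.
Qed.

Lemma arg_unique (X : topologicalType) (D : set X) (f : X -> C) (t s : X -> R) :
  connected D -> cont_on D t -> cont_on D s ->
  (forall x, D x -> f x = cis (t x)) -> (forall x, D x -> f x = cis (s x)) ->
  forall x y, D x -> D y -> t x - s x = t y - s y.
Proof.
move=> cD ct cs ft fs.
apply: (@cis_const _ D (fun x => t x - s x) cD).
  by move=> x Dx; apply: cvgB; [exact: ct|exact: cs].
by move=> x Dx; rewrite cisB -ft// -fs// divff// uni_neq0// ft//; exact: uni_cis.
Qed.

(** Normalising a vector to a unit complex number needs the Euclidean norm, whereas the norm of the
    product type is the maximum norm. *)
Definition nrm2 (v : T) : R := Num.sqrt (v.1 ^+ 2 + v.2 ^+ 2).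

Definition dirv (v : T) : C := Complex (v.1 / nrm2 v) (v.2 / nrm2 v).

Lemma nrm2_gt0 v : v != 0 -> 0 < nrm2 v.
Proof.
move=> v0; rewrite sqrtr_gt0 lt_def addr_ge0 ?sqr_ge0// andbT.
rewrite paddr_eq0 ?sqr_ge0// !sqrf_eq0; apply: contra v0 => /andP[/eqP a /eqP b].
by apply/eqP; case: v a b => /= ? ? -> ->.
Qed.

Lemma uni_dirv v : v != 0 -> uni (dirv v).
Proof.
move=> /nrm2_gt0 n0; rewrite /uni /= !expr_div_n -mulrDl.
rewrite -[X in X / _](@sqr_sqrtr _ (v.1 ^+ 2 + v.2 ^+ 2)) ?addr_ge0 ?sqr_ge0//.
by rewrite divff// expf_neq0// gt_eqF.
Qed.

Lemma nrm2_continuous : continuous nrm2.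
Proof.
move=> v; apply: (@continuous_cvg _ _ _ (nbhs v) _ (fun v : T => v.1 ^+ 2 + v.2 ^+ 2) Num.sqrt).
  exact: sqrt_continuous.
have c1 : u.1 @[u --> v] --> v.1 by exact: cvg_fst.
have c2 : u.2 @[u --> v] --> v.2 by exact: cvg_snd.
by apply: cvgD; [exact: (cvgM c1 c1)|exact: (cvgM c2 c2)].
Qed.

Lemma ccont_dirv : ccont [set v : T | v != 0] dirv.
Proof.
have inv (v : T) : v != 0 -> (nrm2 u)^-1 @[u --> v] --> (nrm2 v)^-1.
  by move=> v0; apply: cvgV; [rewrite gt_eqF// nrm2_gt0|exact: nrm2_continuous].
split => v /= v0; apply: cvg_within_filter; apply: cvgM.
- exact: cvg_fst.
- exact: inv.
- exact: cvg_snd.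
- exact: inv.
Qed.

Definition dir (p z : T) : C := dirv (z - p).

Lemma uni_dir p z : z <> p -> uni (dir p z).
Proof. by move=> zp; apply: uni_dirv; rewrite subr_eq0; apply/eqP. Qed.

Lemma ccont_dir p (A : set T) : ~ A p -> ccont A (dir p).
Proof.
move=> Ap; apply: (ccont_comp _ _ ccont_dirv).
  by move=> z Az /=; rewrite subr_eq0; apply: contra_notN Ap => /eqP <-.
by apply: continuous_cont_on => z; apply: cvgB; [exact: cvg_id|exact: cvg_cst].
Qed.

Lemma ccont_dirl p (A : set T) : ~ A p -> ccont A (dir^~ p).
Proof.
move=> Ap; apply: (ccont_comp _ _ ccont_dirv).
  by move=> z Az /=; rewrite subr_eq0; apply: contra_notN Ap => /eqP ->.
by apply: continuous_cont_on => z; apply: cvgB; [exact: cvg_cst|exact: cvg_id].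
Qed.

Lemma ccont_dir2 (A : set (T * T)) : (forall p, A p -> p.1 <> p.2) ->
  ccont A (fun p => dir p.1 p.2).
Proof.
move=> Ap; apply: (@ccont_comp _ _ A [set v : T | v != 0] (fun p => p.2 - p.1) dirv).
- by move=> p /Ap pp /=; rewrite subr_eq0 eq_sym; apply/eqP.
- by apply: continuous_cont_on => z; apply: cvgB; [exact: cvg_snd|exact: cvg_fst].
- exact: ccont_dirv.
Qed.

Definition S1 : set T := (fun t => (cos t, sin t)) @` `[0, pi *+ 2]%classic.

Definition cz (z : T) : C := Complex z.1 z.2.

Lemma compact_S1 : compact S1.
Proof.
apply: compact_image; last exact: segment_compact.
apply: cont_on_pair; apply: continuous_cont_on; [exact: continuous_cos|exact: continuous_sin].
Qed.

Lemma S1_sqr w : S1 w -> w.1 ^+ 2 + w.2 ^+ 2 = 1.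
Proof. by case=> t _ <- /=; exact: cos2Dsin2. Qed.

Lemma S1_norm w : S1 w -> 1 / 2 <= `|w| <= 1.
Proof.
move=> /S1_sqr h; rewrite plane_normE; apply/andP; split.
  rewrite le_max; apply/orP; have [a|a] := leP (1/2) `|w.1|; [by left|right].
  have h1 : w.1 ^+ 2 = `|w.1| ^+ 2 by rewrite real_normK ?num_real.
  have h2 : w.2 ^+ 2 = `|w.2| ^+ 2 by rewrite real_normK ?num_real.
  have := normr_ge0 w.1; have := normr_ge0 w.2; nra.
by rewrite ge_max !ler_norml; apply/andP; split; apply/andP; split; nra.
Qed.

(** Along one turn an argument of the power must grow by 2 pi m, yet it returns to its initial
    value. *)
Lemma winding_S1 (m : int) : has_arg S1 (fun z => cz z ^ m) -> m = 0.
Proof.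
move=> [t ct h]; have p0 := @pi_gt0 R.
pose c (s : R) : T := (cos s, sin s).
have cc : cont_on `[0, pi *+ 2]%classic c.
  by apply: cont_on_pair; apply: continuous_cont_on; [exact: continuous_cos|exact: continuous_sin].
have i0 : (`[0, pi *+ 2]%classic : set R) 0 by rewrite /= in_itv /= lexx mulrn_wge0// ltW.
have i1 : (`[0, pi *+ 2]%classic : set R) (pi *+ 2) by rewrite /= in_itv /= lexx mulrn_wge0// ltW.
have := @arg_unique _ `[0, pi *+ 2]%classic (fun s => cis s ^ m) (t \o c) (fun s => s * m%:~R)
  (@segment_connected _ _ _) _ _ _ _ 0 (pi *+ 2) i0 i1.
have -> : (t \o c) (pi *+ 2) = (t \o c) 0 by rewrite /= /c cos2pi sin2pi cos0 sin0.
move=> H; have {H} : (t \o c) 0 - 0 * m%:~R = (t \o c) 0 - pi *+ 2 * m%:~R.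
  apply: H.
  - by apply: (cont_on_comp _ cc ct) => s Hs; exists s.
  - by apply: continuous_cont_on => s; apply: cvgM; [exact: cvg_id|exact: cvg_cst].
  - by move=> s Hs; rewrite /= -h//; exists s.
  - by move=> s Hs; rewrite cisX.
rewrite mul0r subr0 => /eqP; rewrite -subr_eq0 opprB addrC subrK mulf_eq0.
by rewrite mulrn_eq0 /= gt_eqF//= intr_eq0 => /eqP.
Qed.

Lemma dir_S1 p (s : R) w : 0 < s -> S1 w -> dir p (p + s *: w) = cz w.
Proof.
move=> s0 /S1_sqr h; rewrite /dir addrC addKr /dirv /cz.
have -> : nrm2 (s *: w) = s.
  rewrite /nrm2 /= -![_ *: _]/(_ * _) !exprMn -mulrDr h mulr1 sqrtr_sqr gtr0_norm//.
case: w h => a b _; have -> : s *: (a, b) = (s * a, s * b) by [].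
by rewrite /= ![s * _]mulrC !mulfK// gt_eqF.
Qed.

Lemma compact_bound (X : topologicalType) (A : set X) (t : X -> R) : compact A -> cont_on A t ->
  exists2 M : R, 0 < M & forall x, A x -> `|t x| <= M.
Proof.
move=> cA ct; have /compact_bounded[M [Mr HM]] := compact_image ct cA.
exists (`|M| + 1); first by rewrite ltr_wpDl.
move=> x Ax; apply: (HM (`|M| + 1)); last by exists x.
by rewrite ltr_pwDr// ler_norm.
Qed.

(* Extending the argument off the face [U] of [x] would give a unit field on the
   plane minus [x] that winds [m] times around [x] and zero times near infinity. *)
Lemma face_winding (K : set T) (x : T) (f : T -> C) (m : int) (M : R) :
  compact K -> ~ K x -> (forall z, joined K x z -> `|z| < M) ->
  ccont (K `|` joined K x) f -> (forall z, (K `|` joined K x) z -> uni (f z)) ->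
  has_arg K (fun z => dir x z ^ m * f z) -> m = 0.
Proof.
move=> cK nKx bU cf uf [t0 ct0 ht0].
have clK := compact_closedP cK.
have oU : open (joined K x) by exact: face_open.
set U := joined K x in bU cf uf oU *.
have Ux : U x by exact: joined_refl.
have [t ct tt0] : exists2 t : T -> R, continuous t & forall z, K z -> t z = t0 z.
  have [B B0 HB] := compact_bound cK ct0.
  have [g [g1 g2 _]] := continuous_bounded_extension (@pseudometric_normal R T) clK B0 (iffRL (cont_onP _ _) ct0) HB.
  by exists g => // z Kz; rewrite -g1// inE.
pose g z := dir x z ^ m * f z.
pose G z := if `[< U z >] then g z else cis (t z).
have [r0 r00 Hr0] : exists2 r : R, 0 < r & ball x r `<=` U.
  have /nbhs_ballP[r /= r0 H] : nbhs x U by apply: open_nbhs_nbhs; split.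
  by exists r.
pose r := r0 / 4; have r_gt0 : 0 < r by rewrite divr_gt0.
have clUK : closure U `<=` K `|` U.
  move=> z Uz; have [Kz|nKz] := pselect (K z); [by left|right].
  exact: closure_face.
have KnU z : K z -> ~ U z by move=> Kz /joined_off.
have G1 z : (closure U) z -> G z = g z.
  move=> /clUK Hz; rewrite /G; case: asboolP => // nUz.
  by case: Hz => // Kz; rewrite /g ht0// tt0.
have G2 z : ~ U z -> G z = cis (t z) by rewrite /G; case: asboolP.
have bx z : ball x r z = (`|z - x| < r) by rewrite -ball_normE /ball_/= distrC.
have cG : ccont (~` ball x r) G.
  have -> : ~` ball x r = (closure U `&` ~` ball x r) `|` ~` U.
    apply/seteqP; split => z.
      move=> Hz; have [Uz|] := pselect (U z); [left; split => //; exact: subset_closure|by right].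
    by case=> [[]//|nU Hb]; apply: nU; apply: Hr0; apply: le_ball Hb; rewrite /r; lra.
  have c1 : closed (closure U `&` ~` ball x r).
    by apply: closedI; [exact: closed_closure|apply: open_closedC; exact: ball_open].
  have c2 : closed (~` U) by exact: open_closedC.
  have h1 : ccont (closure U `&` ~` ball x r) G.
    apply: (@ccont_eq _ _ g); first by move=> z [Hz _]; rewrite G1.
    apply: ccontM; last by apply: ccont_sub cf => z [/clUK].
    have nx : ~ (closure U `&` ~` ball x r) x by move=> [_]; apply; exact: ballxx.
    apply: ccontX; last exact: ccont_dir.
    by move=> z Hz; apply: uni_dir => zx; apply: nx; move: Hz; rewrite zx.
  have h2 : ccont (~` U) G.
    apply: (@ccont_eq _ _ (fun z => cis (t z))); first by move=> z Hz; rewrite G2.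
    exact/ccont_cis/continuous_cont_on.
  by case: h1 h2 => [a1 a2] [b1 b2]; split; exact: cont_onU.
have uG z : ~ ball x r z -> uni (G z).
  move=> nb; have [Uz|nU] := pselect (U z); last by rewrite G2//; exact: uni_cis.
  rewrite G1; last exact: subset_closure.
  apply: uniM; last by apply: uf; right.
  by apply/uniX/uni_dir => zx; apply: nb; rewrite zx; exact: ballxx.
(* So large that the circle of radius [Rb] around [x] leaves the bounded face; there [G] is
   [cis (t z)] and has an argument. *)
pose Rb := 2 * (`|M| + `|x|) + 2 * r.
have cont_sw : continuous (fun p : R * T => x + p.1 *: p.2 : T).
  by move=> p; apply: cvgD; [exact: cvg_cst|apply: cvgZ; [exact: cvg_fst|exact: cvg_snd]].
have normsw (s : R) w : 0 <= s -> S1 w -> s / 2 <= `|(x + s *: w) - x| <= s.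
  move=> s0 /S1_norm/andP[w1 w2]; rewrite addrC addKr normrZ ger0_norm//.
  by apply/andP; split; nra.
have hRb : 2 * r <= Rb by rewrite /Rb lerDr mulr_ge0// addr_ge0.
have A1 : has_arg S1 (fun w : T => G (x + Rb *: w)).
  apply: (@has_arg_eq T S1 (fun w : T => cis (t (x + Rb *: w)))).
    move=> w Sw; rewrite G2// => /bU.
    have /andP[+ _] := normsw Rb w (le_trans (mulr_ge0 (ler0n _ 2) (ltW r_gt0)) hRb) Sw.
    have := ler_normB (x + Rb *: w) x; have := ler_norm M; rewrite /Rb; lra.
  exists (fun w : T => t (x + Rb *: w)) => //.
  apply: (@cont_on_comp T T R S1 setT (fun w : T => x + Rb *: w) t) => //; last exact: continuous_cont_on.
  apply: continuous_cont_on => w; apply: cvgD; first exact: cvg_cst.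
  by apply: cvgZ; [exact: cvg_cst|exact: cvg_id].
have A2 : has_arg S1 (fun w : T => G (x + (2 * r) *: w)).
  apply: (@homotopy_arg_compact R T `[2 * r, Rb]%classic S1 (fun (s : R) (w : T) => G (x + s *: w)) (@segment_connected _ _ _) compact_S1 _ _ Rb (2 * r)) => //.
  - apply: (@ccont_comp _ _ _ (~` ball x r) (fun p : R * T => x + p.1 *: p.2) G _ _ cG).
      move=> [s w] [] /=; rewrite in_itv /= => /andP[s1 s2] Sw.
      rewrite bx; have /andP[h1 _] := normsw s w (le_trans (mulr_ge0 (ler0n _ 2) (ltW r_gt0)) s1) Sw.
      by move: h1 s1; lra.
    exact: continuous_cont_on.
  - move=> s w; rewrite /= in_itv /= => /andP[s1 s2] Sw; apply: uG.
    rewrite bx; have /andP[h1 _] := normsw s w (le_trans (mulr_ge0 (ler0n _ 2) (ltW r_gt0)) s1) Sw.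
    by move: h1 s1; lra.
  - by rewrite /= in_itv /= hRb lexx.
  - by rewrite /= in_itv /= hRb lexx.
have inU (s : R) w : 0 <= s <= 2 * r -> S1 w -> U (x + s *: w).
  move=> /andP[s0 s1] Sw; apply: Hr0; rewrite -ball_normE /ball_/= distrC.
  have /andP[_ h] := normsw s w s0 Sw; apply: le_lt_trans h _.
  by move: s1; rewrite /r; lra.
have A3 : has_arg S1 (fun w : T => f (x + (2 * r) *: w)).
  apply: (@homotopy_arg_compact R T `[0, 2 * r]%classic S1 (fun (s : R) (w : T) => f (x + s *: w)) (@segment_connected _ _ _) compact_S1 _ _ 0 (2 * r)) => //.
  - apply: (@ccont_comp _ _ _ (K `|` U) (fun p : R * T => x + p.1 *: p.2) f _ _ cf).
      by move=> [s w] [] /=; rewrite in_itv /= => s1 Sw; right; exact: inU.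
    exact: continuous_cont_on.
  - by move=> s w; rewrite /= in_itv /= => s1 Sw; apply: uf; right; exact: inU.
  - by rewrite /= in_itv /= lexx mulr_ge0// ltW.
  - by rewrite /= in_itv /= lexx mulr_ge0// ltW.
  - apply: (@has_arg_eq T S1 (fun=> f x)); first by move=> w _; rewrite scale0r addr0.
    by apply/has_arg_cst/uf; right.
apply: winding_S1; have := has_argM A2 (has_argV A3).
apply: has_arg_eq => w Sw.
have i2 : 0 <= 2 * r <= 2 * r by rewrite lexx mulr_ge0// ltW.
rewrite G1; last exact/subset_closure/inU.
rewrite /g mulfK; first by rewrite dir_S1// mulr_gt0.
by apply/uni_neq0/uf; right; exact: inU.
Qed.

End Circle.

(** * Separation by arcs *)

Section Separation.
Variable R : realType.
Local Notation T := (R * R)%type.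
Local Notation C := R[i].
Local Notation re := (@complex.Re R).
Local Notation im := (@complex.Im R).
Local Notation I01 := (`[0, 1]%classic : set R).
Implicit Types (K A B : set T) (x y z : T).

(** Moving the base point through the face from [y] to [x] deforms the constant 1 into the ratio.
    This is one half of Eilenberg's criterion; [joined_arg] is the other. *)
Lemma arg_joined K x y : compact K -> joined K x y ->
  has_arg K (fun z => dir x z / dir y z).
Proof.
move=> cK xy; have nx := joined_offl xy; have ny := joined_off xy.
apply: (@homotopy_arg_compact R T T (joined K x) K (fun p z : T => dir p z / dir y z) _ _ _ _ y x) => //.
- exact: component_connected.
- apply: ccontM.
    apply: ccont_dir2 => -[p z] /= [/joined_off np Kz] pz.
    by apply: np; rewrite pz.
  apply: ccontV; first by move=> [p z] [_ /= Kz]; apply: uni_dir => zy; apply: ny; rewrite -zy.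
  apply: (@ccont_comp _ _ _ (joined K x `*` K) K snd (dir y)); first by move=> p [].
    by apply: continuous_cont_on => p; exact: cvg_snd.
  exact: ccont_dir.
- move=> p z /joined_off np Kz; apply: uniM; first by apply: uni_dir => zp; apply: np; rewrite -zp.
  by apply/uniV/uni_dir => zy; apply: ny; rewrite -zy.
- exact: joined_refl.
- apply: (@has_arg_eq _ _ _ (fun=> 1)); last exact/has_arg_cst/uni1.
  by move=> z Kz; rewrite divff// uni_neq0//; apply: uni_dir => zy; apply: ny; rewrite -zy.
Qed.

Definition bounded_face K x := exists M : R, forall z, joined K x z -> `|z| < M.

Lemma unbounded_joined K x y : compact K ->
  ~ bounded_face K x -> ~ bounded_face K y -> joined K x y.
Proof.
move=> cK; have [r r0 Kr] := bounded_plane cK.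
have far z : ~ bounded_face K z -> exists2 w, joined K z w & r < `|w|.
  move=> nb; apply: contrapT => nw; apply: nb; exists (r + 1) => w zw.
  rewrite ltNge; apply/negP => h; apply: nw; exists w => //.
  by apply: lt_le_trans h; rewrite ltrDl.
move=> /far[v xv rv] /far[w yw rw]; apply: joined_trans xv _.
apply: joined_trans (joined_sym yw).
apply: (joined_conn (@exterior_connected R r (ltW r0))) => // z /= rz /Kr.
by move=> h; have := lt_trans rz h; rewrite ltxx.
Qed.

(** The directions from [y] and [z] are defined on all of [K] and the face of [x], so they can serve
    as the factor [f] of [face_winding]. *)
Lemma face_exponent K x y z (a b c : int) : compact K -> ~ K x -> ~ K y -> ~ K z ->
  bounded_face K x -> ~ joined K x y -> ~ joined K x z ->
  has_arg K (fun w => dir x w ^ a * (dir y w ^ b * dir z w ^ c)) -> a = 0.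
Proof.
move=> cK nx ny nz [M HM] nxy nxz.
have nUy : ~ (K `|` joined K x) y by case.
have nUz : ~ (K `|` joined K x) z by case.
have u p w : ~ (K `|` joined K x) p -> (K `|` joined K x) w -> uni (dir p w).
  by move=> np Uw; apply: uni_dir => wp; apply: np; rewrite -wp.
apply: face_winding cK nx HM _ _.
  apply: ccontM; apply: ccontX => [w Uw|]; first exact: u.
  - exact: ccont_dir.
  - exact: u.
  - exact: ccont_dir.
by move=> w Uw; apply: uniM; apply/uniX/u.
Qed.

(** If the faces differ, one of them is bounded, because any two unbounded faces coincide. Around a
    point of the bounded one the ratio would have exponent 1 or -1, against [face_exponent]. *)
Lemma joined_arg K x y : compact K -> ~ K x -> ~ K y ->
  has_arg K (fun z => dir x z / dir y z) -> joined K x y.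
Proof.
move=> cK nx ny h; apply: contrapT => nxy.
have [bx|nbx] := pselect (bounded_face K x).
  have : (1 : int) = 0; last by [].
  apply: (@face_exponent K x y y 1 (-1) 0 cK) => //.
  by apply: has_arg_eq h => z Kz; rewrite expr1z expr0z mulr1 -exprnN expr1.
have [bb|nby] := pselect (bounded_face K y); last by apply: nxy; exact: unbounded_joined.
have : (1 : int) = 0; last by [].
apply: (@face_exponent K y x x 1 (-1) 0 cK) => //; do ?by move=> /joined_sym.
have := has_argV h; apply: has_arg_eq => z Kz.
by rewrite invf_div expr1z expr0z mulr1 -exprnN expr1.
Qed.

(** Bounded faces have exponent 0 by [face_exponent]. At most one of the three distinct faces is
    unbounded, and its exponent vanishes because the sum does. *)
Lemma exponents0 K x y z (a b c : int) : compact K -> ~ K x -> ~ K y -> ~ K z ->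
  ~ joined K x y -> ~ joined K x z -> ~ joined K y z -> a + b + c = 0 ->
  has_arg K (fun w => dir x w ^ a * (dir y w ^ b * dir z w ^ c)) ->
  [/\ a = 0, b = 0 & c = 0].
Proof.
move=> cK nx ny nz nxy nxz nyz abc h.
have ha : bounded_face K x -> a = 0.
  by move=> bx; apply: (@face_exponent K x y z a b c).
have hb : bounded_face K y -> b = 0.
  move=> bx; apply: (@face_exponent K y x z b a c) => //; first by move=> /joined_sym.
  by apply: has_arg_eq h => w _; rewrite mulrCA.
have hc : bounded_face K z -> c = 0.
  move=> bx; apply: (@face_exponent K z x y c a b) => //; do ?by move=> /joined_sym.
  by apply: has_arg_eq h => w _; rewrite mulrA mulrC.
have [bx|ux] := pselect (bounded_face K x); have [b_y|uy] := pselect (bounded_face K y);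
  have [bz|uz] := pselect (bounded_face K z).
- by split; [exact: ha|exact: hb|exact: hc].
- by move: (ha bx) (hb b_y) abc => -> -> <-; split => //; rewrite !add0r.
- by move: (ha bx) (hc bz) abc => -> ->; rewrite add0r addr0 => ->.
- by exfalso; apply: nyz; exact: unbounded_joined.
- by move: (hb b_y) (hc bz) abc => -> ->; rewrite !addr0 => ->.
- by exfalso; apply: nxz; exact: unbounded_joined.
- by exfalso; apply: nxy; exact: unbounded_joined.
- by exfalso; apply: nxy; exact: unbounded_joined.
Qed.

Lemma has_arg_glue A B (f : T -> C) (t s : T -> R) : closed A -> closed B ->
  cont_on A t -> cont_on B s ->
  (forall z, A z -> f z = cis (t z)) -> (forall z, B z -> f z = cis (s z)) ->
  (forall z, A z -> B z -> t z = s z) -> has_arg (A `|` B) f.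
Proof.
move=> cA cB ct cs ft fs ts.
pose u z := if `[< A z >] then t z else s z.
have uA z : A z -> t z = u z by rewrite /u; case: asboolP.
have uB z : B z -> s z = u z by rewrite /u; case: asboolP => // Az Bz; rewrite ts.
exists u; last by move=> z [Az|Bz]; [rewrite -uA// ft|rewrite -uB// fs].
by apply: cont_onU => //; [exact: cont_on_eq uA ct|exact: cont_on_eq uB cs].
Qed.

Lemma has_arg_glue1 A B (f : T -> C) c : closed A -> closed B -> A `&` B `<=` [set c] ->
  has_arg A f -> has_arg B f -> has_arg (A `|` B) f.
Proof.
move=> cA cB AB [t ct ft] [s cs fs].
(* The arguments on [A] and [B] differ at [c] by a multiple of 2 pi, by which one of them is
   shifted. If [c] is not in both sets, they are disjoint and any shift will do. *)
pose d := if `[< A c /\ B c >] then t c - s c else 0.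
have cd : cis d = 1.
  rewrite /d; case: asboolP => [[Ac Bc]|_]; last exact: cis0.
  by rewrite cisB -ft// -fs// divff// uni_neq0// ft//; exact: uni_cis.
apply: (@has_arg_glue A B f t (fun z => s z + d)) => //.
- by move=> z Bz; apply: cvgD; [exact: cs|exact: cvg_cst].
- by move=> z Bz; rewrite cisD cd mulr1 fs.
- move=> z Az Bz; have zc : z = c by apply: AB.
  rewrite /d; case: asboolP => [_|]; first by rewrite zc addrC subrK.
  by case; rewrite -zc.
Qed.

(** Vanishing first cohomology, phrased with maps to the circle. By [joined_arg] a compact set with
    this property does not separate the plane. *)
Definition acyclic A := forall f : T -> C,
  ccont A f -> (forall z, A z -> uni (f z)) -> has_arg A f.

Lemma acyclic1 c : acyclic [set c].
Proof.
move=> f _ uf; have := @has_arg_cst R T [set c] (f c) (uf c erefl).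
by apply: has_arg_eq => z ->.
Qed.

Lemma acyclic0 : acyclic set0.
Proof.
by move=> f _ _; exists (fun=> 0) => // x.
Qed.

Lemma ccont_dir_ratio A x y : ~ A x -> ~ A y -> ccont A (fun z => dir x z / dir y z).
Proof.
move=> nx ny; apply: ccontM; first exact: ccont_dir.
apply: ccontV; last exact: ccont_dir.
by move=> z Az; apply: uni_dir => zy; apply: ny; rewrite -zy.
Qed.

Lemma uni_dir_ratio A x y z : ~ A x -> ~ A y -> A z -> uni (dir x z / dir y z).
Proof.
move=> nx ny Az; apply: uniM; last apply: uniV.
  by apply: uni_dir => zx; apply: nx; rewrite -zx.
by apply: uni_dir => zx; apply: ny; rewrite -zx.
Qed.

Lemma acyclic_dir A x y : acyclic A -> ~ A x -> ~ A y ->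
  has_arg A (fun z => dir x z / dir y z).
Proof.
by move=> acA nx ny; apply: acA; [exact: ccont_dir_ratio|move=> z; exact: uni_dir_ratio].
Qed.

Lemma acyclicU A B c : closed A -> closed B -> A `&` B `<=` [set c] ->
  acyclic A -> acyclic B -> acyclic (A `|` B).
Proof.
move=> cA cB AB aA aB f cf uf; apply: (has_arg_glue1 cA cB AB).
  by apply: aA; [apply: ccont_sub cf => z; left|move=> z Az; apply: uf; left].
by apply: aB; [apply: ccont_sub cf => z; right|move=> z Az; apply: uf; right].
Qed.

(** The argument known on [K1] and [K2] and the one that exists on [A] are glued along single
    points, so no winding can arise. This covers an edge that links two components of a drawing. *)
Lemma joined_bridge K1 K2 A c d x y : compact K1 -> compact K2 -> compact A -> acyclic A ->
  K1 `&` A `<=` [set c] -> (K1 `|` A) `&` K2 `<=` [set d] -> ~ A x -> ~ A y ->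
  joined (K1 `|` K2) x y -> joined ((K1 `|` A) `|` K2) x y.
Proof.
move=> c1 c2 cA aA h1 h2 nx ny xy.
have cK12 := compactU c1 c2.
have nx' : ~ ((K1 `|` A) `|` K2) x.
  by have := joined_offl xy; move=> H [[?|//]|?]; apply: H; [left|right].
have ny' : ~ ((K1 `|` A) `|` K2) y.
  by have := joined_off xy; move=> H [[?|//]|?]; apply: H; [left|right].
have h := arg_joined cK12 xy.
apply: joined_arg => //; first by do 2 apply: compactU => //.
apply: (has_arg_glue1 _ _ h2).
- by apply: compact_closedP; exact: compactU.
- exact: compact_closedP.
- apply: (has_arg_glue1 _ _ h1); try exact: compact_closedP.
    by apply: has_arg_sub h => z; left.
  exact: acyclic_dir.
- by apply: has_arg_sub h => z; right.
Qed.

Lemma joined_dangle K A c x y : compact K -> compact A -> acyclic A ->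
  K `&` A `<=` [set c] -> ~ A x -> ~ A y ->
  joined K x y -> joined (K `|` A) x y.
Proof.
move=> cK cA aA h nx ny xy; rewrite -[K `|` A]setU0.
apply: (@joined_bridge K set0 A c c) => //; first exact: compact0.
  by move=> z [].
by rewrite setU0.
Qed.

Lemma acyclic_joined A x y : compact A -> acyclic A -> ~ A x -> ~ A y -> joined A x y.
Proof.
move=> cA aA nx ny; rewrite -[A]set0U; apply: (@joined_dangle set0 A 0) => //.
- exact: compact0.
- by move=> z [].
- apply: (@joined_conn R set0 setT) => //.
  apply: conv_connected => //.
  by move=> z _ [].
Qed.

Lemma inverse_cont (X Y : ptopologicalType) (A : set X) (g : X -> Y) :
  compact A -> hausdorff_space Y -> cont_on A g ->
  (forall s t, A s -> A t -> g s = g t -> s = t) ->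
  exists2 h : Y -> X, cont_on (g @` A) h & forall t, A t -> h (g t) = t.
Proof.
move=> cA hY cg ig.
pose h (y : Y) := get [set t | A t /\ g t = y].
have hK t : A t -> h (g t) = t.
  move=> At; have [] : [set s | A s /\ g s = g t] (h (g t)) by apply: getPex; exists t.
  by move=> Ah; apply: ig.
exists h => //; apply/cont_onP/continuous_closedP => W cW.
apply/closed_subspaceP; exists (g @` (A `&` W)).
  apply: compact_closed => //; apply: compact_image; first by apply: cont_on_sub cg => z [].
  exact: compact_closedI.
apply/seteqP; split => y.
  by case=> -[t [At Wt] <-] _; split; [change (W (h (g t))); rewrite hK|exists t].
by case=> /= Wy [t At ty]; split; exists t => //; split => //; rewrite -(hK t)// ty.
Qed.

Definition iarc (g : R -> T) :=
  cont_on I01 g /\ forall s t, I01 s -> I01 t -> g s = g t -> s = t.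

Lemma arc_compact g : iarc g -> compact (g @` I01).
Proof. by move=> [cg _]; apply: compact_image => //; exact: compact01. Qed.

Lemma arc_connected g : iarc g -> connected (g @` I01).
Proof. by move=> [cg _]; apply: connected_image => //; exact: connected01. Qed.

Lemma arc_acyclic g : iarc g -> acyclic (g @` I01).
Proof.
move=> [cg ig] f cf uf.
have [h ch hK] := inverse_cont (@compact01 R) (@norm_hausdorff _ _) cg ig.
have : has_arg I01 (f \o g).
  apply: lift01; first by apply: (ccont_comp _ cg cf) => t It; exists t.
  by move=> t; rewrite -in01 => It; apply: uf; exists t.
move=> /(has_arg_comp (A := g @` I01) (h := h)) H.
apply: (@has_arg_eq R T (g @` I01) ((f \o g) \o h)).
  by move=> _ [t It <-] /=; rewrite hK.
by apply: H => // _ [t It <-]; rewrite hK.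
Qed.

Lemma i01_0 : I01 0. Proof. by rewrite in01 lexx ler01. Qed.
Lemma i01_1 : I01 1. Proof. by rewrite in01 lexx ler01. Qed.

(** An arc splits a face into at most two. The arguments of [dir x / dir y] on [K] and on the arc
    can be made equal at [g 0]; at [g 1] they then differ by 2 pi m1, and those of [dir x / dir z]
    by 2 pi m2. Two integers satisfy a linear relation, so a product of powers of the two ratios has
    an argument on the union, which [exponents0] forbids for three distinct faces. *)
Lemma joined_three K g x y z : compact K -> iarc g ->
  K `&` (g @` I01) `<=` [set g 0; g 1] ->
  ~ (g @` I01) x -> ~ (g @` I01) y -> ~ (g @` I01) z ->
  joined K x y -> joined K x z ->
  [\/ joined (K `|` g @` I01) x y, joined (K `|` g @` I01) x z |
      joined (K `|` g @` I01) y z].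
Proof.
move=> cK ag KA nx ny nz xy xz; set A := g @` I01 in KA nx ny nz *.
have cA : compact A := arc_compact ag.
have aA : acyclic A := arc_acyclic ag.
have clK := compact_closedP cK; have clA := compact_closedP cA.
have [K0|nK0] := pselect (K (g 0)); last first.
  constructor 1; apply: (@joined_dangle K A (g 1)) => // w Hw.
  by case: (KA w Hw) => // w0; case: Hw; rewrite w0.
have [K1|nK1] := pselect (K (g 1)); last first.
  constructor 1; apply: (@joined_dangle K A (g 0)) => // w Hw.
  by case: (KA w Hw) => // w0; case: Hw; rewrite w0.
have A0 : A (g 0) by exists 0 => //; exact: i01_0.
have A1 : A (g 1) by exists 1 => //; exact: i01_1.
have nKx := joined_offl xy; have nKy := joined_off xy; have nKz := joined_off xz.
have nUx : ~ (K `|` A) x by case.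
have nUy : ~ (K `|` A) y by case.
have nUz : ~ (K `|` A) z by case.
have key p : ~ A p -> joined K x p -> exists (m : int) (t s : T -> R),
    [/\ cont_on K t, cont_on A s,
     forall w, K w -> dir x w / dir p w = cis (t w),
     forall w, A w -> dir x w / dir p w = cis (s w) &
     t (g 0) = s (g 0) /\ t (g 1) - s (g 1) = pi *+ 2 * m%:~R].
  move=> np xp; have [t ct ft] := arg_joined cK xp.
  have [s cs fs] := acyclic_dir aA nx np.
  have u w : A w -> cis (s w) / cis (s w) = 1.
    by move=> Aw; rewrite divff// uni_neq0//; exact: uni_cis.
  pose d := t (g 0) - s (g 0).
  have cd : cis d = 1 by rewrite cisB -ft// fs// u.
  have [m em] : exists m : int, (t (g 1) - (s (g 1) + d)) = pi *+ 2 * m%:~R.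
    by apply: cis_eq1; rewrite cisB cisD cd mulr1 -ft// fs// u.
  exists m, t, (fun w => s w + d); split => //.
  - by move=> w Aw; apply: cvgD; [exact: cs|exact: cvg_cst].
  - by move=> w Aw; rewrite cisD cd mulr1 fs.
  - by split => //; rewrite /d addrC subrK.
have [m1 [t1 [s1 [ct1 cs1 ft1 fs1 [e10 e11]]]]] := key y ny xy.
have [m2 [t2 [s2 [ct2 cs2 ft2 fs2 [e20 e21]]]]] := key z nz xz.
have cU : compact (K `|` A) by exact: compactU.
have arg (a b : int) : m1 * a + m2 * b = 0 ->
    has_arg (K `|` A) (fun w => (dir x w / dir y w) ^ a * (dir x w / dir z w) ^ b).
  move=> mab.
  apply: (@has_arg_glue K A _ (fun w => t1 w * a%:~R + t2 w * b%:~R)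
     (fun w => s1 w * a%:~R + s2 w * b%:~R)) => //.
  - by move=> w Kw; apply: cvgD; apply: cvgM; [exact: ct1|exact: cvg_cst|exact: ct2|exact: cvg_cst].
  - by move=> w Kw; apply: cvgD; apply: cvgM; [exact: cs1|exact: cvg_cst|exact: cs2|exact: cvg_cst].
  - by move=> w Kw; rewrite cisD (cisX (t1 w) a) (cisX (t2 w) b) (ft1 w Kw) (ft2 w Kw).
  - by move=> w Kw; rewrite cisD (cisX (s1 w) a) (cisX (s2 w) b) (fs1 w Kw) (fs2 w Kw).
  - move=> w Kw Aw; case: (KA w (conj Kw Aw)) => ->; first by rewrite e10 e20.
    apply/eqP; rewrite -subr_eq0; apply/eqP.
    have -> : t1 (g 1) * a%:~R + t2 (g 1) * b%:~R - (s1 (g 1) * a%:~R + s2 (g 1) * b%:~R) =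
      (t1 (g 1) - s1 (g 1)) * a%:~R + (t2 (g 1) - s2 (g 1)) * b%:~R by ring.
    rewrite e11 e21 -!mulrA -mulrDr -!intrM -intrD mab mulr0 //.
apply: contrapT => H.
have nxy : ~ joined (K `|` A) x y by move=> ?; apply: H; constructor 1.
have nxz : ~ joined (K `|` A) x z by move=> ?; apply: H; constructor 2.
have nyz : ~ joined (K `|` A) y z by move=> ?; apply: H; constructor 3.
(* The relation m1 m2 - m2 m1 = 0 yields the exponents m2 - m1, -m2, m1, all of which must vanish.
   Then [m2 = 0], and [dir x / dir z] alone has an argument. *)
have [_ /eqP + _] : [/\ m2 - m1 = 0, - m2 = 0 & m1 = 0].
  apply: (@exponents0 (K `|` A) x y z) => //; first by ring.
  have : m1 * m2 + m2 * (- m1) = 0 by ring.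
  move=> /arg; apply: has_arg_eq => w Uw.
  have d0 p : ~ (K `|` A) p -> dir p w != 0.
    by move=> np; apply/uni_neq0/uni_dir => wp; apply: np; rewrite -wp.
  rewrite !expfzMl !expfzDr ?d0// !exprz_inv opprK; ring.
rewrite oppr_eq0 => /eqP m20.
have : m1 * 0 + m2 * 1 = 0 by rewrite m20; ring.
move=> /arg h; apply: nxz; apply: joined_arg => //.
by apply: has_arg_eq h => w Uw; rewrite expr0z expr1z mul1r.
Qed.

(** The argument at [z] is the angle that the moving point [g t] sweeps as seen from [z]. For [z]
    near [z0] the two lifts differ by the small angle [del z], which gives continuity. *)
Lemma winding_fun (g : R -> T) : cont_on I01 g ->
  has_arg (~` (g @` I01)) (fun z => dir z (g 1) / dir z (g 0)).
Proof.
move=> cg; set A := g @` I01.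
have cA : compact A by apply: compact_image => //; exact: compact01.
have oA : open (~` A) by apply: closed_openC; exact: compact_closedP.
have nA z t : ~ A z -> I01 t -> g t <> z by move=> nz It gz; apply: nz; exists t.
have cdir2 : ccont (~` A `*` I01) (fun p : T * R => dir p.1 (g p.2)).
  apply: (@ccont_comp _ _ _ (~` A `*` I01) [set p : T * T | p.1 <> p.2]
    (fun p : T * R => (p.1, g p.2)) (fun p => dir p.1 p.2)).
  - by move=> [z t] [/= nz It] zg; apply: (nA z t).
  - apply: cont_on_pair; first by apply: continuous_cont_on => p; exact: cvg_fst.
    apply: (@cont_on_comp _ _ _ _ I01 snd g) => //; first by move=> p [].
    by apply: continuous_cont_on => p; exact: cvg_snd.
  - exact: ccont_dir2.
have udir z t : ~ A z -> I01 t -> uni (dir z (g t)).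
  by move=> nz It; apply/uni_dir/nA.
have cdir z : ~ A z -> ccont I01 (fun t => dir z (g t)).
  by move=> nz; apply: (@slice_ccont _ T R (~` A) I01 (fun z t => dir z (g t)) z).
have lift z : exists t : R -> R, ~ A z -> cont_on I01 t /\
    forall s, I01 s -> dir z (g s) = cis (t s).
  have [nz|Az] := pselect (~ A z); last by exists (fun=> 0).
  have [t ct ft] : has_arg I01 (fun t => dir z (g t)).
    by apply: lift01; [exact: cdir|move=> s; rewrite -in01; exact: udir].
  by exists t.
(* The lifts are chosen separately for each [z]; only the increment [th z 1 - th z 0] does not
   depend on the choice. *)
pose th z := projT1 (cid (lift z)).
have thP z : ~ A z -> cont_on I01 (th z) /\ forall s, I01 s -> dir z (g s) = cis (th z s).
  exact: (projT2 (cid (lift z))).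
have I0 := i01_0; have I1 := i01_1.
exists (fun z => th z 1 - th z 0); last first.
  by move=> z nz; have [_ h] := thP z nz; rewrite cisB !h.
move=> z0 nz0; apply: cvg_within_filter.
pose rho z t := dir z (g t) / dir z0 (g t).
pose del z t := asin (im (rho z t)).
have [ct0 ft0] := thP z0 nz0.
have near0 : \forall z \near z0, ~ A z by apply: open_nbhs_nbhs.
have near1 : \forall z \near z0, forall t, I01 t -> 0 < re (rho z t).
  have := @compact_near_ratio R T R (~` A) I01 (fun z t => dir z (g t)) (@compact01 R) cdir2 udir z0 nz0.
  by rewrite within_interior//; exact: near0.
have near2 : \forall z \near z0, (th z0 1 - th z0 0) + (del z 1 - del z 0) = th z 1 - th z 0.
  apply: filterS2 near0 near1 => z nz pz; have [ct ft] := thP z nz.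
  have [cd fd] : cont_on I01 (del z) /\ forall t, I01 t -> rho z t = cis (del z t).
    apply: (@arg_near R R I01 (rho z)) => //.
      by apply: ccontM; [exact: cdir|apply: ccontV; [move=> t; exact: udir|exact: cdir]].
    by move=> t It; apply: uniM; [exact: udir|exact/uniV/udir].
  have := @arg_unique R R I01 (fun t => dir z (g t)) (th z) (fun t => th z0 t + del z t)
    (@connected01 R) ct _ ft _ 0 1 I0 I1.
  move=> H; suff : th z 0 - (th z0 0 + del z 0) = th z 1 - (th z0 1 + del z 1) by lra.
  apply: H; first by move=> t It; apply: cvgD; [exact: ct0|exact: cd].
  by move=> t It; rewrite cisD -ft0// -fd// mulrC divfK// uni_neq0//; exact: udir.
have dz t : I01 t -> del z t @[z --> z0] --> del z0 t.
  move=> It.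
  have c : ccont (~` A) (fun z => rho z t).
    apply: ccontM; first by apply: ccont_dirl; apply; exists t.
    exact: ccont_cst.
  apply: (@continuous_cvg _ _ _ (nbhs z0) _ (fun z => im (rho z t)) asin).
    apply: continuous_asin; rewrite /rho divff ?uni_neq0//=; last exact: udir.
    by rewrite ltrN10 ltr01.
  by case: c => _ c; apply: (cont_on_open oA c nz0).
have e0 : th z0 1 - th z0 0 = (th z0 1 - th z0 0) + (del z0 1 - del z0 0).
  by rewrite /del /rho !divff ?uni_neq0//= ?subrr ?addr0//; exact: udir.
suff : th z 1 - th z 0 @[z --> z0] --> th z0 1 - th z0 0 + (del z0 1 - del z0 0).
  by rewrite -e0.
apply: cvg_trans; first by apply: near_eq_cvg; exact: near2.
by apply: cvgD; [exact: cvg_cst|apply: cvgB; exact: dz].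
Qed.

Lemma dir_opp (p q : T) : dir p q = - dir q p.
Proof.
rewrite /dir /dirv -(opprB p q); apply/eqP; rewrite eq_complex /=.
have -> : nrm2 (- (p - q)) = nrm2 (p - q) by rewrite /nrm2 /= !sqrrN.
by rewrite !mulNr !eqxx.
Qed.

(* Otherwise the winding functions of the two arcs would paste to an argument
   of [dir z b / dir z a] around [a]. *)
Lemma jordan (g h : R -> T) : iarc g -> iarc h -> g 0 = h 0 -> g 1 = h 1 ->
  (g @` I01) `&` (h @` I01) `<=` [set g 0; g 1] ->
  exists x y, [/\ ~ (g @` I01 `|` h @` I01) x, ~ (g @` I01 `|` h @` I01) y &
    ~ joined (g @` I01 `|` h @` I01) x y].
Proof.
move=> ag ah e0 e1 gh; apply: contrapT => H.
set A := g @` I01 in gh H *; set B := h @` I01 in gh H *.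
have J x y : ~ (A `|` B) x -> ~ (A `|` B) y -> joined (A `|` B) x y.
  by move=> nx ny; apply: contrapT => nj; apply: H; exists x, y.
set a := g 0 in e0 gh; set b := g 1 in e1 gh.
have ab : b <> a by move=> /(proj2 ag _ _ i01_1 i01_0) /eqP; rewrite oner_eq0.
have cA : compact A := arc_compact ag; have cB : compact B := arc_compact ah.
have oA : open (~` A) by apply: closed_openC; exact: compact_closedP.
have oB : open (~` B) by apply: closed_openC; exact: compact_closedP.
have [dA cdA fA] := winding_fun (proj1 ag); have [dB cdB fB] := winding_fun (proj1 ah).
rewrite -/A in cdA fA; rewrite -/B -e0 -e1 in cdB fB.
(* Both increments are arguments of the same quotient, so they differ by a multiple of 2 pi, which
   is constant since the complement is assumed to be a single face. *)
have [c [cc Hc]] : exists c : R, cis c = 1 /\ forall z, ~ (A `|` B) z -> dA z - dB z = c.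
  have w1 z : ~ (A `|` B) z -> cis (dA z - dB z) = 1.
    move=> nz; rewrite cisB -fA -?fB ?divff//; try by move=> ?; apply: nz; (left + right).
    have u p : A p -> uni (dir z p).
      by move=> Ap; apply: uni_dir => pz; apply: nz; left; rewrite -pz.
    by apply/uni_neq0/uniM; [|apply: uniV]; apply: u; [exists 1 => //; exact: i01_1|exists 0 => //; exact: i01_0].
  have [[x0 nx0]|no] := pselect (exists x0, ~ (A `|` B) x0); last first.
    by exists 0; split=> [|z nz]; [exact: cis0|exfalso; apply: no; exists z].
  exists (dA x0 - dB x0); split; first exact: w1.
  move=> z nz; apply: (@cis_const R T (joined (A `|` B) x0) (fun z => dA z - dB z)).
  - exact: component_connected.
  - move=> w /joined_off nw; apply: cvgB.
      by apply: (cont_on_sub _ cdA (x := w)) => //; [move=> v /joined_off nv ?; apply: nv; left|exact: J].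
    by apply: (cont_on_sub _ cdB (x := w)) => //; [move=> v /joined_off nv ?; apply: nv; right|exact: J].
  - by move=> w /joined_off; exact: w1.
  - exact: J.
  - exact: J.
pose u z := if `[< A z >] then dB z + c else dA z.
have uA z : ~ A z -> dA z = u z by rewrite /u; case: asboolP.
have uB z : ~ B z -> dB z + c = u z.
  move=> nB; rewrite /u; case: asboolP => // nA.
  have <- : dA z - dB z = c by apply: Hc; case.
  by rewrite addrC subrK.
pose D := ~` [set a; b].
have DAB z : D z -> ~ A z \/ ~ B z.
  move=> Dz; have [Az|] := pselect (A z); [right => Bz|by left].
  by apply: Dz; apply: gh.
have HD : has_arg D (fun z => dir z b / dir z a).
  exists u.
    move=> z /DAB Hz; apply: cvg_within_filter; case: Hz => nz.
      exact: (cont_on_open oA (cont_on_eq uA cdA)).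
    have cu : cont_on (~` B) (fun z => dB z + c).
      by move=> w Bw; apply: cvgD; [exact: cdB|exact: cvg_cst].
    exact: (cont_on_open oB (cont_on_eq uB cu)).
  move=> z /DAB [nz|nz]; first by rewrite -uA// fA.
  by rewrite -uB// cisD cc mulr1 fB.
have nba : 0 < `|b - a| by rewrite normr_gt0 subr_eq0; apply/eqP.
(* The circle of radius [r] around [a] leaves [b] outside, so [dir z b] contracts on it to the
   constant [dir a b], while [dir z a] winds once. *)
pose r := `|b - a| / 2; have r0 : 0 < r by rewrite divr_gt0.
have nsw (s : R) w : 0 <= s <= r -> S1 w -> a + s *: w <> b.
  move=> /andP[s0 s1] /S1_norm/andP[_ w1] e.
  have : `|b - a| <= s by rewrite -e addrC addKr normrZ ger0_norm// ler_piMr.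
  by move: s1 nba; rewrite /r; lra.
have h1 : has_arg (@S1 R) (fun w : T => dir (a + r *: w) b / dir (a + r *: w) a).
  apply: (@has_arg_comp R T T (@S1 R) D (fun w : T => a + r *: w) (fun z => dir z b / dir z a)) => //.
    move=> w Sw [] /=; last by apply: nsw => //; rewrite lexx ltW.
    move=> /eqP; rewrite -subr_eq0 addrC addKr scaler_eq0 gt_eqF//= => /eqP w0.
    by have := S1_norm Sw; rewrite w0 normr0; lra.
  apply: continuous_cont_on => w; apply: cvgD; first exact: cvg_cst.
  by apply: cvgZ; [exact: cvg_cst|exact: cvg_id].
have h2 : has_arg (@S1 R) (fun w : T => dir (a + r *: w) b).
  apply: (@homotopy_arg_compact R R T `[0, r]%classic (@S1 R) (fun (s : R) (w : T) => dir (a + s *: w) b) (@segment_connected _ _ _) (@compact_S1 R) _ _ 0 r) => //.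
  - apply: (@ccont_comp R (R * T)%type T (`[0, r]%classic `*` @S1 R) (~` [set b]) (fun p : R * T => a + p.1 *: p.2) (fun z : T => dir z b)).
    + by move=> [s w] [] /=; rewrite in_itv /=; exact: nsw.
    + apply: continuous_cont_on => p; apply: cvgD; first exact: cvg_cst.
      by apply: cvgZ; [exact: cvg_fst|exact: cvg_snd].
    + by apply: ccont_dirl; apply.
  - move=> s w; rewrite /= in_itv /= => s1 Sw; apply: uni_dir => e.
    by apply: (nsw s w).
  - by rewrite /= in_itv /= lexx ltW.
  - by rewrite /= in_itv /= lexx ltW.
  - apply: (@has_arg_eq R T (@S1 R) (fun=> dir a b)); first by move=> w _; rewrite scale0r addr0.
    exact/has_arg_cst/uni_dir.
have : (1 : int) = 0; last by [].
apply: (@winding_S1 R).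
have uN1 : uni (-1 : C) by rewrite -cispi; exact: uni_cis.
have := has_argM (@has_arg_cst R T (@S1 R) _ uN1) (has_argM h2 (has_argV h1)).
apply: has_arg_eq => w Sw.
have d1 : dir (a + r *: w) b != 0.
  by apply/uni_neq0/uni_dir => e; apply: (nsw r w) => //; rewrite lexx ltW.
by rewrite invf_div (mulrC (dir (a + r *: w) b)) divfK// mulN1r (dir_opp (a + r *: w)) opprK dir_S1// expr1z.
Qed.

End Separation.

(** * Arcs in the plane *)

Section Arcs.
Variable R : realType.
Local Notation T := (R * R)%type.
Local Notation I01 := (`[0, 1]%classic : set R).
Implicit Types (A B D U : set T) (p q r v x y z : T).

Definition parc p q A := exists g : R -> T, [/\ iarc g, g 0 = p, g 1 = q & g @` I01 = A].

Lemma parc_compact p q A : parc p q A -> compact A.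
Proof. by case=> g [ag _ _ <-]; exact: arc_compact. Qed.

Lemma parc_closed p q A : parc p q A -> closed A.
Proof. by move/parc_compact; exact: compact_closedP. Qed.

Lemma parc_connected p q A : parc p q A -> connected A.
Proof. by case=> g [ag _ _ <-]; exact: arc_connected. Qed.

Lemma parc_acyclic p q A : parc p q A -> acyclic A.
Proof. by case=> g [ag _ _ <-]; exact: arc_acyclic. Qed.

Lemma parc_l p q A : parc p q A -> A p.
Proof. by case=> g [ag <- _ <-]; exists 0 => //; exact: i01_0. Qed.

Lemma parc_r p q A : parc p q A -> A q.
Proof. by case=> g [ag _ <- <-]; exists 1 => //; exact: i01_1. Qed.

(** Since [b < a] is allowed, this yields reversed arcs as well as subarcs. *)
Lemma parc_reparam (g : R -> T) (a b : R) : iarc g -> I01 a -> I01 b -> a != b ->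
  parc (g a) (g b) ((fun t => g (a + t * (b - a))) @` I01).
Proof.
move=> [cg ig]; rewrite !in01 => /andP[a0 a1] /andP[b0 b1] ab.
have I t : I01 t -> I01 (a + t * (b - a)).
  rewrite !in01 => /andP[t0 t1]; apply/andP; split; nra.
exists (fun t => g (a + t * (b - a))); split => //.
- split.
    apply: (cont_on_comp I _ cg); apply: continuous_cont_on => t.
    by apply: cvgD; [exact: cvg_cst|apply: cvgM; [exact: cvg_id|exact: cvg_cst]].
  move=> s t Is It /(ig _ _ (I _ Is) (I _ It)) /addrI/mulIf; apply.
  by rewrite subr_eq0 eq_sym.
- by rewrite mul0r addr0.
- by rewrite mul1r addrC subrK.
Qed.

Lemma parc_sym p q A : parc p q A -> parc q p A.
Proof.
case=> g [ag <- <- <-].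
have -> : g @` I01 = (fun t => g (1 + t * (0 - 1))) @` I01.
  have e (t : R) : 1 + t * (0 - 1) = 1 - t by ring.
  apply/seteqP; split => _ [t It <-]; exists (1 - t); rewrite ?e ?subKr//;
    by move: It; rewrite !in01 => /andP[? ?]; apply/andP; split; lra.
apply: parc_reparam ag (@i01_1 R) (@i01_0 R) _; exact: oner_neq0.
Qed.

Lemma parc_sub p q A x y : parc p q A -> A x -> A y -> x <> y ->
  exists2 B, parc x y B & B `<=` A.
Proof.
case=> g [ag _ _ <-] [a Ia <-] [b Ib <-] ab.
exists ((fun t => g (a + t * (b - a))) @` I01).
  by apply: parc_reparam => //; apply/eqP => e; apply: ab; rewrite e.
move=> _ [t + <-]; move: Ia Ib; rewrite !in01 => /andP[? ?] /andP[? ?] /andP[? ?].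
by exists (a + t * (b - a)) => //; rewrite in01; apply/andP; split; nra.
Qed.

(** Walk along the arc from [x] towards a point of [D] and stop at the first parameter, an infimum,
    that lies over the closed set [D]. *)
Lemma parc_travel a b A D x : parc a b A -> closed D -> A x -> ~ D x ->
  A `&` D !=set0 ->
  exists q B, [/\ D q, parc x q B, B `<=` A & B `&` D `<=` [set q]].
Proof.
case=> g [ag _ _ <-] cD [s Is <-] nD [_ [[t It <-] Dt]].
have [cg ig] := ag.
pose h u := s + u * (t - s).
have Ih u : I01 u -> I01 (h u).
  move: Is It; rewrite !in01 /h => /andP[? ?] /andP[? ?] /andP[? ?].
  by apply/andP; split; nra.
have ch : cont_on I01 (g \o h).
  apply: (cont_on_comp Ih _ cg); apply: continuous_cont_on => u.
  by apply: cvgD; [exact: cvg_cst|apply: cvgM; [exact: cvg_id|exact: cvg_cst]].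
pose S := [set u | I01 u /\ D (g (h u))].
have S1 : S 1 by split; [exact: i01_1|rewrite /h mul1r addrC subrK].
have cS : closed S.
  have /cont_onP/continuous_closedP/(_ _ cD)/closed_subspaceP [W cW eW] := ch.
  have -> : S = W `&` I01 by rewrite eW; apply/seteqP; split => u /= [].
  by apply: closedI => //; exact: (compact_closed (@norm_hausdorff _ _) (@compact01 R)).
have iS : has_inf S by split; [exists 1|exists 0 => u [] /=; rewrite in_itv /= => /andP[]].
pose u0 := inf S.
have Su0 : S u0.
  rewrite (closure_id S).1// => W /nbhs_ballP[e /= e0 be].
  have [u Su ue] := inf_adherent e0 iS.
  exists u; split => //; apply: be; rewrite -ball_normE /ball_/= distrC ger0_norm.
    by rewrite ltrBlDl.
  by rewrite subr_ge0; apply: ge_inf => //; case: iS.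
have [Iu0 Du0] := Su0.
have u00 : 0 < u0.
  move: Iu0; rewrite in01 => /andP[u0' _]; rewrite lt_def u0' andbT.
  by apply/eqP => e; apply: nD; move: Du0; rewrite e /h mul0r addr0.
have hu0 : h u0 - s = u0 * (t - s) by rewrite /h addrC addKr.
have ts : t != s by apply/eqP => e; apply: nD; rewrite -e.
have shu : s != h u0.
  apply/eqP => e; move/eqP: hu0.
  by rewrite -e subrr eq_sym mulf_eq0 gt_eqF//= subr_eq0 (negbTE ts).
exists (g (h u0)), ((fun w => g (s + w * (h u0 - s))) @` I01); split => //.
- by apply: parc_reparam => //; exact: Ih.
- move=> _ [w Iw <-]; exists (h (w * u0)); last by rewrite hu0 /h mulrA.
  by apply: Ih; move: Iw Iu0; rewrite !in01 => /andP[? ?] /andP[? ?]; apply/andP; split; nra.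
- move=> _ [[w Iw <-]]; rewrite hu0 mulrA => Dw; congr (g _); rewrite /h.
  have Sw : S (w * u0).
    by split => //; move: Iw Iu0; rewrite !in01 => /andP[? ?] /andP[? ?]; apply/andP; split; nra.
  have : u0 <= w * u0 by apply: ge_inf => //; case: iS.
  rewrite -[X in X <= _]mul1r ler_pM2r// => w1.
  by move: Iw; rewrite in01 => /andP[_ w2]; have -> : w = 1 by [lra]; rewrite mul1r.
Qed.

Lemma half_cases (t : R) : I01 t -> 0 <= t <= 1/2 \/ 1/2 <= t <= 1.
Proof.
rewrite in01 => /andP[t0 t1]; have [h|h] := leP t (1/2); [left|right].
  by rewrite t0.
by rewrite t1 ltW.
Qed.

Lemma parc_cat p q r A B : parc p q A -> parc q r B -> A `&` B `<=` [set q] ->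
  parc p r (A `|` B).
Proof.
case=> g [[cg ig] g0 g1 gA] [h [[ch ih] h0 h1 hB]] AB.
pose f (t : R) := if t <= 1/2 then g (2 * t) else h (2 * t - 1).
have f1 t : t <= 1/2 -> g (2 * t) = f t by rewrite /f => ->.
have f2 t : 1/2 <= t -> h (2 * t - 1) = f t.
  rewrite /f; case: (leP t (1/2)) => // t1 t2; have -> : t = 1/2 by apply/eqP; rewrite eq_le t1.
  have -> : 2 * (1/2) - 1 = 0 :> R by lra.
  by have -> : 2 * (1/2) = 1 :> R by [lra]; rewrite g1.
have Ig t : 0 <= t <= 1/2 -> I01 (2 * t) by rewrite in01 => /andP[? ?]; apply/andP; split; lra.
have Ihh t : 1/2 <= t <= 1 -> I01 (2 * t - 1) by rewrite in01 => /andP[? ?]; apply/andP; split; lra.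
have fgA t : 0 <= t <= 1/2 -> A (f t).
  by move=> ti; rewrite -gA; exists (2 * t); [exact: Ig|rewrite f1//; case/andP: ti].
have fhB t : 1/2 <= t <= 1 -> B (f t).
  by move=> ti; rewrite -hB; exists (2 * t - 1); [exact: Ihh|rewrite f2//; case/andP: ti].
have cross s t : 0 <= s <= 1/2 -> 1/2 <= t <= 1 -> f s = f t -> s = t.
  move=> si ti e; have fq : f s = q.
    by apply: AB; split; [exact: fgA|rewrite e; exact: fhB].
  have : 2 * s = 1.
    apply: ig; [exact: Ig|exact: i01_1|rewrite g1 -fq f1//]; by case/andP: si.
  have : 2 * t - 1 = 0.
    apply: ih; [exact: Ihh|exact: i01_0|rewrite h0 -fq e f2//]; by case/andP: ti.
  lra.
exists f; split.
- split.
    have -> : I01 = `[0, 1/2]%classic `|` `[1/2, 1]%classic.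
      apply/seteqP; split => t.
        by move=> /half_cases[h2|h2]; [left|right]; rewrite /= in_itv.
      by case; rewrite /= !in_itv /= => /andP[? ?]; apply/andP; split; lra.
    have ca : continuous (fun t : R => 2 * t).
      by move=> t; apply: cvgM; [exact: cvg_cst|exact: cvg_id].
    apply: cont_onU; try exact: itv_closed.
      apply: (@cont_on_eq R T _ (fun t : R => g (2 * t)) f).
        by move=> t; rewrite /= in_itv /= => /andP[_ ?]; exact: f1.
      apply: (@cont_on_comp R R T _ I01 (fun t : R => 2 * t) g) => //; last exact: continuous_cont_on.
    apply: (@cont_on_eq R T _ (fun t : R => h (2 * t - 1)) f).
      by move=> t; rewrite /= in_itv /= => /andP[? _]; exact: f2.
    apply: (@cont_on_comp R R T _ I01 (fun t : R => 2 * t - 1) h) => //.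
    by apply: continuous_cont_on => t; apply: cvgB; [exact: ca|exact: cvg_cst].
  move=> s t /half_cases[si|si] /half_cases[ti|ti] e.
  + have : 2 * s = 2 * t; last by lra.
    by apply: ig; [exact: Ig|exact: Ig|rewrite !f1//; [case/andP: ti|case/andP: si]].
  + exact: cross.
  + by apply/esym/cross.
  + have : 2 * s - 1 = 2 * t - 1; last by lra.
    by apply: ih; [exact: Ihh|exact: Ihh|rewrite !f2//; [case/andP: ti|case/andP: si]].
- by rewrite -f1 ?mulr0//; lra.
- by rewrite -f2; [have -> : 2 * 1 - 1 = 1 :> R by lra|lra].
- apply/seteqP; split.
    by move=> _ [t /half_cases[ti|ti] <-]; [left; exact: fgA|right; exact: fhB].
  move=> w [|].
    rewrite -gA => -[t + <-]; rewrite in01 => /andP[? ?]; exists (t / 2).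
      by rewrite in01; apply/andP; split; lra.
    by rewrite -f1; [congr (g _); lra|lra].
  rewrite -hB => -[t + <-]; rewrite in01 => /andP[? ?]; exists ((t + 1) / 2).
    by rewrite in01; apply/andP; split; lra.
  by rewrite -f2; [congr (h _); lra|lra].
Qed.

(** Concatenation need not be injective; instead [A] is left at its first point on [B], and [B] is
    followed from there. *)
Lemma parc_join p q r A B : parc p q A -> parc q r B -> p <> r ->
  exists2 D, parc p r D & D `<=` A `|` B.
Proof.
move=> pA pB pr; have [Bp|nBp] := pselect (B p).
  have [D pD DB] := parc_sub pB Bp (parc_r pB) pr.
  by exists D => // z /DB; right.
have [x [A' [Bx pA' A'A A'B]]] := parc_travel pA (parc_closed pB) (parc_l pA) nBp
  (ex_intro _ q (conj (parc_r pA) (parc_l pB))).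
have [xr|xr] := pselect (x = r).
  by exists A'; [rewrite -xr|move=> z /A'A; left].
have [B' pB' B'B] := parc_sub pB Bx (parc_r pB) xr.
exists (A' `|` B').
  by apply: parc_cat pA' pB' _ => z [? /B'B ?]; exact: A'B.
by move=> z [/A'A|/B'B]; [left|right].
Qed.

Lemma parc_segment x y : x <> y -> parc x y ((fun t : R => x + t *: (y - x)) @` I01).
Proof.
move=> xy; exists (fun t : R => x + t *: (y - x)); split => //.
- split.
    apply: continuous_cont_on => t; apply: cvgD; first exact: cvg_cst.
    by apply: cvgZ; [exact: cvg_id|exact: cvg_cst].
  move=> s t _ _ /addrI/eqP; rewrite -subr_eq0 -scalerBl scaler_eq0 !subr_eq0.
  by case/orP => [/eqP//|/eqP/esym].
- by rewrite scale0r addr0.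
- by rewrite scale1r addrC subrK.
Qed.

Lemma parc_ball (c : T) e x y : ball c e x -> ball c e y -> x <> y ->
  exists2 A, parc x y A & A `<=` ball c e.
Proof.
move=> bx b_y xy; eexists; first exact: parc_segment.
by move=> _ [t + <-]; rewrite in01 => It; exact: conv_ball.
Qed.

Lemma parc_open_connected U x y : open U -> connected U -> U x -> U y -> x <> y ->
  exists2 A, parc x y A & A `<=` U.
Proof.
move=> oU cU Ux Uy xy.
pose P z := z = x \/ exists2 A, parc x z A & A `<=` U.
have step z w e : P z -> ball z e `<=` U -> ball z e w -> P w.
  move=> Pz be bw; have [->|wx] := pselect (w = x); first by left.
  have e0 : 0 < e.
    by move: bw; rewrite -ball_normE /ball_/=; apply: le_lt_trans.
  have [zw|zw] := pselect (z = w); first by rewrite -zw.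
  have [B pB BU] := parc_ball (ballxx z e0) bw zw.
  right; case: Pz => [zx|[A pA AU]].
    by exists B; [rewrite -zx|move=> v /BU/be].
  have [D pD DAB] := parc_join pA pB (nesym wx).
  by exists D => // v /DAB[/AU|/BU/be].
have opn z : U z -> exists2 e, 0 < e & ball z e `<=` U.
  by move=> Uz; have /nbhs_ballP[e /= e0 he] : nbhs z U by [apply: open_nbhs_nbhs]; exists e.
suff e : U `&` [set z | P z] = U.
  have [_ [yx|//]] : (U `&` [set z | P z]) y by rewrite e.
  by case: xy.
apply: cU; first by exists x; split => //; left.
- exists [set z | exists2 e, ball z e `<=` U /\ 0 < e & P z].
    rewrite openE => z [e [be e0] Pz]; apply/nbhs_ballP; exists (e/2); first by rewrite /= divr_gt0.
    move=> w zw; exists (e/2); last by apply: (step z w e) => //; apply: le_ball zw; lra.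
    split; last by rewrite divr_gt0.
    by move=> u wu; apply: be; apply: (ball_splitr (z := w)) => //; exact: ball_sym.
  apply/seteqP; split => z [Uz Pz]; split => //; last by case: Pz.
  by have [e e0 be] := opn z Uz; exists e.
- exists (closure [set z | U z /\ P z]); first exact: closed_closure.
  apply/seteqP; split => z [Uz Pz]; split => //; first by apply: subset_closure.
  have [e e0 be] := opn z Uz.
  have [w [[Uw Pw] bw]] := Pz (ball z (e/2)) (nbhsx_ballx z _ (divr_gt0 e0 (ltr0Sn R 1))).
  apply: (step w z (e/2)) => //; last exact: ball_sym.
  by move=> u wu; apply: be; apply: (ball_splitr (z := w)) => //; exact: ball_sym.
Qed.

Lemma parc_through U x y : open U -> connected U -> U x -> U y ->
  exists a b A, [/\ parc a b A, A `<=` U, A x & A y].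
Proof.
move=> oU cU Ux Uy; have [xy|xy] := pselect (x = y); last first.
  have [A pA AU] := parc_open_connected oU cU Ux Uy xy.
  by exists x, y, A; split => //; [exact: parc_l pA|exact: parc_r pA].
have /nbhs_ballP[e /= e0 be] : nbhs x U by apply: open_nbhs_nbhs.
pose z : T := x + (e / 2, 0).
have xz : x <> z.
  move=> /eqP; rewrite -subr_eq0 opprD addNKr oppr_eq0 => /eqP [] /eqP.
  by rewrite mulf_eq0 gt_eqF//= invr_eq0 pnatr_eq0.
have Uz : U z.
  apply: be; rewrite -ball_normE /ball_/= opprD addNKr normrN plane_norm_lt /= normr0 e0 andbT.
  by rewrite gtr0_norm; lra.
have [A pA AU] := parc_open_connected oU cU Ux Uz xz.
by exists x, z, A; split => //; [exact: parc_l pA|rewrite -xy; exact: parc_l pA].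
Qed.

End Arcs.

(** * Arcs that converge to a point *)

Section InfiniteArcs.
Variable R : realType.
Local Notation T := (R * R)%type.
Local Notation I01 := (`[0, 1]%classic : set R).

Lemma cont_on_local (X Y : topologicalType) (A B : set X) (f : X -> Y) (x : X) :
  cont_on B f -> B x -> (\forall z \near x, A z -> B z) ->
  f @ within A (nbhs x) --> f x.
Proof.
move=> cf Bx AB U nU.
have H : nbhs x (fun z => B z -> U (f z)) := cf x Bx U nU.
rewrite /= nbhs_simpl /within /=.
by apply: filterS2 AB H => z h1 h2 /h1/h2.
Qed.

Lemma cvg_at (X : topologicalType) (f : R -> X) (x : R) :
  cont_on setT f -> f @ x --> f x.
Proof. by move=> cf; have := cf x Logic.I; rewrite within_interior//; exact: filterT. Qed.

(** The pieces are traversed one per unit of time on the half-line by [G], the half-line is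
    compressed to [0, 1), and [v] is put at 1. Continuity at 1 is the last hypothesis. *)
Lemma parc_infinite (q : nat -> T) (B : nat -> set T) (v : T) :
  (forall k, parc (q k) (q k.+1) (B k)) ->
  (forall k, B k `&` B k.+1 `<=` [set q k.+1]) ->
  (forall k l z, (k.+2 <= l)%N -> B k z -> ~ B l z) ->
  (forall k, ~ B k v) ->
  (forall e : R, 0 < e -> exists N : nat, forall k, (N <= k)%N -> B k `<=` ball v e) ->
  exists2 A, parc (q 0%N) v A & forall z, A z -> z = v \/ exists k, B k z.
Proof.
move=> pB B1 B2 Bv Blim; have [g gP] := choice pB.
pose n (s : R) := Num.truncn s.
pose G (s : R) := g (n s) (s - (n s)%:R).
have gB k t : I01 t -> B k (g k t) by move=> It; case: (gP k) => _ _ _ <-; exists t.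
have nI s : 0 <= s -> I01 (s - (n s)%:R).
  by move=> /truncn_itv; rewrite in01 -natr1 => /andP[? ?]; apply/andP; split; lra.
have GB s : 0 <= s -> B (n s) (G s) by move=> s0; apply/gB/nI.
have GE k s : k%:R <= s <= k.+1%:R -> g k (s - k%:R) = G s.
  move=> /andP[s1]; rewrite le_eqVlt => /orP[/eqP e|s2]; last first.
    by rewrite /G /n (truncn_def (n := k)) // s1.
  have nk : n s = k.+1 by rewrite /n e; apply: truncn_def; apply/andP; split; [exact: lexx|rewrite ltr_nat].
  rewrite /G nk e subrr -natr1 addrC addKr.
  by case: (gP k) (gP k.+1) => _ _ -> _ [_ -> _ _].
pose J (a b : R) : set R := `[a, b]%classic.
have inJ a b t : J a b t = (a <= t <= b) by rewrite /J /= in_itv.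
have cG (N : nat) : cont_on (J 0 N%:R) G.
  elim: N => [|N IH].
    by rewrite /J set_itv1; apply/cont_onP; exact: continuous_subspace1.
  have -> : J 0 N.+1%:R = J 0 N%:R `|` J N%:R N.+1%:R.
    apply/seteqP; split => t.
      rewrite inJ => /andP[t0 t1]; have [h|h] := leP t N%:R; [left|right].
        by rewrite inJ t0.
      by rewrite inJ t1 ltW.
    case; rewrite !inJ => /andP[t0 t1]; first by rewrite t0 (le_trans t1)// ler_nat.
    by rewrite t1 (le_trans _ t0).
  apply: cont_onU => //; try exact: itv_closed.
  apply: (@cont_on_eq R T _ (fun s : R => g N (s - N%:R)) G).
    by move=> s; rewrite inJ; exact: GE.
  apply: (@cont_on_comp R R T _ I01 (fun s : R => s - N%:R) (g N)) => //.
  - move=> s; rewrite inJ in01 -natr1 => /andP[? ?]; apply/andP; split; lra.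
  - by apply: continuous_cont_on => s; apply: cvgB; [exact: cvg_id|exact: cvg_cst].
  - by case: (gP N) => -[].
have Ginj s t : 0 <= s -> s < t -> G s <> G t.
  move=> s0 st e; have t0 : 0 <= t by rewrite ltW// (le_lt_trans s0).
  have /andP[s1 s2] := truncn_itv s0; have /andP[t1 t2] := truncn_itv t0.
  rewrite -/(n s) -/(n t) in s1 s2 t1 t2.
  have nst : (n s <= n t)%N.
    by rewrite -ltnS -(ltr_nat R) (le_lt_trans s1)// (lt_trans st).
  have Gs := GB s s0; have Gt := GB t t0; rewrite -e in Gt.
  move: nst; rewrite leq_eqVlt => /orP[/eqP nst|].
    case: (gP (n s)) => -[_ ig] _ _ _.
    have : s - (n s)%:R = t - (n s)%:R.
      by apply: ig; [exact: nI|rewrite nst; exact: nI|rewrite -/(G s) e /G nst].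
    lra.
  rewrite leq_eqVlt => /orP[/eqP nst|nst]; last by apply: (B2 (n s) (n t) (G s)).
  have Gq : G s = q (n s).+1 by apply: B1; split => //; rewrite nst.
  case: (gP (n s)) => -[_ ig] _ e1 _.
  have : s - (n s)%:R = 1.
    by apply: ig; [exact: nI|exact: i01_1|rewrite -/(G s) Gq e1].
  by move: s2; rewrite -natr1; lra.
pose phi (t : R) := t / (1 - t).
have phi0 t : 0 <= t -> t < 1 -> 0 <= phi t.
  by move=> t0 t1; rewrite divr_ge0// subr_ge0 ltW.
have phi_lt s t : 0 <= s -> s < t -> t < 1 -> phi s < phi t.
  move=> s0 st t1; rewrite /phi ltr_pdivrMr ?subr_gt0 ?(lt_trans st)//.
  by rewrite mulrAC ltr_pdivlMr ?subr_gt0//; nra.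
have cphi t : t < 1 -> {for t, continuous phi}.
  move=> t1; apply: cvgM; first exact: cvg_id.
  apply: cvgV; first by rewrite gt_eqF// subr_gt0.
  by apply: cvgB; [exact: cvg_cst|exact: cvg_id].
pose f (t : R) := if t < 1 then G (phi t) else v.
have f1 t : t < 1 -> G (phi t) = f t by rewrite /f => ->.
have f_1 : f 1 = v by rewrite /f ltxx.
have lt1 t : I01 t -> t < 1 \/ t = 1.
  by rewrite in01 => /andP[_]; rewrite le_eqVlt => /orP[/eqP|]; [right|left].
have fv t : I01 t -> t < 1 -> f t <> v.
  rewrite in01 => /andP[t0 _] t1 e; apply: (Bv (n (phi t))).
  by rewrite -e -f1//; apply/GB/phi0.
exists (f @` I01).
  exists f; split => //; last first.
    rewrite -f1 ?ltr01// /phi mul0r -(GE 0%N) ?lexx ?ler01// subrr.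
    by case: (gP 0%N).
  split.
    move=> t It; case: (lt1 t It) => [t1|->].
      have t0 : 0 <= t by move: It; rewrite in01 => /andP[].
      pose N := (n (phi t)).+1.
      have tN : phi t < N%:R by case/andP: (truncn_itv (phi0 t t0 t1)).
      pose W := [set s | [/\ I01 s, s < 1 & phi s <= N%:R]].
      apply: (@cont_on_local _ _ _ W).
      - apply: (@cont_on_eq R T _ (G \o phi)); first by move=> s [_ s1 _]; rewrite /= f1.
        apply: (@cont_on_comp R R T W (J 0 N%:R) phi G) => //.
          move=> s [Is s1 sN]; rewrite inJ sN andbT phi0//.
          by move: Is; rewrite in01 => /andP[].
        by move=> s [_ s1 _]; apply: cvg_within_filter; exact: cphi.
      - by split => //; exact: ltW.
      - have n1 : \forall s \near t, s < 1 by apply: open_nbhs_nbhs; split; [exact: open_lt|].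
        have n2 : \forall s \near t, phi s < N%:R.
          apply: (cphi t t1 [set u | u < N%:R]).
          by apply: open_nbhs_nbhs; split; [exact: open_lt|].
        by apply: filterS2 n1 n2 => s s1 s2 Is; split => //; exact: ltW.
    rewrite f_1 => U /nbhs_ballP[e /= e0 be].
    have [N HN] := Blim e e0.
    rewrite /= nbhs_simpl /within /=.
    have : \forall s \near (1 : R), N%:R / N.+1%:R < s.
      apply: open_nbhs_nbhs; split; first exact: open_gt.
      by rewrite /= ltr_pdivrMr// mul1r ltr_nat.
    apply: filterS => s sN Is; apply: be; case: (lt1 s Is) => [s1|->]; last first.
      by rewrite f_1; exact: ballxx.
    have s0 : 0 <= s by move: Is; rewrite in_itv => /andP[].
    rewrite -f1//; apply: (HN (n (phi s))); last exact/GB/phi0.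
    rewrite -ltnS -(ltr_nat R); apply: le_lt_trans (_ : phi s < _).
      rewrite /phi ler_pdivlMr ?subr_gt0//.
      by move: sN; rewrite ltr_pdivrMr// -natr1; nra.
    by case/andP: (truncn_itv (phi0 s s0 s1)).
  move=> s t Is It e.
  have s0 : 0 <= s by move: Is; rewrite in01 => /andP[].
  have t0 : 0 <= t by move: It; rewrite in01 => /andP[].
  case: (lt1 s Is) (lt1 t It) => [s1|s1] [t1|t1].
  - have [st|ts|//] := ltgtP s t.
      by exfalso; apply: (Ginj (phi s) (phi t)); [exact: phi0|exact: phi_lt|rewrite !f1].
    by exfalso; apply: (Ginj (phi t) (phi s)); [exact: phi0|exact: phi_lt|rewrite !f1].
  - by exfalso; apply: (fv s) => //; rewrite e t1.
  - by exfalso; apply: (fv t) => //; rewrite -e s1.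
  - by rewrite s1.
move=> _ [t It <-]; case: (lt1 t It) => [t1|->]; last by left.
right; exists (n (phi t)); rewrite -f1//; apply/GB/phi0 => //.
by move: It; rewrite in01 => /andP[].
Qed.

(** Arcs [al n] in [U n] that meet their successors form a chain towards [v], but distant links may
    intersect. A link misses [v], hence misses all links far enough along the chain. Passing from
    each link to the last one that it meets makes non-consecutive links disjoint, and each is then
    cut at its first point on the next. *)
Lemma parc_nested (U : nat -> set T) (v : T) :
  (forall n, open (U n)) -> (forall n, connected (U n)) -> (forall n, U n !=set0) ->
  (forall n, U n.+1 `<=` U n) -> (forall n, ~ U n v) ->
  (forall e : R, 0 < e -> exists N : nat, forall n, (N <= n)%N -> U n `<=` ball v e) ->
  exists p, U 0%N p /\ exists2 A, parc p v A & forall z, A z -> z = v \/ U 0%N z.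
Proof.
move=> oU cU neU subU nUv limU.
have [x xP] := choice neU.
have [al alP] : exists al : nat -> set T, forall n,
    exists a b, [/\ parc a b (al n), al n `<=` U n, al n (x n) & al n (x n.+1)].
  have H n : exists A : set T, exists a b,
      [/\ parc a b A, A `<=` U n, A (x n) & A (x n.+1)].
    have [a [b [A HA]]] := parc_through (oU n) (cU n) (xP n) (subU n _ (xP n.+1)).
    by exists A, a, b.
  by have [al Hal] := choice H; exists al.
have subU0 n : U n `<=` U 0%N.
  by elim: n => // n IH z /subU/IH.
have alU n : al n `<=` U n by case: (alP n) => a [b []].
have far i : exists N : nat, forall j, (N <= j)%N -> forall z, al i z -> ~ al j z.
  have [a [b [pa _ _ _]]] := alP i.
  have : nbhs v (~` al i).
    apply: open_nbhs_nbhs; split; last by move/alU/nUv.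
    by apply: closed_openC; exact: parc_closed pa.
  move=> /nbhs_ballP[e /= e0 be]; have [N HN] := limU e e0.
  by exists N => j Nj z iz /alU/(HN j Nj)/be.
have nxtP i : exists j, [/\ (i < j)%N, al i `&` al j !=set0 &
    forall k, (j < k)%N -> forall z, al i z -> ~ al k z].
  pose P j := `[< (i < j)%N /\ al i `&` al j !=set0 >].
  have exP : exists j, P j.
    exists i.+1; apply/asboolP; split => //; exists (x i.+1).
    by case: (alP i) (alP i.+1) => a [b [_ _ _ h1]] [a' [b' [_ _ h2 _]]].
  have [N HN] := far i.
  have ubP j : P j -> (j <= N)%N.
    move=> /asboolP[_ [z [h1 h2]]]; rewrite leqNgt; apply/negP => Nj.
    by apply: (HN j (ltnW Nj) z).
  case: (ex_maxnP exP ubP) => j /asboolP[ij ne] mx; exists j; split => //.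
  move=> k jk z h1 h2; have /mx : P k.
    by apply/asboolP; split; [exact: ltn_trans jk|exists z].
  by rewrite leqNgt jk.
have [nx nxH] := choice nxtP.
pose idx k := iter k nx 0%N.
have idxS k : (idx k < idx k.+1)%N by case: (nxH (idx k)).
have idx_mono k l : (k <= l)%N -> (idx k <= idx l)%N.
  elim: l => [|l IH]; first by rewrite leqn0 => /eqP ->.
  rewrite leq_eqVlt ltnS => /orP[/eqP->//|/IH h].
  by apply: leq_trans h _; exact: ltnW.
have idx_ge k : (k <= idx k)%N.
  by elim: k => // k IH; exact: leq_ltn_trans (idxS k).
pose D k := al (idx k).
have D1 k : D k `&` D k.+1 !=set0 by case: (nxH (idx k)).
have D2 k l z : (k.+2 <= l)%N -> D k z -> ~ D l z.
  move=> kl; case: (nxH (idx k)) => _ _ h; apply: h.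
  exact: leq_trans (idxS k.+1) (idx_mono _ _ kl).
have [F FP] : exists F : nat * T -> T, forall kq, D kq.1 kq.2 -> ~ D kq.1.+1 kq.2 ->
    exists B, [/\ D kq.1.+1 (F kq), parc kq.2 (F kq) B, B `<=` D kq.1 &
      B `&` D kq.1.+1 `<=` [set F kq]].
  have H (kq : nat * T) : exists q', D kq.1 kq.2 -> ~ D kq.1.+1 kq.2 ->
    exists B, [/\ D kq.1.+1 q', parc kq.2 q' B, B `<=` D kq.1 &
      B `&` D kq.1.+1 `<=` [set q']].
    have [h1|?] := pselect (D kq.1 kq.2); last by exists kq.2.
    have [h2|?] := pselect (~ D kq.1.+1 kq.2); last by exists kq.2.
    have [a [b [pa _ _ _]]] := alP (idx kq.1).
    have [a' [b' [pa' _ _ _]]] := alP (idx kq.1.+1).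
    have [q' [B HB]] := parc_travel pa (parc_closed pa') h1 h2 (D1 kq.1).
    by exists q' => _ _; exists B.
  by have [F HF] := choice H; exists F.
have [q0 [q00 q01]] := D1 0%N.
(* [Q k] lies in [D k] and [D k.+1], hence not in [D k.+2], as [parc_travel] requires for the next
   piece. *)
pose Q := fix Q k := if k is k'.+1 then F (k, Q k') else q0.
have QP k : D k (Q k) /\ D k.+1 (Q k).
  elim: k => [|k [IH1 IH2]]; first by split.
  have nq : ~ D k.+2 (Q k) by apply: (D2 k).
  have [B [h1 h2 h3 h4]] := FP (k.+1, Q k) IH2 nq.
  by split => //; apply: h3; exact: parc_r h2.
have HB k : exists B, [/\ parc (Q k) (Q k.+1) B, B `<=` D k.+1 & B `&` D k.+2 `<=` [set Q k.+1]].
  have [IH1 IH2] := QP k.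
  have nq : ~ D k.+2 (Q k) by apply: (D2 k).
  by have [B [h1 h2 h3 h4]] := FP (k.+1, Q k) IH2 nq; exists B.
have [B BP] := choice HB.
have BD k : B k `<=` D k.+1 by case: (BP k).
have DU k : D k `<=` U k.
  have aux m j : (j <= m)%N -> U m `<=` U j.
    elim: m => [|m IH]; first by rewrite leqn0 => /eqP ->.
    by rewrite leq_eqVlt ltnS => /orP[/eqP->//|/IH h] z /subU/h.
  by move=> z /alU; apply: aux.
have [A pA AB] : exists2 A, parc (Q 0%N) v A & forall z, A z -> z = v \/ exists k, B k z.
  apply: parc_infinite.
  - by move=> k; case: (BP k).
  - by move=> k z [h1 /BD h2]; case: (BP k) => _ _; apply.
  - by move=> k l z kl /BD h1 /BD h2; apply: (D2 k.+1 l.+1 z).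
  - by move=> k /BD/alU; exact: nUv.
  - move=> e e0; have [N HN] := limU e e0; exists N => k Nk z /BD/DU.
    by apply: HN; rewrite (leq_trans Nk).
exists (Q 0%N); split; first by apply: (DU 0%N); case: (QP 0%N).
exists A => // z /AB[->|[k /BD/DU/subU0]]; [by left|by right].
Qed.

(* On a circle in U, the function takes some value twice. *)
Lemma plane_not_line (U : set T) (x : T) (h : T -> R) : open U -> U x -> cont_on U h ->
  ~ (forall y z, U y -> U z -> h y = h z -> y = z).
Proof.
move=> oU Ux ch hinj.
have /nbhs_ballP[e /= e0 be] : nbhs x U by apply: open_nbhs_nbhs.
pose c (t : R) : T := x + (e / 2) *: (cos t, sin t).
have Uc t : U (c t).
  apply: be; rewrite -ball_normE /ball_/= /c opprD addNKr normrN normrZ.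
  rewrite gtr0_norm ?divr_gt0// plane_normE /=.
  have : Num.max `|cos t| `|sin t| <= 1 by rewrite ge_max cos_max sin_max.
  nra.
have cc (a b : R) : {within `[a, b]%classic, continuous (h \o c)}.
  apply/cont_onP; apply: (@cont_on_comp R T R _ U c h) => //.
  apply: continuous_cont_on => t; apply: cvgD; first exact: cvg_cst.
  apply: cvgZ; first exact: cvg_cst.
  apply: (@cvg_at T (fun t : R => (cos t, sin t)) t).
  by apply: cont_on_pair; apply: continuous_cont_on; [exact: continuous_cos|exact: continuous_sin].
have cinj s t : h (c s) = h (c t) -> cos s = cos t /\ sin s = sin t.
  move=> /(hinj _ _ (Uc s) (Uc t)) /addrI /(scalerI _) H'.
  by have [-> ->] : (cos s, sin s) = (cos t, sin t) by apply: H'; rewrite gt_eqF// divr_gt0.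
have p0 := @pi_gt0 R.
have c2 : c (pi *+ 2) = c 0 by rewrite /c cos2pi sin2pi cos0 sin0.
pose m := (h (c 0) + h (c pi)) / 2.
have h0pi : h (c 0) <> h (c pi).
  by move=> /cinj[]; rewrite cos0 cospi => /eqP; rewrite -subr_eq0 opprK (_ : 1 + 1 = 2%:R)// pnatr_eq0.
have mm a b : a = h (c 0) /\ b = h (c pi) \/ a = h (c pi) /\ b = h (c 0) ->
    Num.min a b <= m <= Num.max a b.
  by rewrite /m => -[] [-> ->]; rewrite ge_min le_max;
    have [?|?] := leP (h (c 0)) (h (c pi)); apply/andP; split; apply/orP; (try by [left; lra]); right; lra.
have [s s1 hs] := IVT (ltW p0) (cc 0 pi) (mm _ _ (or_introl (conj erefl erefl))).
have p2 : pi <= pi *+ 2 :> R by rewrite mulr2n lerDl ltW.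
have hc2 : (h \o c) (pi *+ 2) = h (c 0) by rewrite /= c2.
have [t t1 ht] := IVT p2 (cc pi (pi *+ 2)) (mm _ _ (or_intror (conj erefl hc2))).
have [_ e2] := cinj s t (etrans hs (esym ht)).
have sin_s : 0 < sin s.
  apply: sin_gt0_pi; move: s1; rewrite in_itv /= => /andP[s0 s1].
  rewrite !lt_def s0 s1 !andbT; apply/andP; split; apply/eqP => es; apply: h0pi.
    by move: hs; rewrite /= es /m; lra.
  by move: hs; rewrite /= -es /m; lra.
have sin_t : sin t <= 0.
  have -> : t = (t - pi) + pi by rewrite subrK.
  rewrite sinDpi oppr_le0; apply: sin_ge0_pi.
  by move: t1; rewrite in_itv /= mulr2n => /andP[? ?]; apply/andP; split; lra.
by move: sin_t; rewrite -e2 leNgt sin_s.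
Qed.

(** Otherwise the inverse of the parametrisation would embed an open set of the plane in the
    line. *)
Lemma parc_interior (p q : T) (A U : set T) (x : T) :
  parc p q A -> open U -> U x -> exists2 y, U y & ~ A y.
Proof.
case=> g [[cg ig] _ _ <-] oU Ux; apply: contrapT => H.
have UA : U `<=` g @` I01.
  by move=> y Uy; apply: contrapT => nA; apply: H; exists y.
have [h ch hK] := inverse_cont (@compact01 R) (@norm_hausdorff _ _) cg ig.
apply: (plane_not_line oU Ux (cont_on_sub UA ch)) => y z /UA[s Is <-] /UA[t It <-].
by rewrite !hK// => ->.
Qed.

End InfiniteArcs.

(** * Faces along an edge *)

Section EdgeFaces.
Variable R : realType.
Local Notation T := (R * R)%type.
Local Notation I01 := (`[0, 1]%classic : set R).

Lemma off_compact (K : set T) : compact K -> exists x, ~ K x.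
Proof.
move=> /bounded_plane[r r0 Kr]; exists (r, 0) => /Kr.
by rewrite plane_norm_lt /= gtr0_norm// ltxx.
Qed.

Lemma joined_closed_ball (K : set T) x : closed K -> ~ K x ->
  exists2 e : R, 0 < e & forall y, ball x e y -> joined K x y.
Proof.
move=> cK nx; have : nbhs x (~` K) by apply: open_nbhs_nbhs; split => //; exact: closed_openC.
move=> /nbhs_ballP[e /= e0 be]; exists e => // y xy.
by apply: (joined_conn (@connected_ball _ _ x e)) => //; exact: ballxx.
Qed.

Lemma closure_joined (K K0 : set T) p x : closed K0 -> K0 `<=` K -> ~ K0 x ->
  closure (joined K p) x -> joined K0 p x.
Proof.
move=> cK0 K0K nx clx; have [e e0 be] := joined_closed_ball cK0 nx.
have [p' [pp' xp']] := clx (ball x e) (nbhsx_ballx x e e0).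
by apply: joined_trans (joined_sym (be _ xp')); exact: joined_sub pp'.
Qed.

Section OneArc.
Variables (K0 : set T) (g : R -> T).
Hypotheses (cK0 : compact K0) (ag : iarc g).
Local Notation A := (g @` I01).
Hypothesis KA : K0 `&` A `<=` [set g 0; g 1].
Local Notation K := (K0 `|` A).

Let clK0 : closed K0 := compact_closedP cK0.
Let cA : compact A := arc_compact ag.
Let clA : closed A := compact_closedP cA.
Let cK : compact K := compactU cK0 cA.
Let clK : closed K := compact_closedP cK.

Lemma arc_int_off t : 0 < t < 1 -> ~ K0 (g t).
Proof.
move=> /andP[t0 t1] Kt; have It : I01 t by rewrite in01 !ltW.
have [e|e] : [set g 0; g 1] (g t) by apply: KA; split => //; exists t.
- have := proj2 ag _ _ It (i01_0 R) e; move=> e'; move: t0; rewrite e' ltxx//.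
- have := proj2 ag _ _ It (i01_1 R) e; move=> e'; move: t1; rewrite e' ltxx//.
Qed.

Lemma arc_int_joined s t : 0 < s < 1 -> 0 < t < 1 -> joined K0 (g s) (g t).
Proof.
move=> s01 t01; pose D := g @` [set u | 0 < u < 1].
apply: (@joined_conn R K0 D); [|by exists s|by exists t|].
  apply: connected_image.
    apply: cont_on_sub (proj1 ag) => u /andP[? ?].
    by rewrite /= in_itv /= !ltW.
  apply/connected_intervalP => a b /andP[a0 a1] /andP[b0 b1] u /andP[au ub].
  by rewrite /= (lt_le_trans a0 au) (le_lt_trans ub b1).
by move=> _ [u u01 <-]; exact: arc_int_off.
Qed.

(** A face borders an edge along its whole interior or nowhere in it. If the closure missed [g t],
    it would miss [g] on an interval (a, b) around [t]. The two remaining subarcs only dangle from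
    [K0], so they do not separate [p] from [g t]. A connected set between these points can then meet
    [K] only in the interval, where it cannot leave the face; but [g t] is on [K]. *)
Lemma edge_closure p s t : 0 < s < 1 -> 0 < t < 1 -> ~ K p ->
  closure (joined K p) (g s) -> closure (joined K p) (g t).
Proof.
move=> s01 t01 nKp cls; apply: contrapT => ncl; set W := joined K p in cls ncl.
have K0K : K0 `<=` K by move=> z; left.
have py : joined K0 p (g t).
  apply: joined_trans (arc_int_joined s01 t01).
  exact: (closure_joined clK0 K0K (arc_int_off s01) cls).
have [a [b [/andP[a0 at_] /andP[tb b1] Hab]]] : exists a b, [/\ 0 < a < t, t < b < 1 &
    forall u, a < u < b -> ~ closure W (g u)].
  have : nbhs (g t) (~` closure W).
    by apply: open_nbhs_nbhs; split => //; apply: closed_openC; exact: closed_closure.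
  have It : I01 t by rewrite in01; case/andP: t01 => *; rewrite !ltW.
  move=> /(proj1 ag t It); rewrite /= nbhs_simpl /within /= => /nbhs_ballP[e /= e0 be].
  case/andP: t01 => t0 t1.
  pose d := Num.min e (Num.min t (1 - t)) / 2.
  have d0 : 0 < d by rewrite divr_gt0// !lt_min e0 t0 subr_gt0 t1.
  have : d * 2 <= Num.min e (Num.min t (1 - t)) by rewrite divfK.
  rewrite !le_min => /and3P[d1 d2 d3].
  exists (t - d), (t + d); split; [apply/andP; split; lra|apply/andP; split; lra|].
  move=> u /andP[u1 u2]; apply: (be u).
    by rewrite /ball /= ltr_norml; apply/andP; split; lra.
  by rewrite in_itv /=; apply/andP; split; lra.
pose A1 := (fun u => g (0 + u * (a - 0))) @` I01.
pose A2 := (fun u => g (b + u * (1 - b))) @` I01.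
have Ia : I01 a by rewrite in01; case/andP: t01 => *; rewrite !ltW//; lra.
have Ib : I01 b by rewrite in01; case/andP: t01 => *; rewrite !ltW//; lra.
have P1 : parc (g 0) (g a) A1.
  by apply: parc_reparam ag (i01_0 R) Ia _; rewrite lt_eqF.
have P2 : parc (g b) (g 1) A2.
  by apply: parc_reparam ag Ib (i01_1 R) _; rewrite lt_eqF.
have inj := proj2 ag.
have A1P u : I01 u -> A1 (g u) -> u <= a.
  move=> Iu [w]; rewrite in01 => /andP[w0 w1] /inj e.
  rewrite -e; [nra|rewrite in01; apply/andP; split; nra|exact: Iu].
have A2P u : I01 u -> A2 (g u) -> b <= u.
  move=> Iu [w]; rewrite in01 => /andP[w0 w1] /inj e.
  rewrite -e; [nra|rewrite in01; apply/andP; split; nra|exact: Iu].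
have A1A z : A1 z -> exists2 u, I01 u & z = g u.
  by move=> [w]; rewrite in01 => /andP[w0 w1] <-; eexists; last reflexivity; rewrite in01; apply/andP; split; nra.
have A2A z : A2 z -> exists2 u, I01 u & z = g u.
  by move=> [w]; rewrite in01 => /andP[w0 w1] <-; eexists; last reflexivity; rewrite in01; apply/andP; split; nra.
have It : I01 t by rewrite in01; case/andP: t01 => *; rewrite !ltW.
have nA p' (H : ~ K p') : ~ A p' by move=> ?; apply: H; right.
have n1y : ~ A1 (g t) by move=> /(A1P _ It); lra.
have n2y : ~ A2 (g t) by move=> /(A2P _ It); lra.
have n1p : ~ A1 p by move=> /A1A[u Iu e]; apply: (nA p nKp); exists u.
have n2p : ~ A2 p by move=> /A2A[u Iu e]; apply: (nA p nKp); exists u.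
have j1 : joined (K0 `|` A1) p (g t).
  apply: (@joined_dangle R K0 A1 (g 0) p (g t) cK0 (parc_compact P1) (parc_acyclic P1) _ n1p n1y py).
  move=> z [Kz A1z]; have [u Iu e] := A1A z A1z.
  have [//|zg1] : [set g 0; g 1] z by apply: KA; split => //; rewrite e; exists u.
  by exfalso; move: A1z; rewrite zg1 => /(A1P _ (i01_1 R)); lra.
have j2 : joined ((K0 `|` A1) `|` A2) p (g t).
  apply: (@joined_dangle R (K0 `|` A1) A2 (g 1) p (g t) (compactU cK0 (parc_compact P1))
    (parc_compact P2) (parc_acyclic P2) _ n2p n2y j1).
  move=> z [[Kz|A1z] A2z]; have [u Iu e] := A2A z A2z.
    have [zg0|//] : [set g 0; g 1] z by apply: KA; split => //; rewrite e; exists u.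
    by exfalso; move: A2z; rewrite zg0 => /(A2P _ (i01_0 R)); lra.
  by exfalso; move: A1z A2z; rewrite e => /(A1P _ Iu) ? /(A2P _ Iu); lra.
have [D [cD Dp Dy DK]] := joinedP j2.
have DW : D `<=` W.
  apply: (@face_trap R K p D p) => //; first exact: joined_refl.
  move=> z [Dz clz]; apply: contrapT => nW.
  have Kz : K z by apply: contrapT => nKz; apply: nW; exact: closure_face.
  case: Kz => [K0z|[u Iu e]]; first by apply: (DK z) => //; left; left.
  apply: (Hab u); last by rewrite e.
  apply/andP; split; rewrite ltNge; apply/negP => hu; apply: (DK z Dz).
    left; right; exists (u / a).
      move: Iu; rewrite !in01 => /andP[u0 u1].
      by rewrite divr_ge0 ?(ltW a0)//= ler_pdivrMr// mul1r.
    by rewrite add0r subr0 divfK ?gt_eqF.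
  right; exists ((u - b) / (1 - b)).
    move: Iu; rewrite !in01 => /andP[u0 u1].
    by rewrite divr_ge0 ?subr_ge0 ?(ltW b1)//= ler_pdivrMr ?subr_gt0// mul1r lerB.
  by rewrite divfK ?gt_eqF ?subr_gt0// addrC subrK.
by have := joined_off (DW _ Dy); apply; right; exists t.
Qed.

Lemma half01 : 0 < (1/2 : R) < 1.
Proof. by apply/andP; split; lra. Qed.

Lemma half_in : I01 (1/2).
Proof. by rewrite in01; case/andP: half01 => *; rewrite !ltW. Qed.

(* If the closure of the face avoided the arc, the face would fill the connected
   complement of [K0]. *)
Lemma arc_face_closure p : ~ K p -> acyclic K0 -> K0 (g 0) -> K0 (g 1) ->
  closure (joined K p) (g (1/2)).
Proof.
move=> nKp aK0 K00 K01; apply: contrapT => ncl.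
have nint t : 0 < t < 1 -> ~ closure (joined K p) (g t).
  by move=> t01 /(edge_closure t01 half01 nKp).
have nK0p : ~ K0 p by move=> ?; apply: nKp; left.
have j : joined K0 p (g (1/2)).
  exact: (acyclic_joined cK0 aK0 nK0p (arc_int_off half01)).
have [D [cD Dp Dy DK]] := joinedP j.
have DW : D `<=` joined K p.
  apply: (@face_trap R K p D p clK cD Dp (joined_refl nKp)).
  move=> z [Dz clz]; apply: contrapT => nW.
  have Kz : K z by apply: contrapT => nKz; apply: nW; exact: closure_face.
  case: Kz => [K0z|[u Iu e]]; first exact: (DK z).
  have nK0z := DK z Dz.
  apply: (nint u); last by rewrite e.
  have /andP[u0 u1] : 0 <= u <= 1 by rewrite -in01.
  rewrite !lt_def u0 u1 !andbT; apply/andP; split; apply/eqP => eu; apply: nK0z.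
    by rewrite -e eu.
  by rewrite -e -eu.
by apply: (joined_off (DW _ Dy)); right; exists (1/2) => //; exact: half_in.
Qed.

End OneArc.

(** The arc and [B] form a Jordan curve, both sides of which reach the middle of the arc by
    [arc_face_closure]. Near that point [K0] is absent, so points of both sides are found off [K].
    By [joined_three] every nearby point off [K] is in one of these two faces, so each of them
    accumulates at the middle. *)
Lemma edge_splits (K0 B : set T) (g : R -> T) : compact K0 -> iarc g ->
  K0 `&` (g @` I01) `<=` [set g 0; g 1] -> parc (g 0) (g 1) B -> B `<=` K0 ->
  let K := K0 `|` g @` I01 in
  exists x y, [/\ ~ K x, ~ K y, ~ joined K x y,
    closure (joined K x) (g (1/2)) & closure (joined K y) (g (1/2))].
Proof.
move=> cK0 ag KA pB BK0 K.
set A := g @` I01 in KA K *.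
have cA : compact A := arc_compact ag.
have cB := parc_compact pB.
have clK0 := compact_closedP cK0; have clA := compact_closedP cA.
have cC : compact (B `|` A) by exact: compactU.
have clC := compact_closedP cC.
have BA : B `&` A `<=` [set g 0; g 1] by move=> z [/BK0 h1 h2]; exact: KA.
have CK : B `|` A `<=` K by move=> z [/BK0|]; [left|right].
have [x [y [nx ny nj]]] : exists x y,
    [/\ ~ (B `|` A) x, ~ (B `|` A) y & ~ joined (B `|` A) x y].
  have [h [ah h0 h1 hB]] := pB.
  have := @jordan R h g ah ag h0 h1; rewrite hB -/A h0 h1; exact.
have [e e0 be] := joined_closed_ball clK0 (arc_int_off ag KA half01).
set c := g (1/2) in be.
have side p : ~ (B `|` A) p -> forall r, 0 < r -> r <= e ->
    exists2 p', joined (B `|` A) p p' & ball c r p' /\ ~ K p'.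
  move=> np r r0 re.
  have cl := @arc_face_closure B g cB ag BA p np (parc_acyclic pB) (parc_l pB) (parc_r pB).
  have [p' [pp' cp']] := cl (ball c r) (nbhsx_ballx c r r0).
  exists p' => //; split => // -[K0p'|Ap']; last by apply: (joined_off pp'); right.
  by apply: (joined_off (be p' (le_ball re cp'))).
have [x' xx' [cx' nKx']] := side x nx e e0 (lexx e).
have [y' yy' [cy' nKy']] := side y ny e e0 (lexx e).
have njC p q : joined (B `|` A) x p -> joined (B `|` A) y q -> ~ joined K p q.
  move=> xp yq /(joined_sub CK) pq; apply: nj.
  by apply: joined_trans xp _; apply: joined_trans pq _; exact: joined_sym.
have nA p : ~ K p -> ~ A p by move=> np ?; apply: np; right.
have three p : ball c e p -> ~ K p -> joined K x' p \/ joined K y' p.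
  move=> cp np.
  have j0 q : ball c e q -> joined K0 x' q.
    by move=> cq; apply: joined_trans (joined_sym (be _ cx')) (be _ cq).
  have [h|h|h] := joined_three cK0 ag KA (nA _ nKx') (nA _ nKy') (nA _ np) (j0 _ cy') (j0 _ cp).
  - by exfalso; apply: (njC x' y').
  - by left.
  - by right.
exists x', y'; split => //.
- exact: njC.
- move=> U /nbhs_ballP[r /= r0 rU].
  have m0 : 0 < Num.min r e by rewrite lt_min r0.
  have me : Num.min r e <= e by rewrite ge_min lexx orbT.
  have mr : Num.min r e <= r by rewrite ge_min lexx.
  have [p xp [cp nKp]] := side x nx _ m0 me.
  exists p; split; last by apply: rU; exact: le_ball cp.
  by case: (three p (le_ball me cp) nKp) => // /joined_sym h; exfalso; apply: (njC p y').
- move=> U /nbhs_ballP[r /= r0 rU].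
  have m0 : 0 < Num.min r e by rewrite lt_min r0.
  have me : Num.min r e <= e by rewrite ge_min lexx orbT.
  have mr : Num.min r e <= r by rewrite ge_min lexx.
  have [p yp [cp nKp]] := side y ny _ m0 me.
  exists p; split; last by apply: rU; exact: le_ball cp.
  by case: (three p (le_ball me cp) nKp) => // h; exfalso; apply: (njC x' p).
Qed.

Lemma edge_side (K0 : set T) (g : R -> T) p q : compact K0 -> iarc g ->
  K0 `&` (g @` I01) `<=` [set g 0; g 1] ->
  let K := K0 `|` g @` I01 in
  closure (joined K p) (g (1/2)) -> closure (joined K q) (g (1/2)) -> joined K0 p q.
Proof.
move=> cK0 ag KA K cp cq; have clK0 := compact_closedP cK0.
have K0K : K0 `<=` K by move=> z; left.
have nc := arc_int_off ag KA half01.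
apply: joined_trans (closure_joined clK0 K0K nc cp) _.
exact/joined_sym/(closure_joined clK0 K0K nc cq).
Qed.

End EdgeFaces.

(** * Euler's formula *)

Local Notation ed u v := ([set u; v]%SET).

(** * Components of a graph when an edge is added *)

Section GraphConnectivity.
Variable V : finType.
Implicit Types (F : {set {set V}}) (X Tr : {set V}).

Definition gconn F : rel V := connect (fun a b => ed a b \in F).

(** [Tr] has one vertex in each component, so [#|Tr|] is the number of components in Euler's
    formula. *)
Definition transv X F Tr := [/\ Tr \subset X,
  (forall a b, a \in Tr -> b \in Tr -> gconn F a b -> a = b) &
  (forall v, v \in X -> exists2 a, a \in Tr & gconn F a v)].

Lemma gconn_sym F : connect_sym (fun a b => ed a b \in F).
Proof. by apply: sym_connect_sym => a b; rewrite finset.setUC. Qed.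

Lemma gconn0 F a : gconn F a a.
Proof. exact: connect0. Qed.

Lemma gconnC F a b : gconn F a b = gconn F b a.
Proof. exact: gconn_sym. Qed.

Lemma gconn_trans F : transitive (gconn F).
Proof. exact: connect_trans. Qed.

Lemma gconn_sub F F' : F \subset F' -> subrel (gconn F) (gconn F').
Proof.
by move=> /fintype.subsetP FF; apply: connect_sub => a b /FF h; exact: connect1.
Qed.

Lemma edE (a b u v : V) : ed a b = ed u v -> u != v ->
  (a = u /\ b = v) \/ (a = v /\ b = u).
Proof.
move=> e uv.
have : a \in ed u v by rewrite -e !inE eqxx.
have : b \in ed u v by rewrite -e !inE eqxx orbT.
have : u \in ed a b by rewrite e !inE eqxx.
have : v \in ed a b by rewrite e !inE eqxx orbT.
rewrite !inE.
by move=> /orP[]/eqP-> /orP[]/eqP-> /orP[]/eqP ? /orP[]/eqP ?; subst; rewrite ?eqxx in uv *; auto.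
Qed.

Lemma gconn_nil a b : gconn finset.set0 a b -> a = b.
Proof. by case/connectP => -[|c p] /=; rewrite ?inE. Qed.

Lemma gconn_step F u w : u != w -> gconn F u w -> exists a, ed u a \in F.
Proof.
move=> uw /connectP[[|a p] /=]; first by move=> _ e; rewrite e eqxx in uw.
by move=> /andP[h _] _; exists a.
Qed.

Lemma gconn_add_closed F u v : gconn F u v ->
  gconn (ed u v |: F)%SET =2 gconn F.
Proof.
move=> uv a b; apply/idP/idP; last by apply: gconn_sub; exact: subsetU1.
apply: connect_sub => {}a {}b; rewrite finset.in_setU1 => /orP[/eqP e|]; last exact: connect1.
have [e2|uv'] := eqVneq u v.
  have [-> ->] : a = u /\ b = u; last exact: connect0.
  have : a \in ed u v by rewrite -e !inE eqxx.
  have : b \in ed u v by rewrite -e !inE eqxx orbT.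
  by rewrite -e2 !inE !orbb => /eqP -> /eqP ->.
by case: (edE e uv') => -[-> ->] //; rewrite -/(gconn F v u) gconnC.
Qed.

Lemma gconn_add F u v a b : u != v -> gconn (ed u v |: F)%SET a b ->
  [\/ gconn F a b, gconn F a u && gconn F v b | gconn F a v && gconn F u b].
Proof.
move=> uv /connectP[p]; elim: p a => [|c p IH] a /=.
  by move=> _ ->; constructor 1; exact: connect0.
move=> /andP[h /IH{}IH] /IH{}IH; move: h; rewrite finset.in_setU1 => /orP[/eqP e|h].
  case: (edE e uv) => -[-> ec]; rewrite ec in IH.
    case: IH => [?|/andP[_ ?]|/andP[_ ?]].
    - by constructor 2; rewrite gconn0.
    - by constructor 2; rewrite gconn0.
    - by constructor 1.
  case: IH => [?|/andP[_ ?]|/andP[_ ?]].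
  - by constructor 3; rewrite gconn0.
  - by constructor 1.
  - by constructor 3; rewrite gconn0.
have ac : gconn F a c by exact: connect1.
case: IH => [h1|/andP[h1 h2]|/andP[h1 h2]].
- by constructor 1; exact: gconn_trans h1.
- by constructor 2; rewrite h2 (gconn_trans ac h1).
- by constructor 3; rewrite h2 (gconn_trans ac h1).
Qed.

Lemma transv_closed X F Tr u v : gconn F u v -> transv X F Tr -> transv X (ed u v |: F)%SET Tr.
Proof.
move=> uv [h1 h2 h3]; split => // [a b aT bT|w /h3[a aT aw]].
  by rewrite (gconn_add_closed uv); exact: h2.
by exists a => //; rewrite (gconn_add_closed uv).
Qed.

Lemma transv_bridge X F Tr u v : u \in X -> v \in X -> ~~ gconn F u v -> transv X F Tr ->
  exists Tr', transv X (ed u v |: F)%SET Tr' /\ #|Tr| = #|Tr'|.+1.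
Proof.
move=> uX vX nuv [h1 h2 h3].
have uv : u != v by apply: contraNneq nuv => ->; exact: connect0.
have [tv tvT tvv] := h3 v vX; have [tu tuT tuu] := h3 u uX.
have sub : subrel (gconn F) (gconn (ed u v |: F)%SET) by apply: gconn_sub; exact: subsetU1.
exists (Tr :\ tv)%SET; split; last by rewrite (cardsD1 tv Tr) tvT.
have only a : a \in Tr -> gconn F a v -> a = tv.
  by move=> aT av; apply: h2 => //; apply: gconn_trans av _; rewrite gconnC.
split.
- exact: fintype.subset_trans (finset.subsetDl _ _) h1.
- move=> a b; rewrite !finset.in_setD1 => /andP[atv aT] /andP[btv bT] /(gconn_add uv)[].
  + exact: h2.
  + by move=> /andP[_]; rewrite gconnC => /(only b bT) e; rewrite e eqxx in btv.
  + by move=> /andP[/(only a aT) e]; rewrite e eqxx in atv.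
- move=> w wX; have [a aT aw] := h3 w wX.
  have [e|atv] := eqVneq a tv; last by exists a; [rewrite finset.in_setD1 atv|exact: sub].
  exists tu.
    rewrite finset.in_setD1 tuT andbT; apply: contraNneq nuv => e2.
    by apply: gconn_trans tvv; rewrite -e2 gconnC.
  apply: gconn_trans (sub _ _ tuu) _.
  apply: (@gconn_trans _ v); first by apply: connect1; rewrite finset.in_setU1 eqxx.
  by apply: sub; apply: gconn_trans aw; rewrite e gconnC.
Qed.

End GraphConnectivity.

Section PlaneGraphs.
Variable R : realType.
Local Notation T := (R * R)%type.
Local Notation I01 := (`[0, 1]%classic : set R).

Record plane_graph (V : finType) := PlaneGraph {
  pe : {set {set V}};
  pp : V -> T;
  pa : {set V} -> set T;
  pe2 : forall f, f \in pe -> #|f| = 2%N;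
  pp_inj : injective pp;
  pa_arc : forall u v, ed u v \in pe -> parc (pp u) (pp v) (pa (ed u v));
  pa_pt : forall f v, f \in pe -> pa f (pp v) -> v \in f;
  pa_cross : forall f g, f \in pe -> g \in pe -> f != g ->
    pa f `&` pa g `<=` range pp }.

(** A face is represented by one of its points, and [#|I|] is the number of faces. *)
Definition faces (K : set T) (I : finType) (s : I -> T) :=
  [/\ forall i, ~ K (s i), forall i j, joined K (s i) (s j) -> i = j &
      forall x, ~ K x -> exists i, joined K (s i) x].

Variables (V : finType) (G : plane_graph V).
Implicit Types (X : {set V}) (F : {set {set V}}).

Definition geo X F : set T :=
  [set z | (exists2 v, v \in X & z = pp G v) \/ (exists2 f, f \in F & pa G f z)].

Lemma edP f : f \in pe G -> exists u v, u != v /\ f = ed u v.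
Proof. by move=> /pe2/eqP/cards2P[u [v [uv ->]]]; exists u, v. Qed.

Lemma ed_neq u v : ed u v \in pe G -> u != v.
Proof. by move=> /pe2; rewrite cards2; case: eqP. Qed.

Lemma pa_compact f : f \in pe G -> compact (pa G f).
Proof. by move=> fE; have [u [v [_ e]]] := edP fE; move: fE; rewrite e => /pa_arc/parc_compact. Qed.

Lemma geo_setU1 X F f : geo X (f |: F)%SET = geo X F `|` pa G f.
Proof.
apply/seteqP; split => z.
  case=> [h|[h /finset.setU1P[->|hF] hz]]; [by left; left|by right|by left; right; exists h].
case=> [[h|[h hF hz]]|fz]; [by left|by right; exists h => //; rewrite finset.in_setU1 hF orbT|].
by right; exists f => //; rewrite finset.in_setU1 eqxx.
Qed.

Lemma geo_sub X F X' F' : X \subset X' -> F \subset F' -> geo X F `<=` geo X' F'.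
Proof.
move=> /fintype.subsetP XX /fintype.subsetP FF z [[v /XX vX ->]|[f /FF fF fz]].
  by left; exists v.
by right; exists f.
Qed.

Lemma points_acyclic (l : seq V) :
  let P := [set z | exists2 v, v \in l & z = pp G v] in compact P /\ acyclic P.
Proof.
elim: l => [|a l [IH1 IH2]] /=.
  have -> : [set z | exists2 v, v \in [::] & z = pp G v] = set0.
    by apply/seteqP; split => z // [v]; rewrite in_nil.
  by split; [exact: compact0|exact: acyclic0].
have -> : [set z | exists2 v, v \in a :: l & z = pp G v] =
   [set z | exists2 v, v \in l & z = pp G v] `|` [set pp G a].
  apply/seteqP; split => z.
    by case=> v; rewrite in_cons => /orP[/eqP ->|vl] ->; [right|left; exists v].
  by case=> [[v vl ->]|->]; [exists v; rewrite // in_cons vl orbT|exists a; rewrite ?mem_head].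
split; first by apply: compactU => //; exact: compact_set1.
apply: (@acyclicU _ _ _ (pp G a)) => //.
- exact: compact_closedP.
- by apply: compact_closedP; exact: compact_set1.
- exact: acyclic1.
Qed.

Lemma geo0 X : geo X finset.set0 = [set z | exists2 v, v \in enum X & z = pp G v].
Proof.
apply/seteqP; split => z.
  by case=> [[v vX ->]|[f]]; [exists v => //; rewrite mem_enum|rewrite inE].
by case=> v; rewrite mem_enum => vX ->; left; exists v.
Qed.

Lemma edge_set_ind (P : {set {set V}} -> Prop) : P finset.set0 ->
  (forall f F, f \notin F -> P F -> P (f |: F)%SET) -> forall F, P F.
Proof.
move=> P0 PS F; have [n] := ubnP #|F|; elim: n F => // n IH F.
have [->//|[f fF]] := set_0Vmem F.
rewrite (cardsD1 f) fF ltnS => h; rewrite -(finset.setD1K fF); apply: PS.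
  by rewrite !inE eqxx.
exact: IH.
Qed.

Lemma geo_compact X F : F \subset pe G -> compact (geo X F).
Proof.
elim/edge_set_ind : F => [|f F _ IH] FE; first by rewrite geo0; case: (points_acyclic (enum X)).
rewrite geo_setU1; move: FE; rewrite finset.subUset finset.sub1set => /andP[fE FE].
by apply: compactU; [exact: IH|exact: pa_compact].
Qed.

Lemma geo_closed X F : F \subset pe G -> closed (geo X F).
Proof. by move=> FE; apply: compact_closedP; exact: geo_compact. Qed.

Lemma geo_pp X F v : F \subset pe G -> (forall f, f \in F -> f \subset X) ->
  geo X F (pp G v) -> v \in X.
Proof.
move=> /fintype.subsetP FE FX [[w wX /pp_inj ->]//|[f fF fv]].
by apply: (fintype.subsetP (FX f fF)); apply: pa_pt fv; exact: FE.
Qed.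

Lemma pa_cross_pt f g z : f \in pe G -> g \in pe G -> f != g -> pa G f z -> pa G g z ->
  exists w, [/\ z = pp G w, w \in f & w \in g].
Proof.
move=> fE gE fg fz gz; have [w _ wz] := pa_cross fE gE fg (conj fz gz).
exists w; split => //; first by apply: (pa_pt fE); rewrite wz.
by apply: (pa_pt gE); rewrite wz.
Qed.

Lemma geo_arc X F u v : F \subset pe G -> ed u v \in pe G -> ed u v \notin F ->
  geo X F `&` pa G (ed u v) `<=` [set pp G u; pp G v].
Proof.
move=> /fintype.subsetP FE eE eF z [[[w wX zw]|[f fF fz]] ez].
  rewrite zw in ez *; have := pa_pt eE ez; rewrite !inE => /orP[]/eqP ->; [by left|by right].
have fe : f != ed u v by apply: contraNneq eF => <-.
have [w [-> _]] := pa_cross_pt (FE f fF) eE fe fz ez.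
by rewrite !inE => /orP[]/eqP ->; [left|right].
Qed.

Lemma edge_param u v : ed u v \in pe G -> exists g : R -> T,
  [/\ iarc g, g 0 = pp G u, g 1 = pp G v & g @` I01 = pa G (ed u v)].
Proof. by move=> /pa_arc. Qed.

Lemma gconn_parc X F u w : F \subset pe G -> gconn F u w ->
  u = w \/ exists2 B, parc (pp G u) (pp G w) B & B `<=` geo X F.
Proof.
move=> FE /connectP[p]; elim: p u => [|a p IH] u /=; first by move=> _ ->; left.
move=> /andP[ua pp_] ew; case: (IH a pp_ ew) => [aw|[B pB BK]].
  right; exists (pa G (ed u a)); last by move=> z hz; right; exists (ed u a).
  by rewrite -aw; apply: pa_arc; exact: (fintype.subsetP FE).
have [->|uw] := eqVneq u w; [by left|right].
have h := pa_arc ((fintype.subsetP FE) _ ua).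
have uw' : pp G u <> pp G w by move=> /pp_inj e; rewrite e eqxx in uw.
have [D pD DAB] := parc_join h pB uw'.
exists D => // z /DAB[hz|/BK//].
by right; exists (ed u a).
Qed.

(** An arc has empty interior, so it cannot fill an open face. This moves the representative of a
    face off an edge that is about to be added. *)
Lemma face_avoid K x f : closed K -> ~ K x -> f \in pe G -> exists2 y, joined K x y & ~ pa G f y.
Proof.
move=> cK nx fE; have [u [v [uv e]]] := edP fE; rewrite e in fE *.
have oK : open (joined K x) by exact: face_open.
have := parc_interior (pa_arc fE) oK (joined_refl nx).
by case=> y; exists y.
Qed.

(** The last clause is a supplement for small edge sets: as the graph is simple, more than one face
    requires more edges than faces, so two faces require three edges. *)
Definition euler_data X F := exists (I : finType) (s : I -> T) (Tr : {set V}),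
  [/\ faces (geo X F) s, transv X F Tr, #|I| + #|X| = #|F| + 1 + #|Tr| &
      #|I| = 1 \/ #|I|.+1 <= #|F|]%N.

Lemma euler0 X : euler_data X finset.set0.
Proof.
have [cP aP] := points_acyclic (enum X); rewrite -geo0 in cP aP.
have [x nx] := off_compact cP.
exists unit, (fun=> x), X; split.
- split=> // [[] []//|y ny]; exists tt; exact: acyclic_joined.
- split=> // [a b _ _ /gconn_nil//|v vX]; exists v => //; exact: connect0.
- by rewrite card_unit cards0 add0n.
- by left; rewrite card_unit.
Qed.

Section Step.
Variables (X : {set V}) (F : {set {set V}}) (u v : V).
Hypotheses (FE : F \subset pe G) (eE : ed u v \in pe G) (eF : ed u v \notin F).
Hypotheses (FX : forall f, f \in F -> f \subset X) (uX : u \in X) (vX : v \in X).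
Local Notation K0 := (geo X F).
Local Notation A := (pa G (ed u v)).

Let cK0 : compact K0 := geo_compact FE.
Let clK0 : closed K0 := geo_closed FE.
Let cA : compact A := pa_compact eE.
Let K0u : K0 (pp G u). Proof. by left; exists u. Qed.
Let K0v : K0 (pp G v). Proof. by left; exists v. Qed.

(** The drawing is divided into the component [X1], [F1] of [u] and the rest. The new arc meets the
    former only in [pp G u] and the latter only in [pp G v], which is the situation of
    [joined_bridge]. *)
Lemma bridge_faces (I : finType) (s : I -> T) : ~~ gconn F u v -> faces K0 s ->
  exists s' : I -> T, faces (geo X (ed u v |: F)%SET) s'.
Proof.
move=> nuv [s1 s2 s3].
have keep x y : joined K0 x y -> ~ A x -> ~ A y -> joined (K0 `|` A) x y.
  move=> xy nx ny.
  pose X1 := [set w in X | gconn F u w]%SET.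
  pose F1 := [set f in F | f \subset X1]%SET.
  have X1X : X1 \subset X by apply/fintype.subsetP => w; rewrite inE => /andP[].
  have F1F : F1 \subset F by apply/fintype.subsetP => w; rewrite inE => /andP[].
  have F1E := fintype.subset_trans F1F FE.
  have F2E : (F :\: F1)%SET \subset pe G by apply: fintype.subset_trans (finset.subsetDl _ _) FE.
  have F2X f w : f \in (F :\: F1)%SET -> w \in f -> w \in (X :\: X1)%SET.
    rewrite finset.in_setD inE => /andP[+ fF] wf; rewrite fF /= => nf.
    rewrite finset.in_setD (fintype.subsetP (FX fF) _ wf) andbT.
    apply: contra nf; rewrite inE => /andP[wX uw].
    apply/fintype.subsetP => w' w'f; rewrite inE (fintype.subsetP (FX fF) _ w'f) /=.
    have [->//|ww] := eqVneq w' w.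
    apply: gconn_trans uw _; apply: connect1; rewrite (_ : ed w w' = f)//.
    apply/eqP; rewrite eqEcard cards2 eq_sym ww (pe2 (fintype.subsetP FE _ fF)) leqnn andbT.
    by rewrite finset.subUset !finset.sub1set wf.
  have e12 : K0 = geo X1 F1 `|` geo (X :\: X1)%SET (F :\: F1)%SET.
    apply/seteqP; split => z.
      case=> [[w wX ->]|[f fF fz]].
        have [wX1|wX1] := boolP (w \in X1); [left|right]; left; exists w => //.
        by rewrite finset.in_setD wX1.
      have [fF1|fF1] := boolP (f \in F1); [left|right]; right; exists f => //.
      by rewrite finset.in_setD fF1.
    by case; apply: geo_sub => //; exact: finset.subsetDl.
  have F1X f : f \in F1 -> f \subset X1 by rewrite inE => /andP[].
  have F2X' f : f \in (F :\: F1)%SET -> f \subset (X :\: X1)%SET.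
    by move=> fF; apply/fintype.subsetP => w; exact: F2X.
  have vX1 : v \notin X1 by rewrite inE vX.
  have uX1 : u \in X1 by rewrite inE uX; exact: connect0.
  have d12 z : geo X1 F1 z -> geo (X :\: X1)%SET (F :\: F1)%SET z -> False.
    have aux w : w \in X1 -> ~ geo (X :\: X1)%SET (F :\: F1)%SET (pp G w).
      by move=> wX1 /(geo_pp F2E F2X'); rewrite finset.in_setD wX1.
    case=> [[w wX1 ->]|[f fF fz]]; first exact: aux.
    case=> [[w wX1 zw]|[f' fF' fz']].
      have wf : w \in X1 by apply: (geo_pp F1E F1X); right; exists f; rewrite -?zw.
      by move: wX1; rewrite finset.in_setD wf.
    have ff : f != f' by apply: contraTneq fF => ->; move: fF'; rewrite finset.in_setD => /andP[].
    have [w [zw wf wf']] := pa_cross_pt (fintype.subsetP F1E _ fF) (fintype.subsetP F2E _ fF') ff fz fz'.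
    by move: (F2X _ _ fF' wf'); rewrite finset.in_setD (fintype.subsetP (F1X _ fF) _ wf).
  have K1A : geo X1 F1 `&` A `<=` [set pp G u].
    move=> z [h1 h2]; have [//|zv] : [set pp G u; pp G v] z.
      by apply: (geo_arc (X := X) FE eE eF); split => //; exact: geo_sub h1.
    by exfalso; move: vX1; rewrite zv in h1; rewrite (geo_pp F1E F1X h1).
  have K2A : (geo X1 F1 `|` A) `&` geo (X :\: X1)%SET (F :\: F1)%SET `<=` [set pp G v].
    move=> z [[h1|h1] h2]; first by case: (d12 z).
    have [zu|//] : [set pp G u; pp G v] z.
      by apply: (geo_arc (X := X) FE eE eF); split => //; apply: geo_sub h2; exact: finset.subsetDl.
    by exfalso; rewrite zu in h2; move: (geo_pp F2E F2X' h2); rewrite finset.in_setD uX1.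
  rewrite e12 -setUA (setUC (geo (X :\: X1)%SET _)) setUA.
  apply: (joined_bridge _ _ cA _ K1A K2A) => //.
  - exact: geo_compact.
  - exact: geo_compact.
  - exact: parc_acyclic (pa_arc eE).
  - by rewrite -e12.
have ex i : exists y, joined K0 (s i) y /\ ~ A y.
  by have [y h1 h2] := face_avoid clK0 (s1 i) eE; exists y.
have [y yP] := choice ex.
exists y; rewrite geo_setU1; split.
- by move=> i; case: (yP i) => h1 h2 [h|h]; [exact: (joined_off h1)|exact: h2].
- move=> i j /(joined_sub (@subsetUl _ K0 A)) yij; apply: s2.
  case: (yP i) (yP j) => h1 _ [h2 _].
  by apply: joined_trans h1 _; apply: joined_trans yij _; exact: joined_sym.
- move=> x nx; have nK0 : ~ K0 x by move=> ?; apply: nx; left.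
  have [i si] := s3 x nK0; exists i; case: (yP i) => h1 h2.
  apply: keep => //; last by move=> ?; apply: nx; right.
  by apply: joined_trans si; exact: joined_sym.
Qed.

Lemma euler_bridge : ~~ gconn F u v -> euler_data X F -> euler_data X (ed u v |: F)%SET.
Proof.
move=> nuv [I [s [Tr [hs hTr hcard hsmall]]]].
have [Tr' [hTr' cTr]] := transv_bridge uX vX nuv hTr.
have [s' hs'] := bridge_faces nuv hs.
exists I, s', Tr'; split => //.
- by move: hcard; rewrite cTr cardsU1 eF; lia.
- by case: hsmall => h; [left|right; rewrite cardsU1 eF; lia].
Qed.

(** Only the face that contains the interior of the new arc changes. [edge_splits] gives a point on
    either side and [joined_three] excludes a third part; the additional face gets the index
    [None]. *)
Lemma euler_closing : gconn F u v -> euler_data X F -> euler_data X (ed u v |: F)%SET.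
Proof.
move=> guv [I [s [Tr [[s1 s2 s3] hTr hcard hsmall]]]].
have uv := ed_neq eE.
(* A path from [u] to [v] that avoids the edge between them has different first and last edges. This
   starts the supplement of [euler_data]. *)
have F2 : (2 <= #|F|)%N.
  have [a ua] := gconn_step uv guv.
  have [b vb] : exists b, ed v b \in F.
    by apply: (@gconn_step _ _ _ u); [rewrite eq_sym|rewrite gconnC].
  have ne : ed u a != ed v b.
    apply: contraNneq eF => e; have vm : v \in ed u a by rewrite e !inE eqxx.
    move: vm; rewrite !inE eq_sym (negbTE uv) /= => /eqP va.
    by rewrite va.
  have := subset_leq_card (_ : [set ed u a; ed v b]%SET \subset F).
  by rewrite cards2 ne; apply; rewrite finset.subUset !finset.sub1set ua.
have [g [ag g0 g1 gA]] := edge_param eE.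
have KA : K0 `&` g @` I01 `<=` [set g 0; g 1].
  by rewrite g0 g1 gA; exact: geo_arc.
have [B pB BK] : exists2 B, parc (g 0) (g 1) B & B `<=` K0.
  by rewrite g0 g1; case: (gconn_parc X FE guv) => // e; rewrite e eqxx in uv.
have [x' [y' [nx' ny' nxy' clx' cly']]] := edge_splits cK0 ag KA pB BK.
rewrite gA in nx' ny' nxy' clx' cly'.
set c := g (1/2) in clx' cly'.
have nc : ~ K0 c := arc_int_off ag KA (half01 R).
have KK : K0 `<=` K0 `|` A by move=> z; left.
have x'c : joined K0 x' c := closure_joined clK0 KK nc clx'.
have y'c : joined K0 y' c := closure_joined clK0 KK nc cly'.
have [ic sic] := s3 c nc.
have ex i : exists y, joined K0 (s i) y /\ ~ A y.
  by have [y h1 h2] := face_avoid clK0 (s1 i) eE; exists y.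
have [y yP] := choice ex.
have keep p q : joined K0 p q -> ~ joined K0 p c -> joined (K0 `|` A) p q.
  move=> pq npc; apply: (@joined_conn R _ (joined K0 p)) => //.
  - exact: component_connected.
  - by apply: joined_refl; exact: joined_offl pq.
  - move=> z pz [|]; first exact: joined_off pz.
    rewrite -gA => -[t It tz]; apply: npc.
    have nz := joined_off pz; rewrite -tz in nz pz.
    have t01 : 0 < t < 1.
      move: It; rewrite in01 => /andP[t0 t1]; rewrite !lt_def t0 t1 !andbT.
      apply/andP; split; apply/eqP => e; apply: nz.
        by rewrite e g0.
      by rewrite -e g1.
    by apply: joined_trans pz _; exact: (arc_int_joined ag KA t01 (half01 R)).
have off p : ~ (K0 `|` A) p -> ~ (g @` I01) p by rewrite gA => np ?; apply: np; right.
pose s' (o : option I) := if o is Some i then (if i == ic then x' else y i) else y'.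
have s'0 o : joined K0 (s (odflt ic o)) (s' o).
  case: o => [i|] /=; last by apply: joined_trans sic _; exact: joined_sym.
  case: eqP => [->|_]; last by case: (yP i).
  by apply: joined_trans sic _; exact: joined_sym.
exists (option I), s', Tr; split.
- rewrite geo_setU1; split.
  + case=> [i|] //=; case: eqP => // _; case: (yP i) => h1 h2 [h|h]; [exact: (joined_off h1)|exact: h2].
  + move=> o1 o2 h; have h0 := joined_sub KK h.
    have e : odflt ic o1 = odflt ic o2.
      apply: s2; apply: joined_trans (s'0 o1) _; apply: joined_trans h0 _.
      exact/joined_sym/s'0.
    case: o1 o2 e h {h0} => [i|] [j|] //= -> //; rewrite eqxx => h; exfalso; apply: nxy' => //.
    exact: joined_sym.
  + move=> x nx; have nK0 : ~ K0 x by move=> ?; apply: nx; left.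
    have [i si] := s3 x nK0; have [iic|iic] := eqVneq i ic.
      have xc : joined K0 x' x.
        apply: joined_trans x'c _; apply: joined_trans (joined_sym sic) _; by rewrite -iic.
      have xy : joined K0 x' y' by apply: joined_trans x'c _; exact: joined_sym.
      have := joined_three cK0 ag KA (off _ nx') (off _ ny') (off _ nx) xy xc.
      rewrite gA => -[h|h|h]; first by exfalso.
        by exists (Some ic); rewrite /= eqxx.
      by exists None.
    exists (Some i); rewrite /= (negbTE iic); case: (yP i) => h1 h2; apply: keep.
      by apply: joined_trans si; exact: joined_sym.
    move=> yc; move/eqP: iic; apply; apply: s2.
    apply: joined_trans h1 _; apply: joined_trans yc _; exact: joined_sym.
- exact: transv_closed.
- by rewrite card_option cardsU1 eF; move: hcard; lia.
- by right; rewrite card_option cardsU1 eF; case: hsmall; lia.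
Qed.

End Step.

Lemma euler X F : F \subset pe G -> (forall f, f \in F -> f \subset X) -> euler_data X F.
Proof.
elim/edge_set_ind : F => [|f F fF IH] FE FX; first exact: euler0.
move: FE; rewrite finset.subUset finset.sub1set => /andP[fE FE].
have FX' f' : f' \in F -> f' \subset X by move=> h; apply: FX; rewrite finset.in_setU1 h orbT.
have fX : f \subset X by apply: FX; rewrite finset.in_setU1 eqxx.
have {}IH := IH FE FX'.
have [u [v [uv e]]] := edP fE; rewrite e in fE fF fX *.
move: fX; rewrite finset.subUset !finset.sub1set => /andP[uX vX].
have [guv|guv] := boolP (gconn F u v); [exact: euler_closing|exact: euler_bridge].
Qed.

End PlaneGraphs.

(** * Tight vertex sets *)

Lemma sum_eq_termwise (I : finType) (P : pred I) (a b : I -> nat) :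
  (forall i, P i -> (a i <= b i)%N) -> (\sum_(i | P i) b i <= \sum_(i | P i) a i)%N ->
  forall i, P i -> a i = b i.
Proof.
move=> ab; move=> + i Pi; rewrite (bigD1 i) //= [X in (_ <= X)%N](bigD1 i) //= => h.
have : (\sum_(j | P j && (j != i)) a j <= \sum_(j | P j && (j != i)) b j)%N.
  by apply: leq_sum => j /andP[Pj _]; exact: ab.
by have := ab i Pi; lia.
Qed.

Lemma small_faces m n : m = 1%N \/ (m < n)%N -> n = 3%N -> (m <= 2)%N.
Proof. by case=> [->//|+ e]; rewrite e ltnS. Qed.

Section Triples.
Variable V : finType.
Implicit Types (E : {set {set V}}) (T : {set V}).

Lemma cycles3P E T : T \in cycles3 E <->
  #|T| = 3%N /\ forall f : {set V}, #|f| = 2%N -> f \subset T -> f \in E.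
Proof.
rewrite inE; split.
  move=> /andP[/eqP T3 /forallP h]; split => // f f2 fT.
  by have /implyP := h f; apply; rewrite f2 fT.
move=> [T3 h]; rewrite T3 eqxx /=; apply/forallP => f; apply/implyP => /andP[/eqP f2 fT].
exact: h.
Qed.

Lemma cards_triple (u v a : V) : u != v -> u != a -> v != a -> #|[set u; v; a]%SET| = 3%N.
Proof.
move=> uv ua va.
by rewrite finset.setUC cardsU1 !inE eq_sym (negbTE ua) eq_sym (negbTE va) /= cards2 uv.
Qed.

Lemma card_le2_cases (u v a : V) : (#|V| <= 2)%N -> u != v -> a = u \/ a = v.
Proof.
move=> V2 uv; have [->|au] := eqVneq a u; first by left.
have [->|av] := eqVneq a v; first by right.
move: V2; rewrite leqNgt => /negP[]; apply: leq_trans (max_card (mem [set u; v; a]%SET)).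
by rewrite cards_triple // eq_sym.
Qed.

Lemma pair_in_triple (u v a : V) (f : {set V}) : #|f| = 2%N -> f \subset [set u; v; a]%SET ->
  [\/ f = ed u v, f = ed u a | f = ed v a].
Proof.
move=> f2 /fintype.subsetP h.
have /cards2P[x [y [xy e]]] : #|f| == 2 by rewrite f2.
have := h x; have := h y; rewrite e !inE !eqxx orbT /= => /(_ isT) hy /(_ isT) hx.
move: hx hy => /orP[/orP[]|]/eqP hx /orP[/orP[]|]/eqP hy; subst x y; rewrite ?eqxx // in xy *;
  by [constructor 1|constructor 2|constructor 3|constructor 1; rewrite finset.setUC|
      constructor 2; rewrite finset.setUC|constructor 3; rewrite finset.setUC].
Qed.

Lemma cycles3_triple E (u v a : V) : u != v -> u != a -> v != a ->
  ed u v \in E -> ed u a \in E -> ed v a \in E -> [set u; v; a]%SET \in cycles3 E.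
Proof.
move=> uv ua va h1 h2 h3; apply/cycles3P; split; first exact: cards_triple.
by move=> f f2 /(pair_in_triple f2)[] ->.
Qed.

Lemma pair_third T (u v : V) : #|T| = 3%N -> u != v -> u \in T -> v \in T ->
  exists a, [/\ u != a, v != a & T = [set u; v; a]%SET].
Proof.
move=> T3 uv uT vT.
have /set0Pn[a] : (T :\: ed u v)%SET != finset.set0.
  rewrite -card_gt0 cardsD T3; have := subset_leq_card (finset.subsetIr T (ed u v)).
  by rewrite cards2 uv; lia.
rewrite !inE negb_or => /andP[/andP[au av] aT]; exists a; split; [by rewrite eq_sym|by rewrite eq_sym|].
apply/eqP; rewrite eq_sym eqEcard T3 cards_triple ?leqnn ?andbT //; last 2 first.
- by rewrite eq_sym.
- by rewrite eq_sym.
by rewrite !finset.subUset !finset.sub1set uT vT aT.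
Qed.

End Triples.

(** * Boundaries of faces and separating 3-cycles *)

Section Boundaries.
Variable R : realType.
Local Notation T := (R * R)%type.
Local Notation I01 := (`[0, 1]%classic : set R).
Variables (V : finType) (G : plane_graph R V).
Implicit Types (X : {set V}) (F : {set {set V}}).

Lemma iarc_closed (g : R -> T) (C : set T) : iarc g -> closed C ->
  (forall t, 0 < t < 1 -> C (g t)) -> g @` I01 `<=` C.
Proof.
move=> [cg _] clC h.
suff ends s : s = 0 \/ s = 1 -> C (g s).
  move=> _ [t + <-]; rewrite in01 => /andP[t0 t1].
  have [->|t0'] := eqVneq t 0; first by apply: ends; left.
  have [->|t1'] := eqVneq t 1; first by apply: ends; right.
  by apply: h; rewrite !lt_def t0 t1 t0' eq_sym t1'.
move=> hs; apply: clC => U /(cg s (_ : I01 s)) hU.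
have Is : I01 s by case: hs => ->; [exact: i01_0|exact: i01_1].
have := hU Is; rewrite nbhs_simpl /= withinE /= => -[W nW WE].
have {nW} [e /= e0 eW] := (nbhs_ballP _ _).1 nW.
pose d := Num.min (e / 2) (1 / 2).
have d0 : 0 < d by rewrite lt_min !divr_gt0.
have d1 : d <= 1/2 by rewrite ge_min lexx orbT.
have de : d <= e / 2 by rewrite ge_min lexx.
pose t := if s == 0 then d else 1 - d.
have t01 : 0 < t < 1 by rewrite /t; case: ifP => _; lra.
have Wt : W t.
  apply: eW; rewrite /ball /= /t; case: hs => ->; rewrite ?eqxx ?oner_eq0.
    by rewrite sub0r normrN gtr0_norm; lra.
  by rewrite gtr0_norm; lra.
exists (g t); split; first exact: h.
have Wt1 : (W `&` I01) t by split => //; rewrite in01; lra.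
by move: Wt1; rewrite -WE => -[].
Qed.

Definition indE X := [set f in pe G | f \subset X]%SET.

Lemma indE_pe X : indE X \subset pe G.
Proof. by apply/fintype.subsetP => f; rewrite inE => /andP[]. Qed.

Lemma indE_sub X f : f \in indE X -> f \subset X.
Proof. by rewrite inE => /andP[]. Qed.

Definition bd X F x := [set f in F | `[< pa G f `<=` closure (joined (geo G X F) x) >]]%SET.

Lemma bdP X F x f : f \in bd X F x <-> f \in F /\ pa G f `<=` closure (joined (geo G X F) x).
Proof. by rewrite inE; split => [/andP[? /asboolP]|[-> /asboolP]]. Qed.

Lemma bd_sub X F x : bd X F x \subset F.
Proof. by apply/fintype.subsetP => f /bdP[]. Qed.

Section Fixed.
Variables (X : {set V}) (F : {set {set V}}).
Hypotheses (FE : F \subset pe G) (FX : forall f, f \in F -> f \subset X).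
Local Notation K := (geo G X F).

Let cK : compact K := geo_compact FE.
Let clK : closed K := geo_closed FE.

Lemma split_edge f : f \in F -> exists u v g, [/\ f = ed u v, iarc g, g 0 = pp G u, g 1 = pp G v &
  [/\ g @` I01 = pa G f, compact (geo G X (F :\ f)%SET),
  geo G X (F :\ f)%SET `&` (g @` I01) `<=` [set g 0; g 1] &
  K = geo G X (F :\ f)%SET `|` g @` I01]].
Proof.
move=> fF; have fE := fintype.subsetP FE _ fF.
have [u [v [uv e]]] := edP fE.
have [g [ag g0 g1 gA]] := edge_param (G := G) (u := u) (v := v) ltac:(by rewrite -e).
have F'E : (F :\ f)%SET \subset pe G by apply: fintype.subset_trans FE; exact: subD1set.
exists u, v, g; split => //; split.
- by rewrite gA e.
- exact: geo_compact.
- rewrite g0 g1 gA; apply: geo_arc => //; first by rewrite -e.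
  by rewrite -e !inE eqxx.
- by rewrite gA -e -geo_setU1 finset.setD1K.
Qed.

(** By [edge_closure] one interior point of an edge in the closure of a face brings in the whole
    edge. *)
Lemma touch x f z : ~ K x -> f \in F -> pa G f z -> (forall w, z <> pp G w) ->
  closure (joined K x) z -> f \in bd X F x.
Proof.
move=> nx fF fz zw clz; apply/bdP; split=> //.
have [u [v [g [e ag g0 g1 [gA cK0 KA KE]]]]] := split_edge fF.
rewrite -gA; apply: iarc_closed => //; first exact: closed_closure.
move: fz; rewrite -gA => -[t]; rewrite in01 => /andP[t0 t1] tz.
have t01 : 0 < t < 1.
  rewrite !lt_def t0 t1 !andbT; apply/andP; split; apply/eqP => h.
    by apply: (zw u); rewrite -tz h g0.
  by apply: (zw v); rewrite -tz -h g1.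
move=> s s01; rewrite KE; apply: (edge_closure cK0 ag KA t01 s01); rewrite -KE //.
by rewrite tz.
Qed.

(** All points of [K] in the closure of the face lie on its boundary edges or are vertices, so
    erasing the other edges does not enlarge it. *)
Lemma bd_face x : ~ K x -> joined (geo G X (bd X F x)) x = joined K x.
Proof.
move=> nx; have sub : geo G X (bd X F x) `<=` K by apply: geo_sub => //; exact: bd_sub.
apply/seteqP; split => [|y]; last exact: joined_sub.
have nx' : ~ geo G X (bd X F x) x by move=> /sub.
apply: (@face_trap _ K x (joined (geo G X (bd X F x)) x) x) => //.
- exact: component_connected.
- exact: joined_refl.
- exact: joined_refl.
move=> z [xz clz]; apply: closure_face => //; have nz := joined_off xz.
case=> [[w wX zw]|[f fF fz]]; first by apply: nz; left; exists w.
have [[w zw]|] := pselect (exists w, z = pp G w).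
  apply: nz; left; exists w => //; apply: (geo_pp FE FX); rewrite -zw.
  by right; exists f.
move=> /forallNP zw; apply: nz; right; exists f => //; exact: touch zw clz.
Qed.

Lemma bd_three x y z f : ~ K x -> ~ K y -> ~ K z ->
  f \in bd X F x -> f \in bd X F y -> f \in bd X F z ->
  [\/ joined K x y, joined K x z | joined K y z].
Proof.
move=> nx ny nz /bdP[fF hx] /bdP[_ hy] /bdP[_ hz].
have [u [v [g [e ag g0 g1 [gA cK0 KA KE]]]]] := split_edge fF.
have gh : pa G f (g (1/2)) by rewrite -gA; exists (1/2) => //; exact: half_in.
have := edge_side cK0 ag KA; rewrite -KE => side.
rewrite KE; apply: joined_three => //.
- by move=> h; apply: nx; rewrite KE; right.
- by move=> h; apply: ny; rewrite KE; right.
- by move=> h; apply: nz; rewrite KE; right.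
- by apply: side; [exact: hx|exact: hy].
- by apply: side; [exact: hx|exact: hz].
Qed.

Lemma faces1 (L : set T) (I : finType) (s : I -> T) x y : faces L s -> (#|I| <= 1)%N ->
  ~ L x -> ~ L y -> joined L x y.
Proof.
move=> [_ _ s3] I1 nx ny; have [i ix] := s3 x nx; have [j jy] := s3 y ny.
have /fintype_le1P h := I1.
have e : i = j by exact: h.
by rewrite e in ix; apply: joined_trans jy; exact: joined_sym.
Qed.

(** The face of [x] is still a face, and not the only one, after all but its boundary edges are
    erased; by [euler_data] a graph with two faces has three edges. *)
Lemma bd_card_gt2 x y : ~ K x -> ~ K y -> ~ joined K x y -> (2 < #|bd X F x|)%N.
Proof.
move=> nx ny nxy.
have sub : geo G X (bd X F x) `<=` K by apply: geo_sub => //; exact: bd_sub.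
have [|f /bdP[/FX]//|I [s [Tr [hs _ _]]]] := @euler _ _ G X (bd X F x).
  by apply: fintype.subset_trans FE; exact: bd_sub.
case=> [I1|hI].
  exfalso; apply: nxy; rewrite -bd_face //; by apply: (faces1 hs) => [|/sub|/sub]//; rewrite I1.
have : (1 < #|I|)%N; last by lia.
rewrite ltnNge; apply/negP => I1; apply: nxy; rewrite -bd_face //.
by apply: (faces1 hs) => [|/sub|/sub].
Qed.

Lemma bd_count (I : finType) (s : I -> T) f : faces K s ->
  (#|[set i | f \in bd X F (s i)]%SET| <= 2)%N.
Proof.
move=> [s1 s2 _]; rewrite leqNgt; apply/negP.
move=> /card_gt2P[i [j [k [[hi hj hk] [/eqP ij /eqP jk /eqP ki]]]]].
rewrite finset.in_set in hi; rewrite finset.in_set in hj; rewrite finset.in_set in hk.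
by case: (bd_three (s1 i) (s1 j) (s1 k) hi hj hk) => /s2 e; [exact: ij|exact/ki/esym|exact: jk].
Qed.

Lemma bd_sum (I : finType) (s : I -> T) :
  (\sum_(i : I) #|bd X F (s i)| = \sum_(f in F) #|[set i | f \in bd X F (s i)]%SET|)%N.
Proof.
rewrite (eq_bigr (fun i => \sum_(f in F | f \in bd X F (s i)) 1)%N) => [|i _]; last first.
  rewrite sum1dep_card; apply: eq_card => f; rewrite !inE.
  by case: (f \in F).
rewrite (exchange_big_dep (mem F)) /=; last by move=> i f _ /andP[].
apply: eq_bigr => f fF; rewrite sum1dep_card; apply: eq_card => i; rewrite !inE fF.
by rewrite andTb.
Qed.

End Fixed.

Lemma transv_gt0 X F Tr v : v \in X -> transv X F Tr -> (0 < #|Tr|)%N.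
Proof. by move=> vX [_ _ /(_ v vX)[a aT _]]; apply/card_gt0P; exists a. Qed.

(** Count incidences of edges and faces: at least three per face, at most two per edge. Euler's
    formula turns this into the bound, and equality forces equality in every term. With a single
    face the graph is a forest, far from the bound. *)
Lemma indE_faces X : (3 <= #|X|)%N ->
  (#|indE X| + 6 <= 3 * #|X|)%N /\
  ((3 * #|X| <= #|indE X| + 6)%N -> exists (I : finType) (s : I -> T),
   [/\ faces (geo G X (indE X)) s, (#|I| + 4 = 2 * #|X|)%N,
       forall i, #|bd X (indE X) (s i)| = 3%N &
       forall f, f \in indE X -> #|[set i | f \in bd X (indE X) (s i)]%SET| = 2%N]).
Proof.
move=> X3; have [v vX] : exists v, v \in X by apply/card_gt0P; lia.
have [I [s [Tr [hs hT hcard hsmall]]]] := euler (@indE_pe X) (@indE_sub X).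
have T0 := transv_gt0 vX hT.
have [I1|I1] := leqP #|I| 1; first by split; lia.
have [s1 s2 s3] := hs.
have b3 i : (3 <= #|bd X (indE X) (s i)|)%N.
  have [j ij] : exists j, j != i.
    apply/existsP; rewrite -negb_forall; apply: contraL I1 => /forallP h.
    rewrite -leqNgt; apply/fintype_le1P => a b.
    by rewrite (_ : b = a)// (eqP (h a)) (eqP (h b)).
  apply: (@bd_card_gt2 _ _ (@indE_pe X) (@indE_sub X) (s i) (s j)) => //.
  by move=> /s2 e; rewrite e eqxx in ij.
have b2 f : f \in indE X -> (#|[set i | f \in bd X (indE X) (s i)]%SET| <= 2)%N.
  by move=> _; apply: bd_count => //; exact: indE_pe.
have := bd_sum X (indE X) s; set S := (\sum_(i : I) _)%N => eS.
have cI : (\sum_(i : I) 3)%N = (#|I| * 3)%N by rewrite sum_nat_const.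
have cE : (\sum_(f in indE X) 2)%N = (#|indE X| * 2)%N by rewrite sum_nat_const.
have S1 : (#|I| * 3 <= S)%N by rewrite -cI; apply: leq_sum.
have S2 : (S <= #|indE X| * 2)%N by rewrite -cE eS; apply: leq_sum.
clearbody S.
split; first by lia.
move=> tight; exists I, s; split=> //.
- by lia.
- move=> i; symmetry; apply: (@sum_eq_termwise I xpredT (fun=> 3%N) (fun i => #|bd X (indE X) (s i)|)) => //.
  by rewrite bd_sum -eS cI; lia.
- move=> f fX; apply: (@sum_eq_termwise _ (mem (indE X)) (fun f => #|[set i | f \in bd X (indE X) (s i)]%SET|) (fun=> 2%N)) => //.
  by rewrite -eS cE; lia.
Qed.

(** Were the edge a bridge, its removal would leave at most two edges, hence one face, and by
    [bridge_faces] there would be one face with it too. *)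
Lemma gconn_cycle X F x y u v : F \subset pe G -> (forall f, f \in F -> f \subset X) ->
  (#|F| <= 3)%N -> ~ geo G X F x -> ~ geo G X F y -> ~ joined (geo G X F) x y ->
  ed u v \in F -> gconn (F :\ ed u v)%SET u v.
Proof.
move=> FE FX F3 nx ny nxy uvF; apply/negPn/negP => nuv; apply: nxy.
have sub := subD1set F (ed u v).
have F'E := fintype.subset_trans sub FE.
have F'X f : f \in (F :\ ed u v)%SET -> f \subset X by move=> /(fintype.subsetP sub); exact: FX.
have [I [s [Tr [hs _ _ hsmall]]]] := euler F'E F'X.
have uvE := fintype.subsetP FE _ uvF.
have uvn : ed u v \notin (F :\ ed u v)%SET by rewrite !inE eqxx.
have /fintype.subsetP uvX := FX _ uvF.
have uX : u \in X by apply: uvX; rewrite !inE eqxx.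
have vX : v \in X by apply: uvX; rewrite !inE eqxx orbT.
have [s' hs'] := bridge_faces F'E uvE uvn F'X uX vX nuv hs.
rewrite finset.setD1K // in hs'; apply: (faces1 hs') => //.
have := cardsD1 (ed u v) F; rewrite uvF add1n => h; case: hsmall => [->//|hI].
by rewrite h ltnS in F3; exact: leq_trans hI F3.
Qed.

Lemma neq_mem (A B : {set V}) w : w \in A -> w \notin B -> A != B.
Proof. by move=> wA; apply: contraNneq => <-. Qed.

Lemma indE_triple u v a : u != v -> u != a -> v != a ->
  ed u v \in pe G -> ed u a \in pe G -> ed v a \in pe G ->
  indE [set u; v; a]%SET = [set ed u v; ed u a; ed v a]%SET /\
  #|[set ed u v; ed u a; ed v a]%SET| = 3%N.
Proof.
move=> uv ua va h1 h2 h3; split.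
  apply/setP => f; apply/idP/idP.
    rewrite finset.in_set => /andP[/pe2 f2 /(pair_in_triple f2)].
    by case=> ->; rewrite !inE eqxx ?orbT.
  by rewrite !inE => /orP[/orP[]|] /eqP ->;
    rewrite finset.subUset !finset.sub1set !inE !eqxx ?orbT ?h1 ?h2 ?h3.
rewrite cards_triple //.
- apply: (neq_mem (w := v)); first by rewrite !inE eqxx orbT.
  by rewrite !inE negb_or eq_sym uv va.
- apply: (neq_mem (w := u)); first by rewrite !inE eqxx.
  by rewrite !inE negb_or uv ua.
- apply: (neq_mem (w := u)); first by rewrite !inE eqxx.
  by rewrite !inE negb_or uv ua.
Qed.

Lemma cycle_cover (T : {set V}) X : T \in cycles3 (pe G) -> (forall f, f \in indE T -> f \subset X) ->
  T \subset X.
Proof.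
move=> /cycles3P[cT h] TX; apply/fintype.subsetP => w wT.
have [w' ww wT'] : exists2 w', w != w' & w' \in T.
  have /card_gt0P[w'] : (0 < #|T :\ w|)%N by have := cardsD1 w T; rewrite wT cT; lia.
  by rewrite !inE => /andP[ww ?]; exists w' => //; rewrite eq_sym.
have wwT : ed w w' \subset T by rewrite finset.subUset !finset.sub1set wT.
have : ed w w' \in indE T by rewrite inE wwT andbT; apply: h => //; rewrite cards2 ww.
by move/TX; rewrite finset.subUset !finset.sub1set => /andP[].
Qed.

(** Every edge of [D] is continued at both ends by another edge of [D]; three edges can do so only
    by closing up. *)
Lemma cycle_triangle (D : {set {set V}}) : D \subset pe G -> #|D| = 3%N ->
  (forall u v, ed u v \in D -> gconn (D :\ ed u v)%SET u v) ->
  exists T, T \in cycles3 (pe G) /\ D = indE T.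
Proof.
move=> DE D3 cyc.
have next u v : ed u v \in D -> exists a, [/\ ed u a \in D, a != v & a != u].
  move=> h; have uv := ed_neq (fintype.subsetP DE _ h).
  have [a] := gconn_step uv (cyc u v h); rewrite !inE => /andP[ne aD]; exists a; split=> //.
    by apply: contraNneq ne => ->.
  by rewrite eq_sym; exact: (ed_neq (fintype.subsetP DE _ aD)).
have [f fD] : exists f, f \in D by apply/card_gt0P; rewrite D3.
have [u [v [uv e]]] := edP (fintype.subsetP DE _ fD); rewrite e in fD.
have [a [ua av au]] := next u v fD.
have [b [vb bu bv]] : exists b, [/\ ed v b \in D, b != u & b != v].
  by apply: next; rewrite finset.setUC.
have DD : D = [set ed u v; ed u a; ed v b]%SET.
  apply/eqP; rewrite eq_sym eqEcard !finset.subUset !finset.sub1set fD ua vb /=.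
  rewrite D3 cards_triple //.
  - apply: (neq_mem (w := v)); first by rewrite !inE eqxx orbT.
    by rewrite !inE negb_or eq_sym uv eq_sym av.
  - apply: (neq_mem (w := u)); first by rewrite !inE eqxx.
    by rewrite !inE negb_or uv eq_sym bu.
  - apply: (neq_mem (w := u)); first by rewrite !inE eqxx.
    by rewrite !inE negb_or uv eq_sym bu.
have ab : a = b.
  have [c [acD cu ca]] : exists c, [/\ ed a c \in D, c != u & c != a].
    by apply: next; rewrite finset.setUC.
  have aac : a \in ed a c by rewrite !inE eqxx.
  have cac : c \in ed a c by rewrite !inE eqxx orbT.
  move: acD; rewrite DD !inE => /orP[/orP[]|] /eqP ee; move: aac cac; rewrite ee !inE.
  + by rewrite (negbTE au) (negbTE av).
  + by rewrite (negbTE cu) (negbTE ca).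
  + by rewrite (negbTE av) /= => /eqP.
subst b; have ua' : u != a by rewrite eq_sym.
have va' : v != a by rewrite eq_sym.
have DP := fintype.subsetP DE.
exists [set u; v; a]%SET; split.
  by apply: cycles3_triple => //; exact: DP.
by rewrite DD; case: (@indE_triple u v a) => //; exact: DP.
Qed.

Lemma bd_triangle X F x y : F \subset pe G -> (forall f, f \in F -> f \subset X) ->
  ~ geo G X F x -> ~ geo G X F y -> ~ joined (geo G X F) x y -> #|bd X F x| = 3%N ->
  exists T, [/\ T \in cycles3 (pe G), T \subset X & bd X F x = indE T].
Proof.
move=> FE FX nx ny nxy D3.
have DF := bd_sub X F x; have DE := fintype.subset_trans DF FE.
have DX f : f \in bd X F x -> f \subset X by move=> /(fintype.subsetP DF); exact: FX.
have sub : geo G X (bd X F x) `<=` geo G X F by apply: geo_sub.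
have [|T [T3 e]] := cycle_triangle DE D3.
  move=> u v uvD; apply: (@gconn_cycle X _ x y) => //; first by rewrite D3.
  - by move/sub.
  - by move/sub.
  - by rewrite bd_face.
by exists T; split=> //; apply: cycle_cover => // f; rewrite -e; exact: DX.
Qed.

(** The common boundary, three edges, has at most two faces. They are the faces of [x] and [y], so
    no room is left for a third face. *)
Lemma bd_inj X F x y z : F \subset pe G -> (forall f, f \in F -> f \subset X) ->
  ~ geo G X F x -> ~ geo G X F y -> ~ geo G X F z -> ~ joined (geo G X F) x y ->
  #|bd X F x| = 3%N -> bd X F x = bd X F y ->
  joined (geo G X F) x z \/ joined (geo G X F) y z.
Proof.
move=> FE FX nx ny nz nxy D3 e.
have DF := bd_sub X F x; have DE := fintype.subset_trans DF FE.
have DX f : f \in bd X F x -> f \subset X by move=> /(fintype.subsetP DF); exact: FX.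
have sub : geo G X (bd X F x) `<=` geo G X F by apply: geo_sub.
have [I [s [Tr [[s1 s2 s3] _ _ hsmall]]]] := euler DE DX.
have I2 := small_faces hsmall D3.
have [i ix] := s3 x (contra_not (@sub x) nx).
have [j jy] := s3 y (contra_not (@sub y) ny).
have [k kz] := s3 z (contra_not (@sub z) nz).
rewrite -(bd_face FE FX nx) in nxy *; rewrite -(bd_face FE FX ny) -e.
have ij : i != j.
  by apply: contra_notN nxy => /eqP ij; apply: joined_trans (joined_sym ix) _; rewrite ij.
case: (card_le2_cases k I2 ij) => e'.
  by left; apply: joined_trans (joined_sym ix) _; rewrite -e'.
by right; apply: joined_trans (joined_sym jy) _; rewrite -e'.
Qed.

(** There are 2|X| - 4 >= 4 faces, so by [bd_inj] no two of them have the same triangle. *)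
Lemma tight_faces X : (4 <= #|X|)%N -> (3 * #|X| <= #|indE X| + 6)%N ->
  exists (I : finType) (s : I -> T) (t : I -> {set V}),
  [/\ faces (geo G X (indE X)) s, injective t,
      forall i, [/\ t i \in cycles3 (pe G), t i \subset X & bd X (indE X) (s i) = indE (t i)] &
      forall f, f \in indE X -> #|[set i | f \subset t i]%SET| = 2%N].
Proof.
move=> X4 tight; have [_ /(_ tight)[I [s [hs hI h3 h2]]]] := @indE_faces X (ltnW X4).
have [s1 s2 s3] := hs.
have other (i : I) : exists j : I, j != i.
  apply/existsP; rewrite -negb_forall; apply: contraL X4 => /forallP h.
  have : (#|I| <= 1)%N.
    by apply/fintype_le1P => a b; rewrite (_ : b = a)// (eqP (h a)) (eqP (h b)).
  by lia.
have ex i : exists t, [/\ t \in cycles3 (pe G), t \subset X & bd X (indE X) (s i) = indE t].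
  have [j ij] := other i.
  apply: (@bd_triangle X _ (s i) (s j)) => //; [exact: indE_pe|exact: indE_sub|].
  by move=> /s2 e; rewrite e eqxx in ij.
have [t tP] := choice ex.
exists I, s, t; split => //.
  move=> i j e; apply/eqP/negPn/negP => ij.
  have [k ki kj] : exists2 k, k != i & k != j.
    have /card_gt0P[k] : (0 < #|[set: I] :\: [set i; j]|)%N.
      rewrite finset.cardsD finset.setTI cards2 ij cardsT; lia.
    by rewrite !inE andbT negb_or => /andP[ki kj]; exists k.
  have [||h|h] := @bd_inj X _ (s i) (s j) (s k) (@indE_pe X) (@indE_sub X) (s1 i) (s1 j) (s1 k) _ (h3 i).
  - by move=> /s2 e'; rewrite e' eqxx in ij.
  - by have [_ _ ->] := tP i; have [_ _ ->] := tP j; rewrite e.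
  - by rewrite (s2 _ _ h) eqxx in ki.
  - by rewrite (s2 _ _ h) eqxx in kj.
move=> f fX; rewrite -(h2 f fX); apply: eq_card => i; rewrite [LHS]finset.in_set [RHS]finset.in_set.
have [_ _ ->] := tP i; rewrite finset.in_set.
by rewrite (fintype.subsetP (@indE_pe X) _ fX).
Qed.

Lemma tight_two_cycles X f : (4 <= #|X|)%N -> (3 * #|X| <= #|indE X| + 6)%N -> f \in indE X ->
  exists T1 T2, [/\ T1 != T2, T1 \in cycles3 (pe G) /\ T2 \in cycles3 (pe G),
    f \subset T1 /\ f \subset T2 & T1 \subset X /\ T2 \subset X].
Proof.
move=> X4 tight fX; have [I [s [t [_ tinj tP /(_ f fX)/eqP/cards2P[i [j [ij e]]]]]]] := tight_faces X4 tight.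
have := finset.set21 i j; have := finset.set22 i j; rewrite -e !finset.in_set => fj fi.
exists (t i), (t j); have [? ? _] := tP i; have [? ? _] := tP j; split => //.
by apply: contraNneq ij => /tinj ->.
Qed.

Lemma arc_reach a b z : ed b a \in pe G -> pa G (ed b a) z -> z <> pp G a ->
  exists C : set T, [/\ connected C, C z, C (pp G b), C `<=` pa G (ed b a) & ~ C (pp G a)].
Proof.
move=> /edge_param[g [ag g0 g1 gA]]; rewrite -gA => -[t It tz] za.
have [t0|t0] := eqVneq 0 t.
  exists [set z]; split.
  - exact: connected1.
  - by [].
  - by rewrite /= -tz -t0 g0.
  - by move=> _ ->; exists t.
  - by move=> e; exact/za/esym.
have pC := parc_reparam ag (i01_0 R) It t0.
exists ((fun s : R => g (0 + s * (t - 0))) @` I01); split.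
- exact: parc_connected pC.
- by rewrite -tz; exact: parc_r pC.
- by rewrite -g0; exact: parc_l pC.
- move=> _ [r Ir <-]; exists (0 + r * (t - 0)) => //; move: Ir It; rewrite !in01; nra.
- move=> [r Ir e]; apply: za; rewrite -tz -g1; congr g.
  have [_ inj] := ag; have e1 : 0 + r * (t - 0) = 1.
    apply: inj; rewrite ?g1 //; last exact: i01_1.
    by move: Ir It; rewrite !in01; nra.
  by move: Ir It e1; rewrite !in01; nra.
Qed.

(** Two triangles of faces contain [f], so some 3-cycle [D] through [f] is not one of them. The
    drawing of [D] alone has two faces. If one contained no vertex of [X], no edge could enter it,
    it would be a face of the whole drawing, and its triangle would be [D]. So both sides have
    vertices, and an edge between them would cross [D]. *)
Lemma tight_separating X f : (4 <= #|X|)%N -> (3 * #|X| <= #|indE X| + 6)%N -> f \in indE X ->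
  (3 <= #|[set T in cycles3 (pe G) | (f \subset T) && (T \subset X)]%SET|)%N ->
  exists D X1 X2 : {set V}, [/\ D \in cycles3 (pe G), f \subset D,
    X1 :|: X2 = X /\ X1 :&: X2 = D, D \proper X1 /\ D \proper X2 &
    forall a b, a \in X1 :\: D -> b \in X2 :\: D -> ed a b \notin pe G]%SET.
Proof.
move=> X4 tight fX c3; have [I [s [t [hs tinj tP h2]]]] := tight_faces X4 tight.
have [D [D3 fD DX Dt]] : exists D, [/\ D \in cycles3 (pe G), f \subset D, D \subset X & forall i, D <> t i].
  have /card_gt0P[D] : (0 < #|[set T in cycles3 (pe G) | (f \subset T) && (T \subset X)]
     :\: t @: [set i | f \subset t i]%SET|)%SET%N.
    rewrite finset.cardsD subn_gt0; apply: leq_ltn_trans (subset_leq_card (finset.subsetIr _ _)) _.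
    apply: leq_ltn_trans (leq_imset_card _ _) _; by rewrite (h2 f fX).
  rewrite !inE => /andP[nD /andP[/andP[? ?] /andP[fD DX]]]; exists D; split=> //.
    by rewrite inE; apply/andP.
  move=> i e; move/negP: nD; apply; apply/imsetP; exists i => //.
  by rewrite finset.in_set -e.
have /cycles3P[cD hD] := D3.
pose F := indE D.
have FE : F \subset pe G := @indE_pe D.
have FX g : g \in F -> g \subset D := @indE_sub D g.
have [u [v [uv ef]]] := edP (fintype.subsetP (@indE_pe X) _ fX).
subst f; move: (fD); rewrite finset.subUset !finset.sub1set => /andP[uD vD].
have [w [uw vw eD]] := pair_third cD uv uD vD.
have inF a b : a != b -> a \in D -> b \in D -> ed a b \in F.
  move=> ab aD bD; have abD : ed a b \subset D by rewrite finset.subUset !finset.sub1set aD.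
  by rewrite inE abD andbT; apply: hD => //; rewrite cards2 ab.
have uvF : ed u v \in F by exact: inF.
have wD : w \in D by rewrite eD !inE eqxx orbT.
have uwF : ed u w \in F by exact: inF.
have wvF : ed w v \in F by apply: inF; rewrite // eq_sym.
have FpE := fintype.subsetP FE.
have cF : #|F| = 3%N.
  have [e1 e2] := @indE_triple u v w uv uw vw (FpE _ uvF) (FpE _ uwF) ltac:(by rewrite finset.setUC FpE).
  by rewrite /F eD e1.
have FX' g : g \in F -> g \subset X by move=> /FX h; exact: fintype.subset_trans h DX.
set K' := geo G D F; set K := geo G X (indE X).
have KK : K' `<=` K.
  by apply: geo_sub => //; apply/fintype.subsetP => g gF; rewrite inE FX' // FpE.
have clK' : closed K' := geo_closed FE.
have [x [y [nx ny nxy cov]]] : exists x y, [/\ ~ K' x, ~ K' y, ~ joined K' x y &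
    forall z, ~ K' z -> joined K' x z \/ joined K' y z].
  have [g [ag g0 g1 gA]] := edge_param (FpE _ uvF).
  have F'E : (F :\ ed u v)%SET \subset pe G by apply: fintype.subset_trans FE; exact: subD1set.
  have KE : K' = geo G D (F :\ ed u v)%SET `|` g @` I01.
    by rewrite gA -geo_setU1 finset.setD1K.
  have [B pB BK] : exists2 B, parc (g 0) (g 1) B & B `<=` geo G D (F :\ ed u v)%SET.
    rewrite g0 g1; case: (@gconn_parc _ _ G D _ u v F'E) => //; last by move=> e; rewrite e eqxx in uv.
    apply: (@gconn_trans _ _ w); apply: connect1; rewrite finset.in_setD1 ?uwF ?wvF andbT.
      by apply: (neq_mem (w := w)); rewrite !inE ?eqxx ?orbT // negb_or eq_sym uw eq_sym vw.
    by apply: (neq_mem (w := w)); rewrite !inE ?eqxx ?orbT // negb_or eq_sym uw eq_sym vw.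
  have [|x [y [nx ny nxy _ _]]] := edge_splits (geo_compact F'E) ag _ pB BK.
    rewrite g0 g1 gA; apply: geo_arc => //; first exact: FpE.
    by rewrite !inE eqxx.
  rewrite -KE in nx ny nxy; exists x, y; split=> // z nz.
  have [I' [s' [Tr [[s1 s2 s3] _ _ hsmall]]]] := euler FE FX.
  have I2 := small_faces hsmall cF.
  have [i ix] := s3 x nx; have [j jy] := s3 y ny; have [k kz] := s3 z nz.
  have ij : i != j.
    by apply: contra_notN nxy => /eqP ij; apply: joined_trans (joined_sym ix) _; rewrite ij.
  case: (card_le2_cases k I2 ij) => e'.
    by left; apply: joined_trans (joined_sym ix) _; rewrite -e'.
  by right; apply: joined_trans (joined_sym jy) _; rewrite -e'.
(* An edge with an end [b] off the triangle can meet the triangle only in its other end. *)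
have K'edge a b z : ed b a \in pe G -> ed b a \notin F -> b \notin D -> K' z ->
    pa G (ed b a) z -> z = pp G a.
  move=> eE eF bD [[d dD ->]|[g gF gz]] ez.
    have := pa_pt eE ez; rewrite !inE => /orP[]/eqP e; last by rewrite e.
    by rewrite -e dD in bD.
  have ge : g != ed b a by apply: contraNneq eF => <-.
  have [d [-> dg]] := pa_cross_pt (FpE _ gF) eE ge gz ez.
  rewrite !inE => /orP[]/eqP e; last by rewrite e.
  by move: bD; rewrite -e (fintype.subsetP (FX _ gF) _ dg).
have outside g : g \in indE X -> g \notin F -> exists a b, [/\ g = ed b a, b \notin D & b \in X].
  rewrite !finset.in_set => /andP[gE /fintype.subsetP gX]; rewrite gE /= => /subsetPn[b bg bD].
  have [c [d [cd e]]] := edP gE; rewrite e in bg gX *.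
  move: bg (gX _ bg); rewrite !inE => /orP[]/eqP eb; rewrite eb in bD *.
    by exists d, c.
  by exists c, d; rewrite finset.setUC.
have inside p : ~ K' p -> exists b, [/\ b \in X, b \notin D & joined K' p (pp G b)].
  move=> np; apply: contrapT => /forallNP none.
  have free z : joined K' p z -> ~ K z.
    move=> pz; have nz := joined_off pz; case=> [[b bX zb]|[g gX gz]].
      have [bD|bD] := boolP (b \in D); first by apply: nz; left; exists b.
      by apply: (none b); rewrite -zb.
    have [gF|gF] := boolP (g \in F); first by apply: nz; right; exists g.
    have [a [b [e bD bX]]] := outside g gX gF.
    have gE := fintype.subsetP (@indE_pe X) _ gX.
    apply: (none b); split=> //; apply: joined_trans pz _.
    subst g; have [za|za] := pselect (z = pp G a).
      have [aD|aD] := boolP (a \in D); first by exfalso; apply: nz; left; exists a.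
      apply: (joined_conn (parc_connected (pa_arc gE))) => //; last first.
        move=> c cc cK; have ca := K'edge _ _ _ gE gF bD cK cc.
        by move: aD; rewrite (@geo_pp _ _ G D F a) // -ca.
      exact: parc_l (pa_arc gE).
    have [C [cC Cz Cb CA Ca]] := arc_reach gE gz za.
    apply: (joined_conn cC Cz Cb) => c Cc cK; apply: Ca.
    by rewrite -(K'edge _ _ _ gE gF bD cK (CA _ Cc)).
  (* Without vertices on this side the face of the triangle avoids the whole drawing, so it is one
     of its faces. *)
  have eqf : joined K' p = joined K p.
    apply/seteqP; split => z; last exact: joined_sub.
    move=> pz; apply: (@joined_conn _ _ (joined K' p)) => //.
    - exact: component_connected.
    - exact: joined_refl.
  have [s1 s2 s3] := hs; have [k kp] := s3 p (free p (joined_refl np)).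
  have [k3 kX kb] := tP k; apply: (Dt k); apply/eqP.
  have /cycles3P[ck _] := k3.
  rewrite eq_sym eqEcard cD ck leqnn andbT; apply: cycle_cover => // g; rewrite -kb => /bdP[gX gcl].
  have [gF|gF] := boolP (g \in F); first exact: FX.
  have [a [b [e bD bX]]] := outside g gX gF; exfalso.
  have gE := fintype.subsetP (@indE_pe X) _ gX.
  have nb : ~ K' (pp G b) by move=> /(geo_pp FE FX); exact/negP.
  apply: (none b); split=> //; apply: closure_face => //.
  have := gcl (pp G b); rewrite (_ : joined _ (s k) = joined K' p); first apply.
    by rewrite e in gE *; exact: parc_l (pa_arc gE).
  rewrite eqf; apply/seteqP; split => z h; last exact: joined_trans kp h.
  by apply: joined_trans h; exact: joined_sym.
pose side p := [set b in X | (b \in D) || `[< joined K' p (pp G b) >]]%SET.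
have sideP p b : b \in side p <-> b \in X /\ (b \in D \/ joined K' p (pp G b)).
  rewrite finset.in_set; split; first by move=> /andP[-> /orP[|/asboolP]]; auto.
  by case=> -> [->//|h]; apply/orP; right; apply/asboolP.
have subside p : D \subset side p.
  by apply/fintype.subsetP => b bD; apply/sideP; split; [exact: (fintype.subsetP DX)|left].
have psub p : ~ K' p -> D \proper side p.
  move=> np; rewrite properE subside /=; apply/subsetPn.
  by have [b [bX bD jb]] := inside p np; exists b => //; apply/sideP; split; [|right].
exists D, (side x), (side y); split=> //.
- split; apply/setP => b; rewrite !(finset.in_setU, finset.in_setI).
    apply/orP/idP; first by case=> /sideP[].
    move=> bX; have [bD|bD] := boolP (b \in D).
      by left; exact: (fintype.subsetP (subside x)).
    have nb : ~ K' (pp G b) by move=> /(geo_pp FE FX); exact/negP.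
    by case: (cov _ nb) => h; [left|right]; apply/sideP; split; auto.
  apply/andP/idP; last by move=> bD; split; exact: (fintype.subsetP (subside _)).
  case=> /sideP[_ [//|hx]] /sideP[_ [//|hy]]; exfalso; apply: nxy.
  by apply: joined_trans hx _; exact: joined_sym.
- by split; exact: psub.
- move=> a b; rewrite !finset.in_setD => /andP[aD /sideP[_ [h|ha]]]; first by rewrite h in aD.
  move=> /andP[bD /sideP[_ [h|hb]]]; first by rewrite h in bD.
  apply/negP => abE; apply: nxy; apply: joined_trans ha _.
  apply: joined_trans (joined_sym hb).
  have abF : ed a b \notin F by apply: contra aD => /FX/fintype.subsetP; apply; rewrite !inE eqxx.
  apply: (joined_conn (parc_connected (pa_arc abE))) => //.
  + exact: parc_l (pa_arc abE).
  + exact: parc_r (pa_arc abE).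
  move=> c cc cK; have ca := K'edge _ _ _ abE abF aD cK cc.
  by move: bD; rewrite (@geo_pp _ _ G D F b) // -ca.
Qed.

End Boundaries.

(** * Accessibility of vertices *)

Section Access.
Variable R : realType.
Local Notation T := (R * R)%type.
Local Notation I01 := (`[0, 1]%classic : set R).

Definition circle (c : T) (r : R) : set T := [set z | `|z - c| = r].

Lemma dist_continuous (c : T) : continuous (fun z : T => `|z - c| : R).
Proof.
move=> z; apply: (@continuous_comp _ _ _ (fun z : T => z - c) (fun w : T => `|w| : R)).
  by apply: continuousB; [exact: cvg_id|exact: cst_continuous].
exact: norm_continuous.
Qed.

Lemma circle_compact c r : compact (circle c r).
Proof.
apply: (@closed_bounded_compact _ _ (`|c| + `|r|)).
  have -> : circle c r = (fun z : T => `|z - c|) @^-1` [set r] by [].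
  apply: preimage_closed; last exact: closed_eq.
  by move=> z _; exact: dist_continuous.
move=> z zr; rewrite -(subrK c z) addrC; apply: le_trans (ler_normD _ _) _.
by rewrite lerD2l zr ler_norm.
Qed.

Lemma joined_in_ball K c r x y : circle c r `<=` K -> ball c r x -> joined K x y -> ball c r y.
Proof.
move=> sK bx /joinedP[D [cD Dx Dy DK]]; apply: contrapT => ny.
pose nm (z : T) : R := `|z - c|.
have cI : connected (nm @` D).
  apply: connected_image => //; apply: continuous_cont_on; exact: dist_continuous.
move: bx ny; rewrite -!ball_normE /ball_ /= distrC [in X in ~ X]distrC => xr /negP; rewrite -leNgt => yr.
have : (nm @` D) r.
  apply: ((connected_intervalP _).1 cI (nm x) (nm y)); [by exists x|by exists y|].
  by rewrite /nm (ltW xr) yr.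
by case=> z Dz zr; apply: (DK z Dz); apply: sK.
Qed.

(** Near a vertex no exact count is needed, only finiteness, so that some face accumulates at the
    vertex by [closure_fin_cover]. *)
Definition fin_faces (N S : set T) := exists L : seq T,
  forall y, S y -> ~ N y -> exists2 x, x \in L & joined N x y.

(** By [joined_three] an arc replaces each representative by at most two. *)
Lemma fin_faces_arc N S h : compact N -> iarc h -> N `&` (h @` I01) `<=` [set h 0; h 1] ->
  fin_faces N S -> fin_faces (N `|` h @` I01) S.
Proof.
move=> cN ah Nh [L hL]; set N' := N `|` h @` I01.
have ex (x : T) : exists yy : T * T, forall y, joined N x y -> ~ (h @` I01) y ->
    joined N' yy.1 y \/ joined N' yy.2 y.
  have [[y1 [xy1 hy1]]|] := pselect (exists y1, joined N x y1 /\ ~ (h @` I01) y1); last first.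
    by move=> /forallNP none; exists (x, x) => y xy hy; case: (none y).
  have [[y2 [xy2 hy2 n12]]|] := pselect (exists y2, [/\ joined N x y2, ~ (h @` I01) y2 & ~ joined N' y1 y2]); last first.
    move=> /forallNP none; exists (y1, y1) => y xy hy; left => /=.
    by apply: contrapT => ny; case: (none y).
  exists (y1, y2) => y xy hy /=.
  have j12 : joined N y1 y2 by apply: joined_trans xy2; exact: joined_sym.
  have j1 : joined N y1 y by apply: joined_trans xy; exact: joined_sym.
  by case: (joined_three cN ah Nh hy1 hy2 hy j12 j1); [move=> ?; case: n12|left|right].
have [yy yyP] := choice ex.
exists ([seq (yy x).1 | x <- L] ++ [seq (yy x).2 | x <- L]) => y Sy ny.
have [|x xL xy] := hL y Sy; first by move=> ?; apply: ny; left.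
have hy : ~ (h @` I01) y by move=> ?; apply: ny; right.
case: (yyP x y xy hy) => j.
  by exists (yy x).1 => //; rewrite mem_cat; apply/orP; left; apply/mapP; exists x.
by exists (yy x).2 => //; rewrite mem_cat; apply/orP; right; apply/mapP; exists x.
Qed.

Lemma closure_fin_cover (S : set T) (L : seq T) (P : T -> set T) v : closure S v ->
  (forall y, S y -> exists2 x, x \in L & P x y) -> exists2 x, x \in L & closure (P x `&` S) v.
Proof.
move=> + hL; elim: L S hL => [|x L IH] S hL clS.
  by have [y [/hL[]]] := clS setT filterT.
have [clx|nclx] := pselect (closure (P x `&` S) v); first by exists x; rewrite ?mem_head.
have [U nU UP] : exists2 U, nbhs v U & ~ ((P x `&` S) `&` U !=set0).
  by move: nclx => /existsNP[U /not_implyP[nU h]]; exists U.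
have [||w wL clw] := IH (S `&` U).
- move=> y [Sy Uy]; have [z] := hL y Sy; rewrite in_cons => /orP[/eqP -> Pxy|zL zy].
    by exfalso; apply: UP; exists y.
  by exists z.
- by move=> W nW; have [y [Sy [Uy Wy]]] := clS _ (filterI nU nW); exists y.
exists w; first by rewrite in_cons wL orbT.
by apply: closure_subset clw => y [? []].
Qed.

Lemma iarc_germ (g : R -> T) r : iarc g -> 0 < r -> exists h (rest : set T),
  [/\ iarc h, h 0 = g 0, h @` I01 `<=` ball (g 0) r /\ ~ (h @` I01) (g 1),
      compact rest /\ ~ rest (g 0) &
      g @` I01 = h @` I01 `|` rest /\ h @` I01 `&` rest `<=` [set h 1] ].
Proof.
move=> ag r0; have [cg inj] := ag.
have [d d01 dr] : exists2 d : R, 0 < d < 1 & forall t, 0 <= t <= d -> ball (g 0) r (g t).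
  have : nbhs (g x @[x --> within I01 (nbhs (0:R))]) (ball (g 0) r).
    by apply: (cg 0 (i01_0 R)); exact: nbhsx_ballx.
  rewrite nbhs_simpl /= withinE /= => -[W nW WE].
  have {nW} [e /= e0 eW] := (nbhs_ballP _ _).1 nW.
  exists (Num.min (e / 2) (1 / 2)).
    by rewrite lt_min !divr_gt0 //= gt_min; apply/orP; right; lra.
  move=> t /andP[t0]; rewrite le_min => /andP[te t1].
  have Wt1 : (W `&` I01) t.
    split; last by rewrite in01; lra.
    by apply: eW; rewrite /ball /= sub0r normrN ger0_norm //; lra.
  by move: Wt1; rewrite -WE => -[].
have Id : I01 d by rewrite in01; lra.
have d0 : (0 : R) != d by apply/eqP; lra.
have [h [ah h0 h1 hA]] := parc_reparam ag (i01_0 R) Id d0.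
have hI : h @` I01 = g @` `[0, d]%classic.
  rewrite hA; apply/seteqP; split => _ [t It <-].
    by exists (0 + t * (d - 0)) => //; move: It; rewrite in01 /= in_itv /=; nra.
  move: It; rewrite /= in_itv /= => It; exists (t / d).
    by rewrite in_itv /= divr_ge0 ?ler_pdivrMr; lra.
  by congr g; rewrite add0r subr0 divfK //; apply/eqP; lra.
exists h, (g @` `[d, 1]%classic); split => //.
- rewrite hI; split; first by move=> _ [t + <-]; rewrite /= in_itv => It; exact: dr.
  move=> [t]; rewrite /= in_itv /= => It /inj e.
  have : t = 1 by apply: e; [rewrite in01; lra|exact: i01_1].
  by lra.
- split.
    apply: compact_image; last exact: segment_compact.
    by apply: cont_on_sub cg => t /=; rewrite !in_itv /=; lra.
  move=> [t]; rewrite /= in_itv /= => It /inj e.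
  have : t = 0 by apply: e; [rewrite in01; lra|exact: i01_0].
  by lra.
- rewrite hI; split.
    apply/seteqP; split => [_ [t + <-]|_ [] [t It <-]].
    + rewrite in01 => It; have [td|td] := leP t d; [left|right]; exists t => //=.
        by rewrite in_itv /=; lra.
      by rewrite in_itv /=; lra.
    + by exists t => //; move: It; rewrite in01 /= in_itv /=; lra.
    + by exists t => //; move: It; rewrite in01 /= in_itv /=; lra.
  move=> _ [[t + <-] [s + ]]; rewrite /= !in_itv /= => It Is /inj e.
  have st : s = t by apply: e; rewrite in01; lra.
  by rewrite h1; congr g; lra.
Qed.

Variables (V : finType) (G : plane_graph R V).
Local Notation K := (geo G [set: V] (pe G)).

Let cK : compact K := geo_compact (fintype.subxx (pe G)).
Let clK : closed K := geo_closed (fintype.subxx (pe G)).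

(** Remove from the drawing [v] and a short initial part of each edge at [v]. What remains, with the
    circle, is a compact set [M0] that misses [v], so a small ball around [v] lies in one face of
    it. Then [v] and the initial parts are put back: the punctured ball is connected, and each of
    the finitely many arcs preserves finiteness. *)
Lemma finite_sectors (v : V) (r : R) : 0 < r ->
  exists2 e : R, 0 < e & fin_faces (circle (pp G v) r `|` K) (ball (pp G v) e).
Proof.
move=> r0; pose c := pp G v.
have ex (f : {set V}) : exists hr : (R -> T) * set T, f \in pe G -> v \in f ->
    [/\ iarc hr.1, hr.1 0 = c, hr.1 @` I01 `<=` ball c r /\
      (forall w, w \in f -> w != v -> ~ (hr.1 @` I01) (pp G w)),
      compact hr.2 /\ ~ hr.2 c &
      pa G f = hr.1 @` I01 `|` hr.2 /\ hr.1 @` I01 `&` hr.2 `<=` [set hr.1 1]].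
  have [[fE vf]|] := pselect (f \in pe G /\ v \in f); last first.
    by move=> nf; exists ((fun=> c), set0) => fE vf; case: nf.
  have [w [vw ef]] : exists w, v != w /\ f = ed v w.
    have [a [b [ab e]]] := edP fE; move: vf; rewrite e !inE => /orP[]/eqP->.
      by exists b.
    by exists a; rewrite eq_sym finset.setUC.
  rewrite ef in fE; have [g [ag g0 g1 gA]] := edge_param fE.
  have [h [rest [ah h0 [hb hw] [cr nr] [e1 e2]]]] := iarc_germ ag r0.
  exists (h, rest) => _ _ /=; rewrite g0 in h0 hb nr; rewrite g1 in hw.
  split => //.
    split=> // w'; rewrite ef !inE => /orP[]/eqP->; first by rewrite eqxx.
    by [].
  by rewrite ef -gA.
have [hr hrP] := choice ex.
pose h f := (hr f).1; pose rest f := (hr f).2.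
pose at_v := [set f in pe G | v \in f]%SET.
have atP f : f \in at_v -> f \in pe G /\ v \in f by rewrite inE => /andP.
pose Rs (F : {set {set V}}) : set T := [set z | exists2 f, f \in F & rest f z].
have cRs (F : {set {set V}}) : F \subset at_v -> compact (Rs F : set T).
  elim/edge_set_ind : F => [|f F fF IH] FE.
    rewrite (_ : Rs _ = set0); first exact: compact0.
    by apply/seteqP; split => z // [f]; rewrite inE.
  move: FE; rewrite finset.subUset finset.sub1set => /andP[/atP[fE vf] FE].
  have -> : Rs (f |: F)%SET = rest f `|` Rs F.
    apply/seteqP; split => z.
      by case=> g /finset.setU1P[->|gF] gz; [left|right; exists g].
    case=> [fz|[g gF gz]]; [exists f => //|exists g => //]; by rewrite finset.in_setU1 ?eqxx ?gF ?orbT.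
  by apply: compactU; [case: (hrP f fE vf) => _ _ _ []|exact: IH].
pose Y := [set~ v]%SET; pose FY := (pe G :\: at_v)%SET.
have FYE : FY \subset pe G by exact: finset.subsetDl.
have FYv f : f \in FY -> v \notin f by rewrite !inE; case: (f \in pe G) => //=; rewrite andbT.
pose M0 := circle c r `|` geo G Y FY `|` Rs at_v.
have cM0 : compact M0.
  apply: compactU; last exact: cRs.
  by apply: compactU; [exact: circle_compact|exact: geo_compact].
have nM0 : ~ M0 c.
  case=> [[|]|[f /atP[fE vf]]]; last by case: (hrP f fE vf) => _ _ _ [].
    by rewrite /circle /= subrr normr0 => e; move: r0; rewrite -e ltxx.
  case=> [[w + /pp_inj vw]|[f fF]]; first by rewrite !inE vw eqxx.
  by move=> /(pa_pt (fintype.subsetP FYE _ fF)); apply/negP; exact: FYv.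
have [e e0 eb] := joined_closed_ball (compact_closedP cM0) nM0.
exists e => //.
pose M (F : {set {set V}}) : set T := (M0 `|` [set c]) `|` [set z | exists2 f, f \in F & (h f @` I01) z].
have Mstep (f : {set V}) (F : {set {set V}}) : M (f |: F)%SET = M F `|` h f @` I01.
  apply/seteqP; split => z.
    case=> [?|[g /finset.setU1P[->|gF] gz]]; [by left; left|by right|by left; right; exists g].
  case=> [[?|[g gF gz]]|?]; [by left|by right; exists g; rewrite // finset.in_setU1 gF orbT|].
  by right; exists f; rewrite // finset.in_setU1 eqxx.
suff main (F : {set {set V}}) : F \subset at_v -> compact (M F) /\ fin_faces (M F) (ball c e).
  have [_] := main at_v (fintype.subxx _); congr (fin_faces _ _).
  apply/seteqP; split => z.
    case=> [[[[?|zY]|[f /atP[fE vf] fz]]|->]|[f /atP[fE vf] fz]]; first by left.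
    - by right; apply: geo_sub zY => //; exact: finset.subsetT.
    - right; right; exists f => //.
      by case: (hrP f fE vf) => _ _ _ _ [-> _]; right.
    - by right; left; exists v; rewrite ?inE.
    - right; right; exists f => //.
      by case: (hrP f fE vf) => _ _ _ _ [-> _]; left.
  case=> [?|[[w _ ->]|[f fE fz]]]; first by left; left; left; left.
    have [->|wv] := eqVneq w v; first by left; right.
    by left; left; left; right; left; exists w; rewrite // !inE.
  have [vf|vf] := boolP (v \in f).
    have fv : f \in at_v by rewrite inE fE.
    have [_ _ _ _ [eA _]] := hrP f fE vf; move: fz; rewrite eA => -[fz|fz].
      by right; exists f.
    by left; left; right; exists f.
  by left; left; left; right; right; exists f; rewrite // !inE fE (negbTE vf).
elim/edge_set_ind : F => [|f F fF IH] FE.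
  have -> : M finset.set0 = M0 `|` [set c].
    apply/seteqP; split => z; last by left.
    by case=> // -[g]; rewrite inE.
  split; first by apply: compactU => //; exact: compact_set1.
  have [[y [yb ny]]|] := pselect (exists y, ball c e y /\ ~ (M0 `|` [set c]) y); last first.
    by move=> /forallNP none; exists [::] => y yb ny; case: (none y).
  exists [:: y] => y' yb' ny'; exists y; first by rewrite mem_head.
  have off z : (ball c e `\ c) z -> ~ (M0 `|` [set c]) z.
    by move=> [bz zc] [|//]; apply: joined_off; exact: eb bz.
  apply: (joined_conn (@punctured_ball_connected _ c e)) => //.
    by split=> // yc; apply: ny; right.
  by split=> // yc; apply: ny'; right.
move: FE; rewrite finset.subUset finset.sub1set => /andP[fv FE].
have [cM fM] := IH FE; have [fE vf] := atP _ fv.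
have [ah h0 [hb hw] [cr nr] [eA hrest]] := hrP f fE vf.
rewrite Mstep; split; first by apply: compactU => //; exact: arc_compact.
apply: fin_faces_arc => // z [Mz hz].
have fz : pa G f z by rewrite eA; left.
have cross g : g \in pe G -> g != f -> pa G g z -> z = c.
  move=> gE gf gz; have [w [zw wg wf]] := pa_cross_pt gE fE gf gz fz.
  have [e1|wv] := eqVneq w v; first by rewrite zw e1.
  by case: (hw w wf wv); rewrite -zw.
case: Mz => [[[[zc|[[w wv zw]|[g gF gz]]]|[g gv gz]]|zc]|[g gF gz]].
- by exfalso; move: (hb z hz) zc; rewrite -ball_normE /ball_ /= /circle /= distrC => + e1; rewrite e1 ltxx.
- exfalso; have wf : w \in f by apply: pa_pt fE _; rewrite -zw.
  by apply: (hw w wf); rewrite -?zw //; move: wv; rewrite !inE.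
- exfalso; have gE := fintype.subsetP FYE _ gF.
  have gf : g != f by apply: contraTneq vf => <-; exact: FYv.
  by have := gz; rewrite (cross g gE gf gz) => /(pa_pt gE); apply/negP; exact: FYv.
- have [gE vg] := atP _ gv; have [_ _ _ [_ nrg] [eg _]] := hrP g gE vg.
  have [egf|gf] := eqVneq g f; first by right; apply: hrest; split=> //; rewrite -egf.
  by exfalso; apply: nrg; rewrite -(cross g gE gf) // eg; right.
- by left; rewrite /h h0.
- have gv := fintype.subsetP FE _ gF; have [gE vg] := atP _ gv.
  have gf : g != f by apply: contraNneq fF => <-.
  left; rewrite /h /= h0; apply: (cross g gE gf).
  by have [_ _ _ _ [-> _]] := hrP g gE vg; left.
Qed.

(** Inside the ball, [S] is a union of components of the complement of [K]. Hence a smaller sector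
    that meets [S] is contained in it. *)
Definition saturated (c : T) (r : R) (S : set T) := forall D, connected D ->
  D `<=` ~` K -> D `<=` ball c r -> D `&` S !=set0 -> D `<=` S.

(** Among the finitely many sectors of the smaller ball, one accumulates at the vertex through
    points of [S]. The circle in [M] confines it to the ball. *)
Lemma sector_step (v : V) (r r' : R) (S : set T) : 0 < r' <= r ->
  S `<=` ~` K -> closure S (pp G v) -> saturated (pp G v) r S ->
  exists W : set T, [/\ open W /\ connected W, W `<=` S /\ W !=set0,
    W `<=` ball (pp G v) r', closure W (pp G v) & saturated (pp G v) r' W].
Proof.
move=> /andP[r0 rr] SK clS satS; set c := pp G v in clS satS *.
have [e e0 [L hL]] := @finite_sectors v r' r0.
set M := circle c r' `|` K in hL.
have cM : compact M by apply: compactU => //; exact: circle_compact.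
have offM y : ball c r' y -> ~ K y -> ~ M y.
  rewrite -ball_normE /ball_ /= distrC => yr ny [|//]; rewrite /circle /= => e1.
  by rewrite e1 ltxx in yr.
pose e' := Num.min e r'.
have e'0 : 0 < e' by rewrite lt_min e0.
pose S' := S `&` ball c e'.
have S'e y : S' y -> ball c e y /\ ball c r' y.
  by case=> _ yb; split; apply: le_ball yb; rewrite ge_min lexx ?orbT.
have clS' : closure S' c.
  move=> N nN; have [y [Sy [Ny yb]]] := clS _ (filterI nN (nbhsx_ballx c e' e'0)).
  by exists y.
have [|x xL clx] := @closure_fin_cover S' L (joined M) c clS'.
  move=> y Sy; have [ye yr] := S'e y Sy; apply: hL => //; apply: offM => //.
  by apply: SK; case: Sy.
have [x0 [[xx0 S'x0] _]] := clx setT filterT.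
have [x0e x0r] := S'e _ S'x0; have Sx0 : S x0 by case: S'x0.
have WK : joined M x `<=` ~` K by move=> z /joined_off nM Kz; apply: nM; right.
have Wb : joined M x `<=` ball c r'.
  move=> z xz; apply: (@joined_in_ball M c r' x0) => //; first by move=> w; left.
  by apply: joined_trans xz; exact: joined_sym.
have cW : connected (joined M x) by exact: component_connected.
exists (joined M x); split => //.
- by split=> //; apply: face_open; exact: compact_closedP.
- split; last by exists x0.
  apply: satS => //; last by exists x0.
  by move=> z /Wb; exact: le_ball.
- by apply: closure_subset clx => z [].
- move=> D cD DK Db [z [Dz xz]] y Dy; apply: joined_trans xz _.
  by apply: (joined_conn cD Dz Dy) => w Dw; apply: offM; [exact: Db|exact: DK].
Qed.

(** Iterating [sector_step] with radii 1/(n + 1) gives nested connected open subsets of the face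
    that shrink to the vertex, as [parc_nested] requires. The whole face is saturated for every
    radius and starts the iteration. *)
Lemma face_access (v : V) (p : T) : ~ K p -> closure (joined K p) (pp G v) ->
  exists q A, [/\ joined K p q, parc q (pp G v) A &
    forall z, A z -> z = pp G v \/ joined K p z].
Proof.
move=> np clp; pose r (n : nat) : R := n.+1%:R^-1.
have r0 n : 0 < r n.+1 <= r n.
  by rewrite /r invr_gt0 ltr0n /= lef_pV2 ?posrE ?ltr0n // ler_nat.
have ex (nS : nat * set T) : exists W : set T,
    [/\ nS.2 `<=` ~` K, closure nS.2 (pp G v) & saturated (pp G v) (r nS.1) nS.2] ->
    [/\ open W /\ connected W, W `<=` nS.2 /\ W !=set0,
    W `<=` ball (pp G v) (r nS.1.+1), closure W (pp G v) & saturated (pp G v) (r nS.1.+1) W].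
  case: nS => n E /=.
  have [[h1 h2 h3]|nh] := pselect [/\ E `<=` ~` K, closure E (pp G v) & saturated (pp G v) (r n) E].
    by have [W hW] := sector_step (r0 n) h1 h2 h3; exists W.
  by exists set0 => h; case: nh.
have [w wP] := choice ex.
pose f := fix f n := if n is m.+1 then w (m, f m) else joined K p.
have fP n : [/\ f n `<=` ~` K, closure (f n) (pp G v) & saturated (pp G v) (r n) (f n)].
  elim: n => [|n IH].
    split=> //; first by move=> z /joined_off.
    move=> D cD DK _ [z [Dz pz]] y Dy; apply: joined_trans pz _.
    exact: (joined_conn cD Dz Dy).
  have [_ [h1 _] _ h2 h3] := wP (n, f n) IH; split=> // z /h1.
  by case: IH => h _ _; exact: h.
have fS n := wP (n, f n) (fP n).
have sub0 : f 1%N `<=` joined K p by have [_ [+ _] _ _ _] := fS 0%N.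
have [||||||q [Uq [A pA hA]]] := @parc_nested R (fun n => f n.+1) (pp G v).
- by move=> n; case: (fS n) => -[].
- by move=> n; case: (fS n) => -[].
- by move=> n; case: (fS n) => _ [].
- by move=> n; case: (fS n.+1) => _ [].
- move=> n; case: (fP n.+1) => h _ _ /h; apply; left; exists v => //; exact: finset.in_setT.
- move=> e e0; pose N := Num.truncn (e^-1).
  have NE : r N < e.
    rewrite /r invf_plt ?posrE ?ltr0n //.
    by have /andP[] := truncn_itv (ltW (ltac:(by rewrite invr_gt0) : 0 < e^-1)).
  exists N => n Nn z; case: (fS n) => _ _ + _ _ => /[apply]; apply: le_ball.
  apply: le_trans (ltW NE); rewrite /r /= lef_pV2 ?posrE ?ltr0n // ler_nat.
  exact: leqW.
exists q, A; split=> //; first exact: sub0.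
by move=> z /hA[->|/sub0]; [left|right].
Qed.

Lemma face_link (u v : V) (p : T) : u != v -> ~ K p ->
  closure (joined K p) (pp G u) -> closure (joined K p) (pp G v) ->
  exists2 A, parc (pp G u) (pp G v) A & A `&` K `<=` [set pp G u; pp G v].
Proof.
move=> uv np clu clv.
have [a [A [pa_ pA hA]]] := face_access np clu.
have [b [B [pb pB hB]]] := face_access np clv.
have Ku : K (pp G u) by left; exists u => //; exact: finset.in_setT.
have Kv : K (pp G v) by left; exists v => //; exact: finset.in_setT.
have uv' : pp G u <> pp G v by move=> /pp_inj e; rewrite e eqxx in uv.
have oF : open (joined K p) by exact: face_open.
have cF : connected (joined K p) by exact: component_connected.
have ub : pp G u <> b by move=> e; apply: (joined_off pb); rewrite -e.
have [C pC hC] : exists2 C, parc (pp G u) b C & forall z, C z -> z = pp G u \/ joined K p z.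
  have [ab|ab] := pselect (a = b).
    by exists A; rewrite -?ab //; exact: parc_sym.
  have [D pD hD] := parc_open_connected oF cF pa_ pb ab.
  have [C pC hC] := parc_join (parc_sym pA) pD ub.
  by exists C => // z /hC[/hA|/hD]; [|right].
have [D pD hD] := parc_join pC pB uv'.
exists D => // z [/hD[/hC[]|/hB[]] +]; [by left| |by right|];
  by move=> /joined_off.
Qed.

End Access.

(** * Maximal plane graphs *)

(** The inequality amounts to (m - 3)(m - 4) <= 0. *)
Lemma bin2_le4 m : (3 < m)%N -> ('C(m, 2) + 6 <= 3 * m)%N -> m = 4%N.
Proof.
move=> m4; rewrite -(subnK m4); case: (m - 4)%N => // k.
suff : (3 * (k.+1 + 4) < 'C(k.+1 + 4, 2) + 6)%N by lia.
elim: k => // k IH; rewrite addSn binS bin1; lia.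
Qed.

Section MaximalPlane.
Variable R : realType.
Local Notation T := (R * R)%type.
Local Notation I01 := (`[0, 1]%classic : set R).
Variables (V : finType) (G : plane_graph R V).

Lemma bd_joined X F x y : joined (geo G X F) x y -> bd G X F x = bd G X F y.
Proof.
move=> xy; apply/setP => f; apply/idP/idP => /bdP[fF h]; apply/bdP; split=> // z /h;
  apply: closure_subset => w; apply: joined_trans => //; exact: joined_sym.
Qed.

Lemma edge_mid f : f \in pe G -> exists2 z, pa G f z & forall w, z <> pp G w.
Proof.
move=> fE; have [u [v [uv e]]] := edP fE; rewrite e in fE *.
have [g [[cg inj] g0 g1 gA]] := edge_param fE.
have h2 := half_in R; have h3 := half01 R.
exists (g (1/2)); first by rewrite -gA; exists (1/2).
move=> w e1; have : pa G (ed u v) (pp G w) by rewrite -gA -e1; exists (1/2).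
move=> /(pa_pt fE); rewrite !inE => /orP[]/eqP ew; move: e1; rewrite ew.
  by rewrite -g0 => /(inj _ _ h2 (i01_0 R)); lra.
by rewrite -g1 => /(inj _ _ h2 (i01_1 R)); lra.
Qed.

Lemma pa_ends f v : f \in pe G -> v \in f -> pa G f (pp G v).
Proof.
move=> fE; have [a [b [ab e]]] := edP fE; rewrite e in fE * => vf.
move: vf; rewrite !inE => /orP[]/eqP->.
  exact: parc_l (pa_arc fE).
exact: parc_r (pa_arc fE).
Qed.

(** If no boundary edge ended at [w], a small punctured ball around [w] would lie in the face; but
    the edge [f] enters that ball. *)
Lemma corner_edge (X : {set V}) (F : {set {set V}}) x w (f : {set V}) : F \subset pe G -> (forall f, f \in F -> f \subset X) ->
  ~ geo G X F x -> closure (joined (geo G X F) x) (pp G w) -> f \in F -> w \in f ->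
  exists2 f', f' \in bd G X F x & w \in f'.
Proof.
move=> FE FX nx clw fF wf; apply: contrapT => none.
have wX := fintype.subsetP (FX f fF) _ wf.
pose D := bd G X F x; have DE : D \subset pe G by apply: fintype.subset_trans FE; exact: bd_sub.
have cK1 : closed (geo G (X :\ w)%SET D) by exact: geo_closed.
have nw : ~ geo G (X :\ w)%SET D (pp G w).
  case=> [[v + /pp_inj e]|[g gD gw]]; first by rewrite !inE -e eqxx.
  by apply: none; exists g => //; apply: pa_pt gw; exact: (fintype.subsetP DE).
have [e e0 eb] := joined_closed_ball cK1 nw.
have off y : (ball (pp G w) e `\ pp G w) y -> ~ geo G X D y.
  move=> [yb yw] [[v vX yv]|[g gD gy]]; apply: (joined_off (eb y yb)); last by right; exists g.
  by left; exists v => //; rewrite !inE vX andbT; apply: contra_notN yw => /eqP <-.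
have [y [xy yb]] := clw _ (nbhsx_ballx (pp G w) e e0).
have inside z : (ball (pp G w) e `\ pp G w) z -> joined (geo G X F) x z.
  move=> zb; have yw : y <> pp G w by move=> yw; apply: (joined_off xy); left; exists w.
  rewrite -(bd_face FE FX nx); rewrite -(bd_face FE FX nx) in xy.
  by apply: joined_trans xy _; apply: (joined_conn (@punctured_ball_connected _ (pp G w) e)).
have fE := fintype.subsetP FE _ fF.
have [v [ef]] : exists v, f = ed w v.
  have [a [b [ab e1]]] := edP fE; move: wf; rewrite e1 !inE => /orP[]/eqP->; first by exists b.
  by exists a; rewrite finset.setUC.
rewrite ef in fE fF; have [g [ag g0 g1 gA]] := edge_param fE.
have [h [rest [[ch ih] h0 [hb _] _ [eA _]]]] := iarc_germ ag e0.
have I1 := i01_1 R.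
suff [h1 /inside /joined_off] : geo G X F (h 1) /\ (ball (pp G w) e `\ pp G w) (h 1) by [].
split; first by right; exists (ed w v) => //; rewrite -gA eA; left; exists 1.
rewrite -g0; split; first by apply: hb; exists 1.
by rewrite /= -h0 => /(ih _ _ I1 (i01_0 R)) /eqP; rewrite oner_eq0.
Qed.

Definition maximal_plane := forall u v, u != v -> ed u v \notin pe G ->
  ~ exists2 A, parc (pp G u) (pp G v) A &
    A `&` geo G [set: V] (pe G) `<=` [set pp G u; pp G v].

Hypotheses (hmax : maximal_plane) (V3 : (3 <= #|V|)%N).
Local Notation K := (geo G [set: V] (pe G)).
Local Notation bdK := (bd G [set: V] (pe G)).

Let EE : pe G \subset pe G := fintype.subxx _.
Let EX f (fE : f \in pe G) : f \subset [set: V]%SET := finset.subsetT f.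

Definition corners x := [set v | `[< closure (joined K x) (pp G v) >]]%SET.

Lemma cornersP x v : v \in corners x <-> closure (joined K x) (pp G v).
Proof. by rewrite inE; split => /asboolP. Qed.

Lemma corners_clique x u v : ~ K x -> u \in corners x -> v \in corners x -> u != v ->
  ed u v \in pe G.
Proof.
move=> nx /cornersP uc /cornersP vc uv; apply/negPn/negP => /(hmax uv); apply.
exact: face_link uv nx uc vc.
Qed.

Lemma bd_corners x f : f \in bdK x -> f \subset corners x.
Proof.
move=> /bdP[fE h]; apply/fintype.subsetP => v vf; apply/cornersP; apply: h.
exact: pa_ends.
Qed.

Lemma indE_pairs X : (#|indE G X| <= 'C(#|X|, 2))%N.
Proof.
rewrite -cards_draws; apply: subset_leq_card; apply/fintype.subsetP => f.
by rewrite !finset.in_set => /andP[/pe2 -> ->].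
Qed.

(** The corners form a clique, and a plane clique has at most four vertices. Four of them span a
    tight graph whose faces are triangles, so the fourth vertex is not on the boundary of the face
    around [x], against [corner_edge]. *)
Lemma corners_le3 x : ~ K x -> (#|corners x| <= 3)%N.
Proof.
move=> nx; rewrite leqNgt; apply/negP => W4; set W := corners x in W4.
have cW : #|indE G W| = 'C(#|W|, 2).
  rewrite -cards_draws; apply: eq_card => f; rewrite !finset.in_set andbC.
  have [fW|//] := boolP (f \subset W); apply/idP/eqP => [/pe2//|/eqP/cards2P[u [v [uv e]]]].
  move: fW; rewrite e finset.subUset !finset.sub1set => /andP[uW vW].
  by rewrite andTb; exact: (corners_clique nx).
have [hA _] := @indE_faces _ _ G W (ltnW W4).
have W44 : #|W| = 4%N.
  by apply: bin2_le4 => //; rewrite -cW.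
have tight : (3 * #|W| <= #|indE G W| + 6)%N by rewrite cW W44.
have [I [s [t [[s1 s2 s3] _ tP _]]]] := tight_faces W4 tight.
have sub : geo G W (indE G W) `<=` K by apply: geo_sub; [exact: finset.subsetT|exact: indE_pe].
have nx' : ~ geo G W (indE G W) x by move=> /sub.
have [k kx] := s3 x nx'; have [/cycles3P[t3 _] tW e] := tP k.
rewrite (bd_joined kx) in e.
have [w wW wt] : exists2 w, w \in W & w \notin t k.
  by apply/subsetPn; apply/negP => /subset_leq_card; rewrite W44 t3.
have [u uW uw] : exists2 u, u \in W & u != w.
  have /card_gt0P[u] : (0 < #|W :\ w|)%N by have := cardsD1 w W; rewrite wW W44; lia.
  by rewrite finset.in_setD1 => /andP[? ?]; exists u.
have [|||f' + wf'] := @corner_edge W (indE G W) x w (ed w u) (@indE_pe _ _ G W) (@indE_sub _ _ G W) nx'.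
- move/cornersP: wW; apply: closure_subset => z; exact: joined_sub.
- rewrite finset.in_set finset.subUset !finset.sub1set wW uW andbT.
  by rewrite andbT; apply: (corners_clique nx wW uW); rewrite eq_sym.
- by rewrite !inE eqxx.
by rewrite e => /indE_sub/fintype.subsetP/(_ _ wf'); rewrite (negbTE wt).
Qed.

Lemma bd_le3 x : ~ K x -> (#|bdK x| <= 3)%N.
Proof.
move=> nx; have h : bdK x \subset indE G (corners x).
  apply/fintype.subsetP => f fb; rewrite inE bd_corners // andbT.
  by case/bdP: fb.
apply: leq_trans (subset_leq_card h) _; apply: leq_trans (indE_pairs _) _.
by move: (corners_le3 nx); case: #|_| => [|[|[|[|]]]].
Qed.

Lemma corner_exists x z : ~ K x -> K z -> closure (joined K x) z ->
  exists v, v \in corners x /\ (z = pp G v \/ exists2 f, f \in pe G & pa G f z /\ v \in f).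
Proof.
move=> nx Kz clz; have [[w zw]|/forallNP zw] := pselect (exists w, z = pp G w).
  by exists w; split; [apply/cornersP; rewrite -zw|left].
case: Kz => [[w _ e]|[f fE fz]]; first by case: (zw w).
have fb := touch EE nx fE fz zw clz.
have [u [v [uv e]]] := edP fE; have uf : u \in f by rewrite e !inE eqxx.
exists u; split; first exact: (fintype.subsetP (bd_corners fb)).
by right; exists f.
Qed.

(** Otherwise a segment between two parts of the graph contains a subarc that runs from one part to
    the other and is off the drawing in between. The face around it has corners in both parts, and
    these are adjacent by [corners_clique]. *)
Lemma gconn_all u v : gconn (pe G) u v.
Proof.
apply/negPn/negP => nuv.
pose X1 := [set w | gconn (pe G) u w]%SET; pose X2 := (~: X1)%SET.
have inX1 f w w' : f \in pe G -> w \in f -> w' \in f -> w \in X1 -> w' \in X1.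
  move=> fE wf wf'; rewrite !inE => h; have [->//|ww] := eqVneq w' w.
  apply: gconn_trans h _; apply: connect1; rewrite (_ : ed w w' = f)//.
  apply/eqP; rewrite eqEcard cards2 eq_sym ww (pe2 fE) leqnn andbT.
  by rewrite finset.subUset !finset.sub1set wf.
pose K1 := geo G X1 (indE G X1); pose K2 := geo G X2 (indE G X2).
have KK : K `<=` K1 `|` K2.
  move=> z [[w _ zw]|[f fE fz]].
    by have [wX|wX] := boolP (w \in X1); [left|right]; left; exists w; rewrite // finset.in_setC.
  have [a [b [ab e]]] := edP fE; have af : a \in f by rewrite e !inE eqxx.
  have [aX|aX] := boolP (a \in X1); [left|right]; right; exists f => //; rewrite finset.in_set fE /=;
    apply/fintype.subsetP => w wf; first exact: (inX1 f a).
  by rewrite finset.in_setC; apply: contra aX; exact: (inX1 f w a).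
have s1 : K1 `<=` K by apply: geo_sub; [exact: finset.subsetT|exact: indE_pe].
have s2 : K2 `<=` K by apply: geo_sub; [exact: finset.subsetT|exact: indE_pe].
have cl1 : closed K1 by apply: geo_closed; exact: indE_pe.
have cl2 : closed K2 by apply: geo_closed; exact: indE_pe.
have d12 z : K1 z -> ~ K2 z.
  have aux w : w \in X1 -> ~ K2 (pp G w).
    by move=> wX1 /(geo_pp (@indE_pe _ _ G _) (@indE_sub _ _ G _)); rewrite finset.in_setC wX1.
  case=> [[w wX ->]|[f fF fz]]; first exact: aux.
  have fX := indE_sub fF; have fE := fintype.subsetP (@indE_pe _ _ G _) _ fF.
  case=> [[w wX2 zw]|[f' fF' fz']].
    move: wX2; rewrite finset.in_setC => /negP; apply; apply: (fintype.subsetP fX).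
    by apply: (pa_pt fE); rewrite -zw.
  have fX' := indE_sub fF'; have fE' := fintype.subsetP (@indE_pe _ _ G _) _ fF'.
  have ff : f != f'.
    apply: contraTneq fX => ->; have [a [b [ab e]]] := edP fE'.
    have af : a \in f' by rewrite e !inE eqxx.
    apply/subsetPn; exists a => //; have := fintype.subsetP fX' _ af.
    by rewrite finset.in_setC.
  have [w [_ /(fintype.subsetP fX) h1 /(fintype.subsetP fX')]] := pa_cross_pt fE fE' ff fz fz'.
  by rewrite finset.in_setC h1.
have uX1 : u \in X1 by rewrite inE; exact: gconn0.
have vX2 : v \in X2 by rewrite !inE.
have K1u : K1 (pp G u) by left; exists u.
have K2v : K2 (pp G v) by left; exists v.
have uv : pp G u <> pp G v by move=> /pp_inj e; rewrite e gconn0 in nuv.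
have pS := parc_segment uv; set S := (X in parc _ _ X) in pS.
(* Stop at the first point on [K2], then return from it to the first point on [K1]; the piece in
   between meets the drawing only at its ends. *)
have [q [B1 [K2q pB1 B1S hB1]]] := parc_travel pS cl2 (parc_l pS) (d12 _ K1u)
  (ex_intro _ (pp G v) (conj (parc_r pS) K2v)).
have [q' [B2 [K1q' pB2 B2B hB2]]] := parc_travel pB1 cl1 (parc_r pB1) (fun h => d12 _ h K2q)
  (ex_intro _ (pp G u) (conj (parc_l pB1) K1u)).
have [g [ag g0 g1 gA]] := pB2.
have Kg : K `&` (g @` I01) `<=` [set g 0; g 1].
  rewrite gA g0 g1 => z [/KK[h|h] hz]; first by right; apply: hB2.
  by left; apply: hB1; split=> //; exact: B2B.
pose x := g (1/2); have nx : ~ K x := arc_int_off ag Kg (half01 R).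
have clx : g @` I01 `<=` closure (joined K x).
  apply: iarc_closed => //; first exact: closed_closure.
  by move=> t t01; apply: subset_closure; apply: (arc_int_joined ag Kg (half01 R) t01).
have [w2 [w2c w2q]] : exists w, w \in corners x /\ w \in X2.
  have [||w [wc hw]] := @corner_exists x q nx; first exact: s2.
    by apply: clx; rewrite gA; exact: parc_l pB2.
  exists w; split=> //; rewrite finset.in_setC; apply/negP => wX1.
  case: hw => [e|[f fE [fq wf]]].
    by apply: (d12 q) => //; left; exists w.
  apply: (d12 q) => //; right; exists f => //; rewrite finset.in_set fE.
  by apply/fintype.subsetP => w' wf'; exact: (inX1 f w w').
have [w1 [w1c w1q]] : exists w, w \in corners x /\ w \in X1.
  have [||w [wc hw]] := @corner_exists x q' nx; first exact: s1.
    by apply: clx; rewrite gA; exact: parc_r pB2.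
  exists w; split=> //; apply/negPn/negP => wX1.
  case: hw => [e|[f fE [fq wf]]].
    by apply: (d12 q') => //; left; exists w; rewrite // finset.in_setC.
  apply: (d12 q') => //; right; exists f => //; rewrite finset.in_set fE.
  apply/fintype.subsetP => w' wf'; rewrite finset.in_setC; apply: contra wX1; exact: (inX1 f w' w).
have w12 : w1 != w2 by apply: contraTneq w1q => ->; rewrite -finset.in_setC.
have e12 := corners_clique nx w1c w2c w12.
move: w2q; rewrite finset.in_setC => /negP; apply.
by apply: (inX1 _ w1 w2 e12) => //; rewrite !inE eqxx ?orbT.
Qed.

Lemma edge_face (I : finType) (s : I -> T) f : faces K s -> f \in pe G ->
  exists i, f \in bdK (s i).
Proof.
move=> [s1 s2 s3] fE; have [u [v [g [e ag g0 g1 [gA cK0 KA KE]]]]] := split_edge [set: V]%SET EE fE.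
set K0 := geo G [set: V]%SET (pe G :\ f)%SET in cK0 KA KE.
have [c fc cw] := edge_mid fE.
have nc : ~ K0 c.
  move=> h; have : (K0 `&` g @` I01) c by split=> //; rewrite gA.
  by move=> /KA; rewrite g0 g1 => -[]; exact: cw.
pose S := [set y | joined K0 c y /\ ~ pa G f y].
have oF : open (joined K0 c) by apply: face_open; exact: compact_closedP.
have clS : closure S c.
  move=> U nU; have [W [oW Wc] WU] : exists2 W : set T, open W /\ W c & W `<=` U.
    by move: nU; rewrite nbhsE => -[W [? ?] ?]; exists W.
  have fE' := fE; rewrite e in fE'.
  have [y [cy Wy] ny] := parc_interior (pa_arc fE') (openI oF oW) (conj (joined_refl nc) Wc).
  by exists y; split; [split=> //; rewrite e|exact: WU].
have [|p pL clp] := @closure_fin_cover _ S [seq s i | i <- enum I] (joined K) c clS.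
  move=> y [cy ny]; have nKy : ~ K y.
    by rewrite KE gA => -[|//]; exact: joined_off cy.
  by have [i iy] := s3 y nKy; exists (s i) => //; apply/mapP; exists i; rewrite ?mem_enum.
have [i _ ep] := mapP pL; exists i; apply: (touch EE (s1 i) fE fc cw).
by rewrite -ep; apply: closure_subset clp => z [].
Qed.

(** An edge on a cycle has two sides by [edge_splits]. At a bridge, a third corner of an adjacent
    face would be adjacent to both ends and close a cycle. So that face has no other boundary edge,
    and since one edge does not separate, it contains everything off that edge and the vertices. But
    a further edge exists, as the graph is connected with at least three vertices. *)
Lemma edge_two_faces (I : finType) (s : I -> T) f : faces K s -> f \in pe G ->
  (2 <= #|[set i | f \in bdK (s i)]%SET|)%N.
Proof.
move=> hs fE; have [s1 s2 s3] := hs.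
have [u [v [g [e ag g0 g1 [gA cK0 KA KE]]]]] := split_edge [set: V]%SET EE fE.
have F'E : (pe G :\ f)%SET \subset pe G by exact: subD1set.
have uv : u != v by rewrite e in fE; exact: ed_neq fE.
have [guv|nuv] := boolP (gconn (pe G :\ f)%SET u v).
  have [B pB BK] : exists2 B, parc (g 0) (g 1) B & B `<=` geo G [set: V]%SET (pe G :\ f)%SET.
    by rewrite g0 g1; case: (gconn_parc [set: V]%SET F'E guv) => // e'; rewrite e' eqxx in uv.
  have [x [y [nx ny nxy clx cly]]] := edge_splits cK0 ag KA pB BK.
  rewrite -KE in nx ny nxy clx cly.
  have c01 := half01 R; have nc := arc_int_off ag KA c01.
  have fc : pa G f (g (1/2)) by rewrite -gA; exists (1/2) => //; exact: half_in.
  have cw w : g (1/2) <> pp G w.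
    by move=> ew; apply: nc; left; exists w; rewrite ?finset.in_setT.
  have [i ix] := s3 x nx; have [j jy] := s3 y ny.
  apply/card_gt1P; exists i, j; split.
  - rewrite finset.in_set (bd_joined ix); exact: (touch EE nx fE fc cw clx).
  - rewrite finset.in_set (bd_joined jy); exact: (touch EE ny fE fc cw cly).
  - apply: contra_notN nxy => /eqP ij; apply: joined_trans (joined_sym ix) _.
    by rewrite ij.
exfalso; have [i fi] := edge_face hs fE; have nx := s1 i; set x := s i in fi nx.
have /fintype.subsetP fc := bd_corners fi.
have uc : u \in corners x by apply: fc; rewrite e !inE eqxx.
have vc : v \in corners x by apply: fc; rewrite e !inE eqxx orbT.
have cuv w : w \in corners x -> w \in f.
  move=> wc; rewrite e !inE; have [//|wu] := eqVneq w u; have [//|wv] := eqVneq w v.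
  exfalso; move/negP: nuv; apply; apply: (@gconn_trans _ _ w); apply: connect1;
    rewrite finset.in_setD1.
  - rewrite (corners_clique nx uc wc) ?andbT; last by rewrite eq_sym.
    by rewrite e; apply: (neq_mem (w := w)); rewrite !inE ?eqxx ?orbT // negb_or wu wv.
  - rewrite (corners_clique nx wc vc) ?andbT //.
    by rewrite e; apply: (neq_mem (w := w)); rewrite !inE ?eqxx // negb_or wu wv.
have bf h : h \in bdK x -> h = f.
  move=> hb; have hE : h \in pe G by case/bdP: hb.
  apply/eqP; rewrite eqEcard (pe2 hE) (pe2 fE) leqnn andbT.
  by apply/fintype.subsetP => w wh; apply: cuv; exact: (fintype.subsetP (bd_corners hb)).
have [w wf] : exists w, w \notin f.
  apply/existsP; rewrite -negb_forall; apply: contraL V3 => /forallP h.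
  by rewrite -leqNgt -(pe2 fE); apply: subset_leq_card; apply/fintype.subsetP => w _; exact: h.
have [a wa] : exists a, ed w a \in pe G.
  apply: (@gconn_step _ _ _ u _ (gconn_all w u)).
  by apply: contraNneq wf => ->; rewrite e !inE eqxx.
have waf : ed w a != f by apply: (neq_mem (w := w)); rewrite // !inE eqxx.
have [m wm mw] := edge_mid wa.
have DE : bdK x \subset pe G by exact: bd_sub.
have nm : ~ geo G [set: V]%SET (bdK x) m.
  case=> [[w' _ ew]|[h /bf -> hm]]; first by case: (mw w').
  by have [w' [ew _ _]] := pa_cross_pt wa fE waf wm hm; case: (mw w').
have nx' : ~ geo G [set: V]%SET (bdK x) x.
  by move=> h; apply: nx; apply: geo_sub h.
have [I' [s' [Tr [hs' _ _ hsmall]]]] := euler DE (fun h _ => finset.subsetT h).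
have D1 : (#|bdK x| <= 1)%N.
  by rewrite -(cards1 f); apply: subset_leq_card; apply/fintype.subsetP => h /bf ->; rewrite inE.
have I1 : (#|I'| <= 1)%N by case: hsmall => [->//|h]; apply: leq_trans (ltnW h) D1.
have := faces1 hs' I1 nx' nm; rewrite (bd_face EE EX nx) => /joined_off; apply.
by right; exists (ed w a).
Qed.

(** The two inequalities in the proof of [indE_faces] hold here in the opposite direction, and
    connectivity leaves only one component in Euler's formula. *)
Theorem maximal_tight : (3 * #|V| <= #|pe G| + 6)%N.
Proof.
have [I [s [Tr [hs [hT1 hT2 hT3] hcard _]]]] := euler EE EX.
have [s1 s2 s3] := hs.
have T1 : (#|Tr| <= 1)%N.
  apply/card_le1_eqP => a b aT bT; apply: hT2 => //; exact: gconn_all.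
have := bd_sum G [set: V]%SET (pe G) s.
have cI : (\sum_(i : I) 3)%N = (#|I| * 3)%N by rewrite sum_nat_const.
have cE : (\sum_(f in pe G) 2)%N = (#|pe G| * 2)%N by rewrite sum_nat_const.
set S := (\sum_(i : I) _)%N => eS.
have S1 : (S <= #|I| * 3)%N by rewrite -cI; apply: leq_sum => i _; exact: bd_le3.
have S2 : (#|pe G| * 2 <= S)%N.
  by rewrite -cE eS; apply: leq_sum => f fE; exact: edge_two_faces.
rewrite cardsT in hcard; clearbody S.
move: hcard T1 S1 S2; clear; lia.
Qed.

End MaximalPlane.

(** * Stereographic projection *)

Section Stereographic.
Variable R : realType.
Local Notation T := (R * R)%type.
Local Notation S := 'rV[R]_3.
Local Notation I01 := (`[0, 1]%classic : set R).

Definition row3 (a b c : R) : S := \row_i [:: a; b; c]`_i.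
Local Notation x0 x := ((x : S) 0 0).
Local Notation x1 x := ((x : S) 0 1).
Local Notation x2 x := ((x : S) 0 2%:R).
Local Notation north := (row3 0 0 1).

Lemma row3_eq (x y : S) : x0 x = x0 y -> x1 x = x1 y -> x2 x = x2 y -> x = y.
Proof.
move=> h0 h1 h2; apply/rowP => -[[|[|[|//]]] h].
- by have -> : Ordinal h = 0 by exact: val_inj.
- by have -> : Ordinal h = 1 by exact: val_inj.
- by have -> : Ordinal h = 2%:R by exact: val_inj.
Qed.

Lemma row3_split a b c : row3 a b c = a *: row3 1 0 0 + b *: row3 0 1 0 + c *: row3 0 0 1.
Proof. by apply: row3_eq; rewrite !mxE /= !mulr0 ?mulr1 ?addr0 ?add0r. Qed.

Lemma sphere2E (x : S) : sphere2 x <-> x0 x ^+ 2 + x1 x ^+ 2 + x2 x ^+ 2 = 1.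
Proof.
rewrite /sphere2 /= !big_ord_recl big_ord0 addr0 addrA.
have -> : lift ord0 ord0 = 1 :> 'I_3 by exact: val_inj.
by have -> : lift ord0 (lift ord0 ord0) = 2%:R :> 'I_3 by exact: val_inj.
Qed.

(* [mirror N] is the reflection that exchanges N and the north pole; when N is the
   north pole, division by zero makes the coefficient vanish and it is the identity. *)
Definition mirror_coef (N x : S) :=
  (x0 N * x0 x + x1 N * x1 x + (x2 N - 1) * x2 x) / (1 - x2 N).

Definition mirror (N x : S) : S := x - mirror_coef N x *: (N - north).

Section Pole.
Variable N : S.
Hypothesis SN : sphere2 N.

Lemma mirror0 x : x0 (mirror N x) = x0 x - mirror_coef N x * x0 N.
Proof. by rewrite !mxE /= subr0. Qed.
Lemma mirror1 x : x1 (mirror N x) = x1 x - mirror_coef N x * x1 N.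
Proof. by rewrite !mxE /= subr0. Qed.
Lemma mirror2 x : x2 (mirror N x) = x2 x - mirror_coef N x * (x2 N - 1).
Proof. by rewrite !mxE /=. Qed.

Lemma mirror_coefN x : mirror_coef N (mirror N x) = - mirror_coef N x.
Proof.
rewrite {1}/mirror_coef mirror0 mirror1 mirror2; set k := mirror_coef N x.
have [e|ne] := eqVneq (1 - x2 N) 0; first by rewrite /k /mirror_coef e invr0 !mulr0 oppr0.
have ek : k * (1 - x2 N) = x0 N * x0 x + x1 N * x1 x + (x2 N - 1) * x2 x.
  by rewrite /k /mirror_coef mulfVK.
apply: (mulIf ne); rewrite mulfVK // mulNr ek.
move/sphere2E: SN => hN.
(* The squared length of [N - north], which makes the map a reflection. *)
have e2 : x0 N ^+ 2 + x1 N ^+ 2 + (x2 N - 1) ^+ 2 = 2 * (1 - x2 N) by rewrite sqrrB1; lra.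
transitivity (k * (1 - x2 N) - k * (x0 N ^+ 2 + x1 N ^+ 2 + (x2 N - 1) ^+ 2)).
  by rewrite ek; ring.
by rewrite e2 -ek; ring.
Qed.

Lemma mirrorK x : mirror N (mirror N x) = x.
Proof. by rewrite {1}/mirror mirror_coefN scaleNr opprK subrK. Qed.

Lemma mirror_pole : mirror N N = north.
Proof.
rewrite /mirror /mirror_coef; move/sphere2E: SN => hN.
have [e|ne] := eqVneq (1 - x2 N) 0.
  rewrite e invr0 mulr0 scale0r subr0; apply: row3_eq; rewrite mxE /=; nra.
rewrite (_ : _ / _ = 1); first by rewrite scale1r opprB addrC subrK.
by apply: (mulIf ne); rewrite mulfVK //; lra.
Qed.

Lemma mirror_sphere x : sphere2 x -> sphere2 (mirror N x).
Proof.
move=> /sphere2E hx; apply/sphere2E; rewrite mirror0 mirror1 mirror2.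
set k := mirror_coef N x; move/sphere2E: SN => hN.
have [e|ne] := eqVneq (1 - x2 N) 0.
  by rewrite /k /mirror_coef e invr0 !mulr0 !mul0r !subr0.
have ek : k * (1 - x2 N) = x0 N * x0 x + x1 N * x1 x + (x2 N - 1) * x2 x.
  by rewrite /k /mirror_coef mulfVK.
have e2 : x0 N ^+ 2 + x1 N ^+ 2 + (x2 N - 1) ^+ 2 = 2 * (1 - x2 N) by rewrite sqrrB1; lra.
transitivity (x0 x ^+ 2 + x1 x ^+ 2 + x2 x ^+ 2 -
   2 * k * (x0 N * x0 x + x1 N * x1 x + (x2 N - 1) * x2 x) +
   k ^+ 2 * (x0 N ^+ 2 + x1 N ^+ 2 + (x2 N - 1) ^+ 2)); first by ring.
by rewrite hx e2 -ek; ring.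
Qed.

Definition stereo (x : S) : T :=
  (x0 (mirror N x) / (1 - x2 (mirror N x)), x1 (mirror N x) / (1 - x2 (mirror N x))).

Definition unstereo (p : T) : S :=
  mirror N (row3 (2 * p.1 / (1 + p.1 ^+ 2 + p.2 ^+ 2)) (2 * p.2 / (1 + p.1 ^+ 2 + p.2 ^+ 2))
     ((p.1 ^+ 2 + p.2 ^+ 2 - 1) / (1 + p.1 ^+ 2 + p.2 ^+ 2))).

Let den (p : T) : 1 + p.1 ^+ 2 + p.2 ^+ 2 != 0.
Proof. by rewrite gt_eqF // -addrA ltr_pwDl // addr_ge0 ?sqr_ge0. Qed.

Lemma unstereo_sphere p : sphere2 (unstereo p).
Proof.
apply: mirror_sphere; apply/sphere2E; rewrite !mxE /=; have := den p; move=> h; field.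
exact: h.
Qed.

Lemma stereoK p : stereo (unstereo p) = p.
Proof.
rewrite /stereo mirrorK !mxE /=; have h := den p; case: p h => a b /= h.
by congr pair; field; rewrite h /= (_ : _ - _ = 2) ?pnatr_eq0 //; ring.
Qed.

Lemma mirror_pole_neq x : sphere2 x -> x <> N -> 1 - x2 (mirror N x) != 0.
Proof.
move=> sx xN; apply/eqP => e; apply: xN.
rewrite -[x]mirrorK -[RHS]mirrorK mirror_pole; congr mirror.
have /sphere2E h := mirror_sphere sx.
by apply: row3_eq; rewrite [RHS]mxE /=; nra.
Qed.

Lemma unstereoK x : sphere2 x -> x <> N -> unstereo (stereo x) = x.
Proof.
move=> sx xN; rewrite /unstereo -[RHS]mirrorK; congr mirror.
have h := mirror_pole_neq sx xN; have /sphere2E := mirror_sphere sx.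
rewrite /stereo /=; set y := mirror N x in h *; move=> e.
have es : (x0 y / (1 - x2 y)) ^+ 2 + (x1 y / (1 - x2 y)) ^+ 2 = (1 + x2 y) / (1 - x2 y).
  have ab : x0 y ^+ 2 + x1 y ^+ 2 = (1 - x2 y) * (1 + x2 y) by lra.
  by rewrite !exprMn -mulrDl ab; field.
rewrite -!(addrA 1) es.
have ed : 1 + (1 + x2 y) / (1 - x2 y) = 2 / (1 - x2 y) by field.
have ed' : (1 + x2 y) / (1 - x2 y) - 1 = 2 * x2 y / (1 - x2 y) by field.
rewrite ed ed'; apply: row3_eq; rewrite mxE /=; field; exact: h.
Qed.

Lemma row3_continuous (X : topologicalType) (F : set_system X) (f g h : X -> R) (a b c : R) :
  Filter F -> f @ F --> a -> g @ F --> b -> h @ F --> c ->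
  (fun x => row3 (f x) (g x) (h x)) @ F --> row3 a b c.
Proof.
move=> FF fa gb hc; rewrite row3_split.
rewrite (_ : (fun x => _) = (fun x => f x *: row3 1 0 0 + g x *: row3 0 1 0 + h x *: row3 0 0 1)).
  by apply: cvgD; [apply: cvgD|]; apply: cvgZ => //; exact: cvg_cst.
by apply/funext => x; exact: row3_split.
Qed.

Lemma crd_cvg (X : topologicalType) (F : set_system X) (f : X -> S) (a : S) i :
  Filter F -> f @ F --> a -> (fun x => f x 0 i) @ F --> a 0 i.
Proof. by move=> FF fa; apply: (continuous_cvg _ (@coord_continuous _ _ _ 0 i a) fa). Qed.

Lemma mirror_cvg (X : topologicalType) (F : set_system X) (f : X -> S) (a : S) :
  Filter F -> f @ F --> a -> (fun x => mirror N (f x)) @ F --> mirror N a.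
Proof.
move=> FF fa; apply: cvgB => //; apply: cvgZ; last exact: cvg_cst.
apply: cvgM; last exact: cvg_cst.
by apply: cvgD; [apply: cvgD|]; apply: cvgM; (try exact: cvg_cst); exact: crd_cvg.
Qed.

Lemma unstereo_cvg (X : topologicalType) (F : set_system X) (f : X -> T) (p : T) :
  Filter F -> f @ F --> p -> (fun x => unstereo (f x)) @ F --> unstereo p.
Proof.
move=> FF fp; apply: mirror_cvg.
have c1 : (fun x => (f x).1) @ F --> p.1 by apply: cvg_comp fp _; exact: cvg_fst.
have c2 : (fun x => (f x).2) @ F --> p.2 by apply: cvg_comp fp _; exact: cvg_snd.
have s1 : (fun x => (f x).1 ^+ 2) @ F --> p.1 ^+ 2 by exact: (cvgM c1 c1).
have s2 : (fun x => (f x).2 ^+ 2) @ F --> p.2 ^+ 2 by exact: (cvgM c2 c2).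
have cd : (fun x => (1 + (f x).1 ^+ 2 + (f x).2 ^+ 2)^-1) @ F --> (1 + p.1 ^+ 2 + p.2 ^+ 2)^-1.
  by apply: cvgV; [exact: den|apply: cvgD => //; apply: cvgD => //; exact: cvg_cst].
apply: row3_continuous; apply: cvgM => //.
- by apply: cvgM => //; exact: cvg_cst.
- by apply: cvgM => //; exact: cvg_cst.
- by apply: cvgB; [exact: cvgD|exact: cvg_cst].
Qed.

Lemma unstereo_continuous : continuous unstereo.
Proof. by move=> p; exact: (@unstereo_cvg _ (nbhs p) id p). Qed.

Lemma stereo_cont : cont_on ([set x | sphere2 x] `\ N) stereo.
Proof.
have c0 x : mirror N @ within ([set x | sphere2 x] `\ N) (nbhs x) --> mirror N x.
  by apply: (@mirror_cvg _ _ id); exact: cvg_within.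
have cd x : sphere2 x -> x <> N ->
    (fun y => (1 - x2 (mirror N y))^-1) @ within ([set x | sphere2 x] `\ N) (nbhs x) -->
    (1 - x2 (mirror N x))^-1.
  move=> sx xN; apply: cvgV; first exact: mirror_pole_neq.
  by apply: cvgB; [exact: cvg_cst|exact: crd_cvg].
by apply: cont_on_pair => x [sx xN]; apply: cvgM; (try exact: crd_cvg); exact: cd.
Qed.

End Pole.

(** In the chart [psi] from the north pole, points and arcs are closed with empty interior, since no
    open set of the plane embeds in a point or an arc. Finite unions keep this property, so the
    drawing does not cover the sphere. *)
Lemma sphere_off_arcs (V : finType) (P : sphere_graph R V) : exists N : S,
  [/\ sphere2 N, forall v, N <> vertex_point P v &
      forall f, f \in edges P -> ~ edge_arc P f N].
Proof.
have Sn : sphere2 north by apply/sphere2E; rewrite !mxE /= expr0n expr1n /= !add0r.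
pose psi := unstereo north.
have cpsi : continuous psi := @unstereo_continuous north.
have ipsi p q : psi p = psi q -> p = q by move=> e; rewrite -(stereoK Sn p) -/psi -/(psi p) e stereoK.
pose bad (Y : set S) := closed (psi @^-1` Y) /\ forall (U : set T) x, open U -> U x -> exists2 y, U y & ~ Y (psi y).
have bad0 : bad set0.
  by split; [rewrite preimage_set0; exact: closed0|move=> U x _ Ux; exists x].
have badU Y Z : bad Y -> bad Z -> bad (Y `|` Z).
  move=> [cY hY] [cZ hZ]; split; first by rewrite preimage_setU; exact: closedU.
  move=> U x oU Ux; have [y Uy nY] := hY U x oU Ux.
  have oU' : open (U `&` ~` (psi @^-1` Y)) by apply: openI => //; exact: closed_openC.
  have [z [Uz nYz] nZ] := hZ _ y oU' (conj Uy nY).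
  by exists z => // -[].
have bad_arc p q A : simple_arc p q A -> bad A.
  move=> [g [cg ig _ _ gA]].
  have cg' : cont_on I01 g by apply/cont_onP.
  have ig' s t : I01 s -> I01 t -> g s = g t -> s = t.
    by move=> Is It e; apply: ig => //; rewrite inE.
  have cA : compact A by rewrite -gA; apply: compact_image => //; exact: compact01.
  split.
    apply: preimage_closed; last by apply: compact_closed => //; exact: norm_hausdorff.
    by move=> z _; exact: cpsi.
  move=> U x oU Ux; apply: contrapT => H.
  have UA y : U y -> (g @` I01) (psi y).
    by move=> Uy; rewrite gA; apply: contrapT => nA; apply: H; exists y.
  have [h ch hK] := inverse_cont (@compact01 R) (@norm_hausdorff _ _) cg' ig'.
  apply: (@plane_not_line _ U x (h \o psi) oU Ux).
    by apply: (@cont_on_comp T S R U (g @` I01) psi h) => //; exact: continuous_cont_on.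
  move=> y z /UA[s Is es] /UA[t It et] /=; rewrite -es -et !hK // => st.
  by apply: ipsi; rewrite -es -et st.
have bad_pt a : bad [set a].
  split.
    apply: preimage_closed; last by apply: compact_closed; [exact: norm_hausdorff|exact: compact_set1].
    by move=> z _; exact: cpsi.
  move=> U x oU Ux; apply: contrapT => H.
  have Ua y : U y -> psi y = a by move=> Uy; apply: contrapT => nA; apply: H; exists y.
  apply: (@plane_not_line _ U x (fun=> 0) oU Ux).
    by apply: continuous_cont_on => z; exact: cvg_cst.
  by move=> y z /Ua ey /Ua ez _; apply: ipsi; rewrite ey ez.
have bad_seq (I : eqType) (l : seq I) (Y : I -> set S) : (forall i, i \in l -> bad (Y i)) ->
    bad [set z | exists2 i, i \in l & Y i z].
  elim: l => [|a l IH] hl.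
    rewrite (_ : [set z | _] = set0) //; by apply/seteqP; split => z // -[].
  rewrite (_ : [set z | _] = Y a `|` [set z | exists2 i, i \in l & Y i z]).
    apply: badU; first by apply: hl; rewrite mem_head.
    by apply: IH => i il; apply: hl; rewrite in_cons il orbT.
  apply/seteqP; split => z.
    by case=> i; rewrite in_cons => /orP[/eqP ->|il] h; [left|right; exists i].
  by case=> [h|[i il h]]; [exists a; rewrite ?mem_head|exists i; rewrite // in_cons il orbT].
have [_ h] : bad ([set z | exists2 v, v \in enum V & [set vertex_point P v] z] `|`
     [set z | exists2 f, f \in enum (edges P) & edge_arc P f z]).
  apply: badU; apply: bad_seq => // f; rewrite mem_enum => fE.
  have /cards2P[u [v [uv e]]] : #|f| == 2 by rewrite (edges_card2 fE).
  by rewrite e; apply: bad_arc; apply: arc_simple; rewrite -e.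
have [y _ ny] := h setT 0 openT I.
exists (psi y); split.
- exact: unstereo_sphere.
- by move=> v e; apply: ny; left; exists v; rewrite ?mem_enum.
- by move=> f fE e; apply: ny; right; exists f; rewrite ?mem_enum.
Qed.

(** * From the sphere to the plane and back *)

Section Transfer.
Variables (V : finType) (P : sphere_graph R V) (N : S).
Hypotheses (SN : sphere2 N) (NV : forall v, N <> vertex_point P v).
Hypothesis NE : forall f, f \in edges P -> ~ edge_arc P f N.
Local Notation phi := (stereo N).
Local Notation psi := (unstereo N).

Lemma edge_off f z : f \in edges P -> edge_arc P f z -> sphere2 z /\ z <> N.
Proof.
move=> fE fz; split; first exact: arc_sphere fz.
by move=> e; apply: (NE fE); rewrite -e.
Qed.

Lemma psi_phi_edge f z : f \in edges P -> edge_arc P f z -> psi (phi z) = z.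
Proof. by move=> fE /(edge_off fE)[? ?]; exact: unstereoK. Qed.

Lemma psi_phi_vertex v : psi (phi (vertex_point P v)) = vertex_point P v.
Proof. by apply: unstereoK => //; [exact: point_sphere|exact/nesym/NV]. Qed.

Lemma plane_point_inj : injective (fun v => phi (vertex_point P v)).
Proof.
by move=> u v /(congr1 psi); rewrite !psi_phi_vertex => /point_inj.
Qed.

Lemma plane_arc u v : ed u v \in edges P ->
  parc (phi (vertex_point P u)) (phi (vertex_point P v)) (phi @` edge_arc P (ed u v)).
Proof.
move=> uvE; have [g [cg ig g0 g1 gA]] := arc_simple uvE.
have gE t : I01 t -> edge_arc P (ed u v) (g t) by move=> It; rewrite -gA; exists t.
exists (phi \o g); split.
- split.
    apply: (@cont_on_comp R S T I01 ([set x | sphere2 x] `\ N) g phi).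
    + by move=> t /gE/(edge_off uvE)[? ?].
    + exact/cont_onP.
    + exact: stereo_cont.
  move=> s t Is It /= /(congr1 psi).
  rewrite (psi_phi_edge uvE (gE s Is)) (psi_phi_edge uvE (gE t It)) => e.
  by apply: ig => //; rewrite inE.
- by rewrite /= g0.
- by rewrite /= g1.
- by rewrite -gA -image_comp.
Qed.

Lemma plane_arc_point f v : f \in edges P ->
  (phi @` edge_arc P f) (phi (vertex_point P v)) -> v \in f.
Proof.
move=> fE [z fz /(congr1 psi)]; rewrite psi_phi_vertex (psi_phi_edge fE fz) => e.
by apply: arc_point fE _; rewrite -e.
Qed.

Lemma plane_arc_cross f g : f \in edges P -> g \in edges P -> f != g ->
  (phi @` edge_arc P f) `&` (phi @` edge_arc P g) `<=` range (fun v => phi (vertex_point P v)).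
Proof.
move=> fE gE fg _ [[z fz <-] [w gw /(congr1 psi)]].
rewrite (psi_phi_edge fE fz) (psi_phi_edge gE gw) => e; rewrite e in gw.
by have [v _ <-] := arc_cross fE gE fg (conj fz gw); exists v.
Qed.

Definition plane_of : plane_graph R V :=
  PlaneGraph (edges_card2 (s := P)) plane_point_inj plane_arc plane_arc_point plane_arc_cross.

Lemma sphere_arc p q A : parc p q A -> simple_arc (psi p) (psi q) (psi @` A).
Proof.
case=> g [[cg ig] g0 g1 gA]; exists (psi \o g); split.
- apply/cont_onP; apply: (@cont_on_comp R T S I01 setT g psi) => //.
  by apply: continuous_cont_on; exact: unstereo_continuous.
- move=> s t; rewrite !inE => Is It /= /(congr1 phi); rewrite !stereoK //.
  exact: ig.
- by rewrite /= g0.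
- by rewrite /= g1.
- by rewrite -gA -image_comp.
Qed.

Section AddEdge.
Variables (u v : V) (A : set T).
Hypotheses (uv : u != v) (uvE : ed u v \notin edges P).
Hypothesis pA : parc (phi (vertex_point P u)) (phi (vertex_point P v)) A.
Hypothesis KA : A `&` geo plane_of [set: V]%SET (edges P) `<=`
  [set phi (vertex_point P u); phi (vertex_point P v)].

Let E' := (ed u v |: edges P)%SET.
Let arc' (f : {set V}) := if f == ed u v then psi @` A else edge_arc P f.

Let arc'_old f : f \in edges P -> arc' f = edge_arc P f.
Proof. by move=> fE; rewrite /arc'; case: eqP => // e; move: uvE; rewrite -e fE. Qed.

Let E'P f : f \in E' -> f = ed u v \/ f \in edges P.
Proof. by rewrite finset.in_setU1 => /orP[/eqP|]; [left|right]. Qed.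

Let arc'_new : arc' (ed u v) = psi @` A.
Proof. by rewrite /arc' eqxx. Qed.

Let card2' f : f \in E' -> #|f| = 2%N.
Proof. by case/E'P => [->|/edges_card2//]; rewrite cards2 uv. Qed.

Let sphere' f : f \in E' -> arc' f `<=` @sphere2 R.
Proof.
case/E'P => [->|fE]; last by rewrite arc'_old //; exact: arc_sphere.
by rewrite arc'_new => _ [z _ <-]; exact: unstereo_sphere.
Qed.

Let simple' a b : ed a b \in E' -> simple_arc (vertex_point P a) (vertex_point P b) (arc' (ed a b)).
Proof.
case/E'P => [e|abE]; last by rewrite arc'_old //; exact: arc_simple.
rewrite e arc'_new; case: (edE e uv) => -[-> ->].
  by rewrite -(psi_phi_vertex u) -(psi_phi_vertex v); exact: sphere_arc.
by rewrite -(psi_phi_vertex u) -(psi_phi_vertex v); apply: sphere_arc; exact: parc_sym.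
Qed.

Let new_meets_old z : A z -> geo plane_of [set: V]%SET (edges P) z ->
  exists2 w, w \in ed u v & z = phi (vertex_point P w).
Proof.
move=> Az Kz; case: (KA (conj Az Kz)) => ->; [exists u|exists v] => //; by rewrite !inE eqxx ?orbT.
Qed.

Let point' f w : f \in E' -> arc' f (vertex_point P w) -> w \in f.
Proof.
case/E'P => [->|fE]; last by rewrite arc'_old //; exact: arc_point.
rewrite arc'_new => -[z Az zw]; have zE : z = phi (vertex_point P w) by rewrite -zw stereoK.
have [|w' w'uv] := new_meets_old Az; first by left; exists w => //; rewrite finset.in_setT.
by rewrite zE => /plane_point_inj ->.
Qed.

Let cross_new f : f \in edges P -> arc' f `&` (psi @` A) `<=` range (vertex_point P).
Proof.
move=> fE y [fy [z Az zy]]; rewrite arc'_old // -zy in fy *.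
have [|w _ ->] := new_meets_old Az; last by exists w; rewrite ?psi_phi_vertex.
by right; exists f => //; exists (psi z) => //; rewrite stereoK.
Qed.

Let cross' f g : f \in E' -> g \in E' -> f != g -> arc' f `&` arc' g `<=` range (vertex_point P).
Proof.
case/E'P => [->|fE]; case/E'P => [->|gE] fg.
- by rewrite eqxx in fg.
- by rewrite arc'_new setIC; exact: cross_new.
- by rewrite arc'_new; exact: cross_new.
- by rewrite !arc'_old //; exact: arc_cross.
Qed.

(** The inverse projection places the new arc on the sphere. The plane arc meets the old drawing
    only at its ends, so this is a proper extension of [P]. *)
Lemma extend_edge : exists2 Q, sphere_extends P Q & edges Q <> edges P.
Proof.
exists (SphereGraph card2' (point_sphere P) (@point_inj _ _ P) sphere' simple' point' cross').
  by split=> /=; [exact: finset.subsetUr|by []|exact: arc'_old].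
by move=> /= e; move: uvE; rewrite -e finset.in_setU1 eqxx.
Qed.

End AddEdge.

Lemma plane_of_maximal : triangulation P -> maximal_plane plane_of.
Proof.
move=> [_ hmax] u v uv uvE [A pA KA].
by have [Q /hmax] := extend_edge uv uvE pA KA.
Qed.

End Transfer.

Theorem plane_model (V : finType) (P : sphere_graph R V) : triangulation P ->
  exists G : plane_graph R V, pe G = edges P /\ maximal_plane G.
Proof.
move=> hP; have [N [SN NV NE]] := sphere_off_arcs P.
by exists (plane_of SN NV NE); split=> //; exact: plane_of_maximal.
Qed.

End Stereographic.

(** * Pieces of a braced triangulation *)

Lemma double_count (I J : finType) (A : {set I}) (B : {set J}) (r : I -> J -> bool) :
  (\sum_(i in A) #|[set j in B | r i j]%SET| = \sum_(j in B) #|[set i in A | r i j]%SET|)%N.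
Proof.
have h (K : finType) (C : {set K}) (p : pred K) : #|[set k in C | p k]%SET| = (\sum_(k in C | p k) 1)%N.
  by rewrite sum1dep_card; apply: eq_card => k; rewrite !inE.
rewrite (eq_bigr (fun i => \sum_(j in B | r i j) 1)%N); last by move=> i _; exact: h.
rewrite (exchange_big_dep (mem B)) /=; last by move=> i j _ /andP[].
apply: eq_bigr => j jB; rewrite h; apply: eq_bigl => i.
by rewrite jB.
Qed.

Section Configurations.
Local Open Scope set_scope.
Local Open Scope nat_scope.
Variables (V : finType) (E : {set {set V}}).
Implicit Types (X A : {set V}) (M : {set {set V}}) (H : {set V * V}) (D : V -> {set V}).

Definition ind X := [set f in E | f \subset X].
Definition cyc X (f : {set V}) := [set T in cycles3 E | (f \subset T) && (T \subset X)].
Definition tight X := 3 * #|X| <= #|ind X| + 6.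

(** From here on the argument is combinatorial: these four facts are all that is used of
    planarity. *)
Hypothesis E2 : forall f, f \in E -> #|f| = 2.
Hypothesis sparse : forall X, 3 <= #|X| -> #|ind X| + 6 <= 3 * #|X|.
Hypothesis two_cycles : forall X f, 4 <= #|X| -> tight X -> f \in ind X -> 2 <= #|cyc X f|.
Hypothesis separating : forall X f, 4 <= #|X| -> tight X -> f \in ind X -> 3 <= #|cyc X f| ->
  exists S X1 X2 : {set V}, [/\ S \in cycles3 E, f \subset S,
    X1 :|: X2 = X /\ X1 :&: X2 = S, S \proper X1 /\ S \proper X2 &
    forall a b, a \in X1 :\: S -> b \in X2 :\: S -> ed a b \notin E].

Definition nbr z := [set y | ed y z \in E].

(** The trace of a 3-cycle x, y, z with the brace xz: its third side yz is an edge, recorded by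
    [D z], or a brace too. The relation is not symmetric, so it is used for both orders of the
    ends. *)
Definition served H D x y := exists z, (x, z) \in H /\ (y \in D z \/ (y, z) \in H).

(* H consists of the half braces (x, z) with x in X; the other end z may have been separated
   from X, and then D z is the marked 3-cycle that replaces its neighbours. *)
Definition config X M H D := [/\ 4 <= #|X| /\ tight X,
  forall m, m \in M -> m \in cycles3 E /\ m \subset X,
  forall x z, (x, z) \in H -> [/\ x \in X, x != z & ed x z \notin E],
  forall z, (z \in X -> D z = nbr z) /\ (z \notin X -> D z \in M) &
  forall x y, x \in X -> y \in X -> ed x y \in E ->
    [\/ exists2 m, m \in M & ed x y \subset m, 3 <= #|cyc X (ed x y)| |
        served H D x y \/ served H D y x]].

Lemma edge_ends X f : f \in ind X -> exists x y, [/\ x != y, x \in X, y \in X, f = ed x y & f \in E].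
Proof.
rewrite inE => /andP[fE fX]; have /cards2P[x [y [xy e]]] : #|f| == 2 by rewrite E2.
by move: fX; rewrite e finset.subUset !finset.sub1set -e => /andP[? ?]; exists x, y.
Qed.

Lemma cycle_edge T x y : T \in cycles3 E -> x \in T -> y \in T -> x != y -> ed x y \in E.
Proof.
move=> /cycles3P[_ h] xT yT xy; apply: h; first by rewrite cards2 xy.
by rewrite finset.subUset !finset.sub1set xT.
Qed.

Lemma card_ind_cycle T : T \in cycles3 E -> #|ind T| = 3.
Proof.
move=> /cycles3P[T3 h]; have -> : 3 = 'C(#|T|, 2) by rewrite T3.
rewrite -cards_draws; apply: eq_card => f; rewrite !inE andbC.
have [fT|//] := boolP (f \subset T); apply/idP/eqP => [/E2//|f2].
by rewrite andTb h.
Qed.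

Lemma sum_ind X : \sum_(f in ind X) #|cyc X f| = #|[set T in cycles3 E | T \subset X]| * 3.
Proof.
rewrite -sum_nat_const; under [RHS]eq_bigr => T do rewrite inE.
rewrite (eq_bigr (fun f : {set V} => #|[set T in [set T in cycles3 E | T \subset X] | f \subset T]|)).
  rewrite -(double_count _ _ (fun T f : {set V} => f \subset T)); apply: eq_big => T; first by rewrite inE.
  rewrite inE => /andP[T3 TX]; rewrite -(card_ind_cycle T3); apply: eq_card => f; rewrite !inE -andbA.
  congr andb; have [fT|] := boolP (f \subset T); rewrite ?andbF ?andbT //.
  exact: fintype.subset_trans fT TX.
move=> f _; apply: eq_card => T; rewrite !inE -!andbA; congr andb.
by congr andb; rewrite andbC.
Qed.

Lemma base_case X M H D : config X M H D -> (forall f, f \in ind X -> #|cyc X f| <= 2) ->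
  2 * #|X| + 8 <= 7 * #|M| + 11 * #|H|.
Proof.
move=> [[X4 tX] hM hH hD cover] c2.
pose A := [set x | [exists z, (x, z) \in H]].
have AP x : reflect (exists z, (x, z) \in H) (x \in A) by rewrite inE; exact: existsP.
have AX : A \subset X by apply/fintype.subsetP => x /AP[z /hH[]].
have cA : #|A| <= #|H|.
  apply: leq_trans (leq_imset_card fst H); apply: subset_leq_card; apply/fintype.subsetP => x /AP[z xz].
  by apply/imsetP; exists (x, z).
pose ME := [set f in E | [exists m in M, f \subset m]].
have cME : #|ME| <= 3 * #|M|.
  have -> : 3 * #|M| = \sum_(m in M) #|[set f in ME | f \subset m]|.
    rewrite mulnC -sum_nat_const; apply: eq_bigr => m mM; have [m3 _] := hM m mM.
    rewrite -(card_ind_cycle m3); apply: eq_card => f; rewrite !inE.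
    have [fm|_] := boolP (f \subset m); rewrite ?andbF ?andbT //.
    by rewrite (_ : [exists m0 in M, _] = true) ?andbT //; apply/existsP; exists m; rewrite mM.
  rewrite (double_count _ _ (fun m f : {set V} => f \subset m)) -sum1_card; apply: leq_sum => f.
  rewrite inE => /andP[_ /existsP[m /andP[mM fm]]].
  by apply/card_gt0P; exists m; rewrite inE mM.
pose C := [set T in cycles3 E | T \subset X].
have C1 : 2 * #|X| <= #|C| + 4.
  have : #|ind X| * 2 <= #|C| * 3.
    by rewrite -sum_ind -sum_nat_const; apply: leq_sum => f; exact: two_cycles.
  by move: tX; rewrite /tight; lia.
have C2 : #|C| <= 2 * (#|ME| + #|ind A|).
  have MX f : f \in ME -> f \in ind X.
    rewrite !inE => /andP[-> /existsP[m /andP[mM fm]]] /=.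
    by case: (hM m mM) => _; exact: fintype.subset_trans.
  have AiX f : f \in ind A -> f \in ind X.
    by rewrite !inE => /andP[-> fA]; exact: fintype.subset_trans fA AX.
  apply: leq_trans (_ : 2 * #|ME :|: ind A| <= _); last by rewrite leq_mul2l leq_card_setU.
  rewrite mulnC -sum_nat_const; apply: leq_trans (_ : \sum_(f in ME :|: ind A) #|cyc X f| <= _); last first.
    by apply: leq_sum => f; rewrite finset.in_setU => /orP[/MX|/AiX]; exact: c2.
  rewrite (eq_bigr (fun f : {set V} => #|[set T in C | f \subset T]|)); last first.
    by move=> f _; apply: eq_card => T; rewrite !inE -!andbA; congr andb; congr andb; rewrite andbC.
  rewrite -(double_count _ _ (fun T f : {set V} => f \subset T)) -sum1_card; apply: leq_sum => T.
  rewrite inE => /andP[T3 TX]; have TXP := fintype.subsetP TX.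
  have [cT _] := (cycles3P _ _).1 T3.
  suff [f [fF fT]] : exists f, f \in ME :|: ind A /\ f \subset T.
    by apply/card_gt0P; exists f; rewrite inE fF.
  have edT x y : x \in T -> y \in T -> ed x y \subset T.
    by move=> xT yT; rewrite finset.subUset !finset.sub1set xT.
  (* In a 3-cycle without a marked edge, any two vertices include one of [A], so two of the three
     vertices are in [A] and span an edge. *)
  have step x y : x \in T -> y \in T -> x != y ->
      (exists f, f \in ME :|: ind A /\ f \subset T) \/ (x \in A \/ y \in A).
    move=> xT yT xy; have xyE := cycle_edge T3 xT yT xy.
    case: (cover x y (TXP _ xT) (TXP _ yT) xyE) => [[m mM xm]|h3|].
    - left; exists (ed x y); split; last exact: edT.
      by rewrite !inE xyE; apply/orP; left; apply/existsP; exists m; rewrite mM.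
    - move: h3; rewrite ltnNge c2 // inE xyE; exact: fintype.subset_trans (edT _ _ xT yT) TX.
    - by case=> -[z [h _]]; right; [left|right]; apply/AP; exists z.
  have inA x y : x \in T -> y \in T -> x != y -> x \in A -> y \in A ->
      exists f, f \in ME :|: ind A /\ f \subset T.
    move=> xT yT xy xA yA; exists (ed x y); split; last exact: edT.
    rewrite finset.in_setU; apply/orP; right; rewrite inE (cycle_edge T3 xT yT xy).
    by rewrite finset.subUset !finset.sub1set xA.
  have [x [y [z [[xT yT zT] [xy yz zx]]]]] : exists x y z, [/\ x \in T, y \in T & z \in T] /\ [/\ x != y, y != z & z != x].
    by apply/card_gt2P; rewrite cT.
  case: (step x y xT yT xy) => //; case: (step y z yT zT yz) => //; case: (step z x zT xT zx) => //.
  by move=> [h1|h1] [h2|h2] [h3|h3]; solve [exact: (inA x y)|exact: (inA y z)|exact: (inA z x)].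
have iA0 : #|A| <= 1 -> #|ind A| = 0.
  move=> A1; apply: eq_card0 => f; apply/negP => /edge_ends[x [y [xy xA yA _ _]]].
  by move: A1; rewrite leqNgt => /negP; apply; apply/card_gt1P; exists x, y.
have iA1 : #|A| = 2 -> #|ind A| <= 1.
  move=> A2; have : #|ind A| <= 'C(#|A|, 2); last by rewrite A2.
  rewrite -cards_draws; apply: subset_leq_card; apply/fintype.subsetP => f.
  by rewrite !inE => /andP[/E2 -> ->].
have iA3 := @sparse A.
(* For |A| = 1 the count gives 2|X| <= 6|M| + 4, which suffices since |X| >= 4 excludes |M| = 0.
   Only an empty [A] needs a better count. *)
have [A3|A3] := leqP 3 #|A|; first by have := iA3 A3; lia.
have [A2|A2] := leqP 2 #|A|; first by have := iA1 ltac:(lia); lia.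
have i0 := iA0 ltac:(lia); have [A0|A1] := posnP #|A|; last by lia.
(* Without half braces every edge is marked, so 3|X| - 6 <= 3|M|. This settles |M| >= 3 and leaves
   |M| = 2, |X| = 4. *)
have all_marked : ind X \subset ME.
  apply/fintype.subsetP => f /edge_ends[x [y [xy xX yX e fE]]]; rewrite e in fE *.
  have noA z w : (z, w) \notin H.
    apply/negP => h; have : z \in A by apply/AP; exists w.
    by move/eqP: A0; rewrite cards_eq0 => /eqP ->; rewrite inE.
  case: (cover x y xX yX fE) => [[m mM xm]|h3|].
  - by rewrite inE fE; apply/existsP; exists m; rewrite mM.
  - move: h3; rewrite ltnNge c2 // inE fE finset.subUset !finset.sub1set xX yX //.
  - by case=> -[z [h _]]; move: (noA x z) (noA y z); rewrite h.
have := subset_leq_card all_marked; move: tX; rewrite /tight => tX c1.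
have [M3|M3] := leqP 3 #|M|; first by lia.
have M2 : #|M| = 2 by lia.
have X44 : #|X| = 4 by lia.
(* Two 3-cycles on four vertices share an edge, so they cover at most five of the six edges. *)
exfalso; have /cards2P[m1 [m2 [m12 eM]]] : #|M| == 2 by rewrite M2.
have [m1M m2M] : m1 \in M /\ m2 \in M by rewrite eM !inE !eqxx orbT.
have [c1' m1X] := hM _ m1M; have [c2' m2X] := hM _ m2M.
have sub : ME \subset ind m1 :|: ind m2.
  apply/fintype.subsetP => f; rewrite !inE => /andP[-> /existsP[m /andP[]]] /=.
  by rewrite eM !inE => /orP[]/eqP -> ->; rewrite ?orbT.
have : 0 < #|ind m1 :&: ind m2|.
  have h12 : 2 <= #|m1 :&: m2|.
    have := subset_leq_card (_ : m1 :|: m2 \subset X); rewrite finset.subUset m1X m2X => /(_ isT).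
    have := cardsUI m1 m2; have [-> _] := (cycles3P _ _).1 c1'; have [-> _] := (cycles3P _ _).1 c2'.
    by move: X44; clear; lia.
  have /card_gt1P[x [y [xm ym xy]]] := h12.
  apply/card_gt0P; exists (ed x y); move: xm ym; rewrite !inE => /andP[x1 x2] /andP[y1 y2].
  by rewrite (cycle_edge c1' x1 y1 xy) !finset.subUset !finset.sub1set x1 x2 y1 y2.
have := cardsUI (ind m1) (ind m2); rewrite (card_ind_cycle c1') (card_ind_cycle c2').
by have := subset_leq_card sub; move: c1 tX X44; clear; lia.
Qed.

(** * Cutting a configuration along a 3-cycle *)

Section Split.
Variables (X X1 X2 S : {set V}).
Hypotheses (S3 : S \in cycles3 E) (XU : X1 :|: X2 = X) (XI : X1 :&: X2 = S).
Hypothesis cross : forall a b, a \in X1 :\: S -> b \in X2 :\: S -> ed a b \notin E.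

Let SX1 : S \subset X1. Proof. by rewrite -XI finset.subsetIl. Qed.
Let SX2 : S \subset X2. Proof. by rewrite -XI finset.subsetIr. Qed.
Let X1X : X1 \subset X. Proof. by rewrite -XU finset.subsetUl. Qed.
Let X2X : X2 \subset X. Proof. by rewrite -XU finset.subsetUr. Qed.

Lemma adjacent_side a b : a \in X1 -> b \in X2 -> ed a b \in E -> a \in S \/ b \in S.
Proof.
move=> aX bX abE; have [aS|aS] := boolP (a \in S); [by left|right].
apply/negPn/negP => bS; have := @cross a b; rewrite !finset.in_setD aS bS aX bX abE.
by move=> /(_ isT isT).
Qed.

Lemma clique_side (Y : {set V}) : Y \subset X ->
  (forall a b, a \in Y -> b \in Y -> a != b -> ed a b \in E) -> Y \subset X1 \/ Y \subset X2.
Proof.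
move=> YX cl; have [h|/subsetPn[a aY aX1]] := boolP (Y \subset X1); first by left.
right; apply/fintype.subsetP => b bY; apply/negPn/negP => bX2.
have aX2 : a \in X2 by have := fintype.subsetP YX _ aY; rewrite -XU inE (negbTE aX1).
have bX1 : b \in X1 by have := fintype.subsetP YX _ bY; rewrite -XU inE (negbTE bX2) orbF.
have ba : b != a by apply: contraNneq aX1 => <-.
case: (adjacent_side bX1 aX2 (cl b a bY aY ba)) => [/(fintype.subsetP SX2)|/(fintype.subsetP SX1)] h.
  by rewrite h in bX2.
by rewrite h in aX1.
Qed.

Lemma cycle_side T : T \in cycles3 E -> T \subset X -> T \subset X1 \/ T \subset X2.
Proof.
by move=> T3 TX; apply: clique_side TX _ => a b aT bT ab; exact: cycle_edge T3 aT bT ab.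
Qed.

Lemma ind_split : ind X = ind X1 :|: ind X2 /\ ind X1 :&: ind X2 = ind S.
Proof.
split; apply/setP => f; rewrite !inE; last first.
  by rewrite -XI finset.subsetI; case: (f \in E).
have [fE|//] := boolP (f \in E) => /=; apply/idP/orP; last first.
  by case=> h; apply: fintype.subset_trans h _.
move=> fX; apply: clique_side => // a b af bf ab.
rewrite (_ : ed a b = f) //; apply/eqP; rewrite eqEcard cards2 ab (E2 fE) leqnn andbT.
by rewrite finset.subUset !finset.sub1set af.
Qed.

(** Vertices and edges add up apart from the three vertices and three edges of [S]. As [X2] spans at
    most 3|X2| - 6 edges, [X1] has to attain its own bound. *)
Lemma tight_split : 3 <= #|X1| -> 3 <= #|X2| -> tight X -> tight X1.
Proof.
move=> X13 X23; have [e1 e2] := ind_split; have := cardsUI (ind X1) (ind X2).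
rewrite -e1 e2 (card_ind_cycle S3); have := cardsUI X1 X2.
rewrite XU XI; have [-> _] := (cycles3P _ _).1 S3.
by have := sparse X23; rewrite /tight; clear; lia.
Qed.

Variables (M : {set {set V}}) (H : {set V * V}) (D : V -> {set V}).
Hypothesis cfg : config X M H D.

(** A vertex that an earlier cut removed is located by its mark [D z], which, as a 3-cycle, lies in
    one of the parts. *)
Definition side (Y : {set V}) z := if z \in X then z \in Y else D z \subset Y.
Definition half_M (Y : {set V}) := S |: [set m in M | m \subset Y].
(** A half brace that starts off [S] follows its start. One that starts in [S] is kept in [Y] only
    if its other end is not on the side of [Z]. Since every [z] is on some side, no half brace goes
    to both parts. *)
Definition half_H (Y Z : {set V}) :=
  [set p in H | (p.1 \in Y :\: S) || ((p.1 \in S) && ~~ side Z p.2)].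
(** When [z] is not on the side of [Y], the vertices of [Y] in [D z] all lie in [S], so the new mark
    [S] can replace [D z]. *)
Definition half_D (Y : {set V}) z := if side Y z then D z else S.

Lemma side_or z : side X1 z \/ side X2 z.
Proof.
have [_ hM _ hD _] := cfg; rewrite /side; case: ifP => zX.
  by move: zX; rewrite -XU inE => /orP.
have [_ /(_ (negbT zX))/hM[m3 mX]] := hD z.
exact: cycle_side.
Qed.

Lemma config_split : 4 <= #|X1| -> 3 <= #|X2| ->
  config X1 (half_M X1) (half_H X1 X2) (half_D X1).
Proof.
move=> X14 X23; have [[X4 tX] hM hH hD cover] := cfg.
have tX1 := tight_split (ltnW X14) X23 tX.
have cS x y : x \in S -> y \in S -> x != y -> ed x y \in E by exact: cycle_edge.
have inS z : z \in X1 -> z \in X2 -> z \in S by move=> h1 h2; rewrite -XI inE h1.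
have nb z y : (y \in nbr z) = (ed y z \in E) by rewrite inE.
split=> //.
- move=> m /finset.setU1P[->|]; first by split.
  by rewrite inE => /andP[/hM[m3 _] ->].
- move=> x z; rewrite inE /= => /andP[/hH[xX xz nxz] h]; split=> //.
  by case/orP: h => [|/andP[/(fintype.subsetP SX1)//]]; rewrite finset.in_setD => /andP[].
- move=> z; rewrite /half_D /side; split=> zX1.
    by rewrite (fintype.subsetP X1X _ zX1) zX1; case: (hD z) => -> //; exact: (fintype.subsetP X1X).
  have SM : S \in half_M X1 by rewrite finset.setU11.
  case zX : (z \in X); first by rewrite (negbTE zX1).
  case: ifP => // DzX.
  have [_ /(_ (negbT zX)) DM] := hD z.
  by rewrite finset.in_setU1; apply/orP; right; rewrite inE DM.
move=> x y xX1 yX1 xyE.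
have xX := fintype.subsetP X1X _ xX1; have yX := fintype.subsetP X1X _ yX1.
have xyX1 : ed x y \subset X1 by rewrite finset.subUset !finset.sub1set xX1.
have [xyS|nS] := boolP (ed x y \subset S); first by constructor 1; exists S; rewrite ?finset.setU11.
have not_both : ~ (x \in S /\ y \in S).
  by move=> [xS yS]; move: nS; rewrite finset.subUset !finset.sub1set xS yS.
(* A half brace that is not kept starts in [S], and its start still belongs to [half_D X1 z]. So [a]
   can take the part of the vertex that is merely adjacent to [z]. *)
have dropped a z : a \in X1 -> (a, z) \in H -> (a, z) \notin half_H X1 X2 -> a \in S /\ side X2 z /\ a \in half_D X1 z.
  move=> aX1 az; rewrite inE az /= negb_or finset.in_setD aX1 andbT negbK negb_and negbK.
  move=> /andP[aS]; rewrite aS /= => z2; split=> //; split=> //.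
  rewrite /half_D; case: ifP => // z1; have [aX az' naz] := hH a z az.
  move: z1 z2; rewrite /side; case: ifP => zX z1 z2.
    by move: naz; rewrite (cS a z aS (inS _ z1 z2) az').
  have [_ /(_ (negbT zX))/hM[m3 _]] := hD z.
  rewrite (_ : D z = S) //; apply/eqP; rewrite eqEcard.
  have [-> _] := (cycles3P _ _).1 m3; have [-> _] := (cycles3P _ _).1 S3.
  by rewrite leqnn andbT -XI finset.subsetI z1 z2.
(* If [(a, z)] is kept, it still serves the edge. If not, [b] is off [S] and cannot be in [D z], so
   [(b, z)] is a half brace, which is kept and serves the edge in the opposite order. *)
have near a b z : a \in X1 -> b \in X1 -> ed a b \in E -> ~ (a \in S /\ b \in S) ->
    (a, z) \in H -> (b \in D z \/ (b, z) \in H) ->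
    served (half_H X1 X2) (half_D X1) a b \/ served (half_H X1 X2) (half_D X1) b a.
  move=> aX1 bX1 abE nab az hb.
  have [az1|az1] := boolP ((a, z) \in half_H X1 X2).
    left; exists z; split=> //; case: hb => [bz|bz]; last first.
      have [|bz1] := boolP ((b, z) \in half_H X1 X2); [by right|left].
      by have [_ [_ ]] := dropped b z bX1 bz bz1.
    left; rewrite /half_D; case: ifP => // nz1.
    case: (side_or z) => [|z2]; first by rewrite nz1.
    move: nz1 z2; rewrite /side; case: ifP => zX nz1 z2; last exact: inS _ (fintype.subsetP z2 _ bz).
    have [/(_ zX) eD _] := hD z; rewrite eD nb in bz.
    case: (adjacent_side bX1 z2 bz) => // zS.
    by rewrite (fintype.subsetP SX1 _ zS) in nz1.
  have [aS [z2 aD]] := dropped a z aX1 az az1.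
  have bS : b \notin S by apply/negP => bS; apply: nab.
  case: hb => bz.
    exfalso; have [aX az' naz] := hH a z az; move: z2; rewrite /side; case: ifP => zX z2.
      have [/(_ zX) eD _] := hD z; rewrite eD nb in bz.
      case: (adjacent_side bX1 z2 bz) => [bS'|zS]; first by rewrite bS' in bS.
      by move: naz; rewrite (cS a z).
    by move/negP: bS; apply; apply: inS => //; exact: (fintype.subsetP z2).
  right; exists z; split; last by left.
  by rewrite inE bz finset.in_setD bS bX1.
case: (cover x y xX yX xyE) => [[m mM xym]|h3|].
- constructor 1; have [m3 mX] := hM m mM; case: (cycle_side m3 mX) => mi.
    by exists m => //; rewrite finset.in_setU1 inE mM mi orbT.
  by exfalso; move/negP: nS; apply; rewrite -XI finset.subsetI xyX1; exact: fintype.subset_trans xym mi.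
- constructor 2; apply: leq_trans h3 _; apply: subset_leq_card; apply/fintype.subsetP => T.
  rewrite finset.in_set => /andP[T3 /andP[xyT TX]]; rewrite finset.in_set T3 xyT /=.
  case: (cycle_side T3 TX) => // T2; exfalso; move/negP: nS; apply.
  by rewrite -XI finset.subsetI xyX1; exact: fintype.subset_trans xyT T2.
- case=> -[z [h1 h2]]; constructor 3; first exact: near h1 h2.
  suff : served (half_H X1 X2) (half_D X1) y x \/ served (half_H X1 X2) (half_D X1) x y by case; auto.
  apply: near h1 h2 => //; first by rewrite finset.setUC.
  by case=> ? ?; apply: not_both.
Qed.

End Split.

(** The two extra marks weigh 14 = 8 + 6: the surplus constant and twice the three vertices counted
    twice. *)
Lemma bound_split x x1 x2 m m1 m2 h h1 h2 : x + 3 = x1 + x2 ->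
  2 * x1 + 8 <= 7 * m1 + 11 * h1 -> 2 * x2 + 8 <= 7 * m2 + 11 * h2 ->
  h1 + h2 <= h -> m1 + m2 <= m + 2 -> 2 * x + 8 <= 7 * m + 11 * h.
Proof. lia. Qed.

Lemma bound_final n h b : 2 * n + 8 <= 7 * 0 + 11 * h -> h <= 2 * b -> n <= 11 * b - 4.
Proof. lia. Qed.

Lemma config_bound n X M H D : #|X| < n -> config X M H D -> 2 * #|X| + 8 <= 7 * #|M| + 11 * #|H|.
Proof.
elim: n X M H D => // n IH X M H D; rewrite ltnS => Xn cfg.
have [[X4 tX] hM _ hD _] := cfg.
have [/existsP[f /andP[fX f3]]|/existsPn none] := boolP [exists f, (f \in ind X) && (3 <= #|cyc X f|)]; last first.
  apply: base_case cfg _ => f fX; have := none f.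
  by rewrite fX -leqNgt.
have [S [X1 [X2 [S3 _ [XU XI] [S1 S2] cross]]]] := separating X4 tX fX f3.
have [cS _] := (cycles3P _ _).1 S3.
have c1 : 4 <= #|X1| by rewrite -cS; exact: proper_card.
have c2 : 4 <= #|X2| by rewrite -cS; exact: proper_card.
have cross' a b : a \in X2 :\: S -> b \in X1 :\: S -> ed a b \notin E.
  by move=> aX bX; rewrite finset.setUC; exact: cross.
have XU' : X2 :|: X1 = X by rewrite finset.setUC.
have XI' : X2 :&: X1 = S by rewrite finset.setIC.
have cX := cardsUI X1 X2; rewrite XU XI cS in cX.
have cfg1 := config_split S3 XU XI cross cfg c1 (ltnW c2).
have cfg2 := config_split S3 XU' XI' cross' cfg c2 (ltnW c1).
have l1 : #|X1| < n by lia.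
have l2 : #|X2| < n by lia.
have b1 := IH _ _ _ _ l1 cfg1; have b2 := IH _ _ _ _ l2 cfg2.
have hH : #|half_H X S H D X1 X2| + #|half_H X S H D X2 X1| <= #|H|.
  rewrite -cardsUI (_ : _ :&: _ = finset.set0) ?cards0 ?addn0.
    apply: subset_leq_card; apply/fintype.subsetP => p; rewrite !inE -andb_orr.
    by move=> /andP[].
  apply/setP => p; rewrite [RHS]inE; apply/negbTE; apply/negP.
  rewrite !inE => /andP[/andP[_ h1] /andP[_ h2]].
  have so := side_or XU XI cross cfg p.2.
  move: h1 h2; have [pS|pS] /= := boolP (p.1 \in S).
    by case: so => ->.
  rewrite !orbF => p1 p2; move: pS; rewrite -XI inE p1 p2 //.
(* A mark inside both parts is contained in [S], hence equal to it, so only [S] is counted twice. *)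
have hM' : #|half_M S M X1| + #|half_M S M X2| <= #|M| + 2.
  have := cardsUI (half_M S M X1) (half_M S M X2).
  have : #|half_M S M X1 :|: half_M S M X2| <= #|M| + 1.
    apply: leq_trans (_ : #|S |: M| <= _).
      apply: subset_leq_card; apply/fintype.subsetP => m; rewrite !inE.
      by case: (m == S) => //= /orP[] /andP[].
    by rewrite cardsU1 addnC leq_add2l leq_b1.
  have : #|half_M S M X1 :&: half_M S M X2| <= 1.
    rewrite -(cards1 S); apply: subset_leq_card; apply/fintype.subsetP => m; rewrite !inE.
    case: eqP => //= mS /andP[/andP[mM m1] /andP[_ m2]]; exfalso; apply: mS.
    apply/eqP; rewrite eqEcard -XI finset.subsetI m1 m2 /= XI cS.
    by have [/cycles3P[-> _] _] := hM m mM.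
  by lia.
exact: bound_split cX b1 b2 hH hM'.
Qed.

End Configurations.

Lemma half_braces_le (V : finType) (B : {set {set V}}) :
  (forall f, f \in B -> #|f| = 2%N) ->
  (#|[set p : V * V | ed p.1 p.2 \in B]%SET| <= 2 * #|B|)%N.
Proof.
move=> B2; set H := [set p | _]%SET.
apply: leq_trans (_ : \sum_(f in B) #|[set p in H | ed p.1 p.2 == f]%SET| <= _)%N.
  rewrite -(double_count H B (fun p f => ed p.1 p.2 == f)) -sum1_card; apply: leq_sum => p.
  by rewrite inE => pB; apply/card_gt0P; exists (ed p.1 p.2); rewrite inE pB /=.
rewrite mulnC -sum_nat_const; apply: leq_sum => f /B2/eqP/cards2P[u [v [uv ->]]].
apply: leq_trans (_ : #|[set (u, v); (v, u)]%SET| <= 2)%N; last by rewrite cards2; case: (_ != _).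
apply: subset_leq_card; apply/fintype.subsetP => -[a b]; rewrite !inE /= => /andP[_ /eqP e].
by case: (edE e uv) => -[-> ->]; rewrite eqxx ?orbT.
Qed.

Theorem theorem2p7 (R : realType) (V : finType) (P : sphere_graph R V)
    (B : {set {set V}}) (hP : triangulation P) (hB : braces (edges P) B)
    (hirr : braced_irreducible (edges P) B) (hb : (1 <= #|B|)%N) :
  (#|V| <= 11 * #|B| - 4)%N.
Proof.
have [G [eE Gmax]] := plane_model hP; have [V3 _] := hP.
rewrite -eE in hB hirr; have B2 f (fB : f \in B) := (hB f fB).1.
(* Configurations need four vertices; for three the bound follows from [hb]. *)
have [V4|V4] := leqP #|V| 3; first by lia.
have indT : ind (pe G) [set: V]%SET = pe G.
  by apply/setP => f; rewrite inE finset.subsetT andbT.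
have tT : tight (pe G) [set: V]%SET.
  by rewrite /tight indT cardsT; exact: maximal_tight.
pose H := [set p : V * V | ed p.1 p.2 \in B]%SET.
have sparse (X : {set V}) : (3 <= #|X| -> #|ind (pe G) X| + 6 <= 3 * #|X|)%N.
  by move=> X3; have [] := indE_faces G X3.
have two_cycles (X f : {set V}) : (4 <= #|X|)%N -> tight (pe G) X -> f \in ind (pe G) X ->
    (2 <= #|cyc (pe G) X f|)%N.
  move=> X4 tX fX; have [T1 [T2 [T12 [c1 c2] [f1 f2] [x1 x2]]]] := tight_two_cycles X4 tX fX.
  by apply/card_gt1P; exists T1, T2; split=> //; rewrite finset.in_set ?c1 ?c2 ?f1 ?f2.
have separating (X f : {set V}) : (4 <= #|X|)%N -> tight (pe G) X -> f \in ind (pe G) X ->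
    (3 <= #|cyc (pe G) X f|)%N -> exists S X1 X2 : {set V}, [/\ S \in cycles3 (pe G), f \subset S,
    X1 :|: X2 = X /\ X1 :&: X2 = S, S \proper X1 /\ S \proper X2 &
    forall a b, a \in X1 :\: S -> b \in X2 :\: S -> ed a b \notin pe G]%SET.
  exact: tight_separating.
suff cfg : config (pe G) [set: V]%SET finset.set0 H (nbr (pe G)).
  have := config_bound (@pe2 _ _ G) sparse two_cycles separating (ltnSn _) cfg.
  by rewrite cardsT cards0 => h; apply: bound_final h (half_braces_le B2).
split.
- by rewrite cardsT.
- by move=> m; rewrite inE.
- move=> x z; rewrite inE /= => xzB; have [xz2 xzE] := hB _ xzB; split=> //.
  by move: xz2; rewrite cards2; case: eqP.
- by move=> z; split; rewrite ?finset.in_setT.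
move=> x y _ _ xyE; have xy := ed_neq xyE.
have [h3|h3] := leqP 3 #|cyc (pe G) [set: V]%SET (ed x y)|; first by constructor 2.
constructor 3.
have h2 := two_cycles [set: V]%SET (ed x y) ltac:(by rewrite cardsT) tT ltac:(by rewrite indT).
(* An edge in exactly two 3-cycles is contractible in the triangulation, so by irreducibility it
   lies in a 3-cycle with a brace. That brace joins the third vertex [z] to [x] or [y], which gives
   the half brace that serves the edge. *)
have con : contractible (pe G) (ed x y).
  split=> //; apply/eqP; rewrite eqn_leq; apply/andP; split.
    rewrite -ltnS; apply: leq_ltn_trans h3; apply: subset_leq_card; apply/fintype.subsetP => T.
    by rewrite !finset.in_set finset.subsetT andbT.
  apply: leq_trans h2 _; apply: subset_leq_card; apply/fintype.subsetP => T.
  by rewrite !finset.in_set finset.subsetT andbT.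
have [T [g [T3 xyT gB gT]]] : exists T g : {set V}, [/\ T \in cycles3 (pe G :|: B)%SET,
    ed x y \subset T, g \in B & g \subset T].
  by apply: contrapT => no; apply: (hirr _ xyE).
have /cycles3P[cT hT] := T3.
have [xT yT] : x \in T /\ y \in T by move: xyT; rewrite finset.subUset !finset.sub1set => /andP[].
have [z [xz yz eT]] := pair_third cT xy xT yT.
have inH a b : ed a b \in B -> (a, b) \in H by rewrite inE.
have zT : z \in T by rewrite eT !inE eqxx orbT.
have near a : a != z -> a \in T -> a \in nbr (pe G) z \/ (a, z) \in H.
  move=> az aT; have : ed a z \in (pe G :|: B)%SET.
    by apply: hT; [rewrite cards2 az|rewrite finset.subUset !finset.sub1set aT].
  by rewrite finset.in_setU => /orP[h|/inH]; [left; rewrite inE|right].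
rewrite eT in gT; case: (pair_in_triple (B2 g gB) gT) => eg; rewrite eg in gB.
- by have [_] := hB _ gB; rewrite xyE.
- by left; exists z; split; [exact: inH|exact: near].
- by right; exists z; split; [exact: inH|exact: near].
Qed.
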